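(* Let $N=1$. Let $V\in C(\mathbb{R})$ satisfy: - $\inf_{x\in\mathbb{R}}V(x)=V_0$ for some $V_0>0$; - there exists $V_\infty>0$ such that $\lim_{|x|\to\infty}V(x)=V_\infty$; - $V(-x)=V(x)$ for all $x\in\mathbb{R}$; - there exist $\alpha\in(2\sqrt{V_\infty},\infty)$ and $\kappa>0$ such that $V(x)\le V_\infty+\kappa e^{-\alpha|x|}$ for all $x\in\mathbb{R}$. Let $f\in C(\mathbb{R})$ with $f(s)=0$ for all $s\le0$, and suppose: - there exists $p\in(2,\infty)$ such that $\lim_{s\to0^+}\frac{f(s)}{s^{p-1}}=1$; - there exists $s_2>0$ such that $\frac{f(s)}{s}$ is nondecreasing in $(0,s_2)$. Then there exist $\lambda_0=\lambda_0(V,f)>0$, $C_0=C_0(V_\infty,p)>0$ and $\widetilde C_0=\widetilde C_0(V_\infty,p)>0$ (depending only on the indicated quantities) such that if the inequalities $\lambda\ge\lambda_0$ and $$-C_0+\frac{\widetilde C_0\,\kappa\,\alpha}{\alpha^2-4V_\infty}<0$$ hold, then the problem $$-u''+V(x)u=\lambda f(u)\quad\text{in }\mathbb{R},\qquad u\in H^1(\mathbb{R}),$$ admits an even positive solution $u_\lambda$.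
   Context: Positive solution means a solution $u$ with $u>0$ in $\mathbb{R}$; even means $u(-x)=u(x)$. In particular $C_0$ and $\widetilde C_0$ depend only on the number $V_\infty$ and the exponent $p$, not on $V$ itself. *)

(* Defs.v *)
From HB Require Import structures.
From mathcomp Require Import all_boot all_order all_algebra.
From mathcomp Require Import all_classical all_reals all_analysis.

Set Implicit Arguments.
Unset Strict Implicit.
Unset Printing Implicit Defensive.

Import Order.TTheory GRing.Theory Num.Theory.
Import numFieldNormedType.Exports.

Local Open Scope classical_set_scope.
Local Open Scope ring_scope.

(* phi is in C_c^oo(R). *)
Definition test_function (R : realType) (phi : R -> R) : Prop :=
  (forall (n : nat) (x : R), derivable (derive1n n phi) x 1) /\
  (exists M : R, forall x : R, M < `|x| -> phi x = 0).

Definition L2 (R : realType) (u : R -> R) : Prop :=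
  measurable_fun [set: R] u /\ finite_norm (@lebesgue_measure R) 2%:E u.

Definition weak_derivative (R : realType) (u du : R -> R) : Prop :=
  forall phi : R -> R, test_function phi ->
    \int[@lebesgue_measure R]_x (u x * derive1 phi x)
      = - \int[@lebesgue_measure R]_x (du x * phi x).

(* u belongs to the Sobolev space H^1(R), and du represents u'. *)
Definition H1_derivative (R : realType) (u du : R -> R) : Prop :=
  [/\ L2 u, L2 du & weak_derivative u du].

(* u is in H^1(R) and solves -u'' + V u = lambda f(u) in R in the weak sense.
   An element of H^1(R) has exactly one continuous representative; asking u to
   be that representative is what gives u a value at each point. When V and f
   are continuous, every integrand below is integrable. *)
Definition weak_solution (R : realType) (V f : R -> R) (lambda : R)
    (u : R -> R) : Prop :=
  continuous u /\
  exists2 du : R -> R, H1_derivative u du &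
    forall phi : R -> R, test_function phi ->
      \int[@lebesgue_measure R]_x (du x * derive1 phi x + V x * u x * phi x)
        = lambda * \int[@lebesgue_measure R]_x (f (u x) * phi x).

(* Main.v *)
Require Import Defs.
From HB Require Import structures.
From mathcomp Require Import all_boot all_order all_algebra.
From mathcomp Require Import all_classical all_reals all_analysis.
From mathcomp Require Import ring lra.

Import Order.TTheory GRing.Theory Num.Theory.
Import numFieldNormedType.Exports.

Local Open Scope classical_set_scope.
Local Open Scope ring_scope.

Set Implicit Arguments.
Unset Strict Implicit.
Unset Printing Implicit Defensive.

(** The substitution u = lambda^(-1/(p-2)) w turns the equation into
    -w'' + V w = h(w) with h(s) = L^(p-1) f(s/L) and L = lambda^(1/(p-2)), and
    for large lambda only the values of f near 0 matter: once f is continued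
    by a pure power beyond a small amplitude, h lies between s^(p-1)/b and
    b s^(p-1) with b as close to 1 as desired, and h(s)/s is nondecreasing.
    It remains to solve the equation for such an h, with a sup bound on w that
    is the same for all alpha and kappa; for lambda large this bound stays in
    the range where h still comes from f.

    Even solutions are solutions on the half-line x >= 0 with w'(0) = 0, and
    there the energy E(u) = int_0^oo (u'^2 + V u^2)/2 - H(u) has a natural
    threshold. Write m^2 for the limit of V. The limiting equation
    -w'' + m^2 w = w^(p-1) has an explicit soliton W, and c = int_R (W'^2 +
    m^2 W^2)/2 - W^p/p is the price of a bump that sits far from the origin.
    A function of energy below c cannot move all its mass to infinity.

    - Below the threshold. The competitor is W(x - 1) restricted to x >= 0; its
      even extension is not smooth at 0, but its half-line energy is c minus
      the energy of the tail that was cut off, a gain of at least m t q^2 / 2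
      with q = W(1) and some t > 0 depending on p and m only. The perturbation
      kappa e^(-alpha x) costs at most a multiple of kappa q^2 / (alpha - 2m),
      because W(x - 1) <= q e^(m x). The value q^2 cancels when the two are
      compared, which gives the condition on kappa and alpha; the gain that is
      left over does not depend on them ([soliton_competitor],
      [competitor_energy]).

    - Descent. Call u balanced when it lies on the Nehari set, E'(u)u = 0. Given
      such u, let v solve -v'' + om^2 v = (om^2 - V) u + h(u), v'(0) = 0, where
      om^2 bounds V, and rescale v to a balanced function tau v. Since H is
      convex as a function of s^2, the energy drops by at least
      tau^2 |v - u|^2 / 2 ([energy_step]). Iterating, |v - u| tends to 0, so
      that the iterates are approximate solutions. The explicit Green function
      gives bounds, the slope estimate |v'| <= om v and positivity at each step.

    - Compactness. With Phi'(s)^2 = m^2 s^2 - 2 s^p / p, the integrand of the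
      limiting energy dominates |(Phi o u)'| (the Modica-Mortola trick), so a
      function that rises from a small value to the height of the soliton and
      returns to 0 costs nearly c = 2 Phi(peak). The ray of a balanced function
      culminates at that function, so each iterate can be normalised to this
      height; hence iterates of energy at most c - gain, if b is close to 1,
      stay away from 0 on a fixed interval ([iterates_nonvanishing]).

    - Limit. The iterates are bounded and equi-Lipschitz, so they converge
      locally uniformly along an ultrafilter; the limit is a classical even
      solution, positive because |v'| <= om v is a Harnack inequality, with u
      and u' square integrable ([iterates_limit]). Integration by parts makes
      it a weak solution ([classical_weak_solution]). *)

(** * Primitives on the line *)

Section calculus.
Context {R : realType}.
Implicit Types (f g F : R -> R).

Lemma scaleRE (a b : R) : a *: (b : R^o) = a * b. Proof. by []. Qed.

Definition has_deriv F f := forall x : R, is_derive x 1 F (f x).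

Lemma le_of_deriv_ge0 F f (a b : R) : a <= b ->
  (forall x : R, a <= x <= b -> is_derive x 1 F (f x)) ->
  (forall x : R, a < x < b -> 0 <= f x) -> F a <= F b.
Proof.
move=> ab dF f0; move: ab; rewrite le_eqVlt => /predU1P[->//|ab].
have [||c] := @MVT R F f a b ab.
- by move=> x /[!in_itv]/= /andP[ax xb]; apply: dF; rewrite !ltW.
- apply: derivable_within_continuous => x /[!in_itv]/= xab.
  by apply: ex_derive; exact: dF.
rewrite in_itv/= => cab FE; rewrite -subr_ge0 FE mulr_ge0 ?f0// subr_ge0 ltW//.
Qed.

Lemma has_deriv_continuous F f : has_deriv F f -> continuous F.
Proof.
move=> dF x; apply: differentiable_continuous; apply/derivable1_diffP.
exact: ex_derive.
Qed.

Lemma continuous_integrable_itv f (a b : R) : continuous f ->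
  (@lebesgue_measure R).-integrable `[a, b] (EFin \o f).
Proof.
move=> cf; apply: continuous_compact_integrable; first exact: segment_compact.
exact: continuous_subspaceT.
Qed.

(** Lebesgue integration is oriented by its intervals, so the integral from 0
    to x is taken as a difference of two integrals from the common left end
    - |x| - 1; this covers negative x as well. *)
Definition prim f (x : R) : R :=
  \int[@lebesgue_measure R]_(t in `[- `|x| - 1, x]) f t
  - \int[@lebesgue_measure R]_(t in `[- `|x| - 1, 0]) f t.

Let FN f (a x : R) : R := \int[@lebesgue_measure R]_(t in `[a, x]) f t.

Let FND f (a x : R) : continuous f -> a < x -> is_derive x 1 (FN f a) (f x).
Proof.
move=> cf ax.
have xx1 : x < x + 1 by rewrite ltrDl.
have [d dE] := @continuous_FTC1_closed R f a x (x + 1) xx1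
  (continuous_integrable_itv a (x + 1) cf) ax (cf x).
apply: DeriveDef; first exact: d.
by rewrite -derive1E; exact: dE.
Qed.

(** Changing the left end shifts the integral by a constant, which cancels in
    the difference; this lets the left end vary with x in [prim]. *)
Let FNE f (a b x : R) : continuous f -> a < x -> a < 0 -> b < x -> b < 0 ->
  FN f a x - FN f a 0 = FN f b x - FN f b 0.
Proof.
move=> cf ax a0 bx b0.
pose G y := FN f a y - FN f b y.
have dG y : a < y -> b < y -> is_derive y 1 G 0.
  move=> ay by_; have := FND cf ay; have := FND cf by_ => d1 d2.
  by apply: is_derive_eq; rewrite subrr.
have key (u v : R) : u <= v -> a < u -> b < u -> G u = G v.
  move=> uv au bu; apply/eqP; rewrite eq_le; apply/andP; split.
    apply: (@le_of_deriv_ge0 G (fun=> 0)) => // y /andP[uy _].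
    by apply: dG; apply: lt_le_trans uy.
  rewrite -lerN2.
  apply: (@le_of_deriv_ge0 (- G) (fun=> 0)) => // y /andP[uy _].
  have d : is_derive y 1 G 0 by apply: dG; apply: lt_le_trans uy.
  by apply: is_derive_eq; rewrite oppr0.
suff : G x = G 0 by rewrite /G; lra.
by have [x0|/ltW x0] := leP x 0; [exact: key|apply/esym; exact: key].
Qed.

Lemma prim0 f : prim f 0 = 0. Proof. by rewrite /prim subrr. Qed.

Lemma primD f : continuous f -> has_deriv (prim f) f.
Proof.
move=> cf x; pose a := - `|x| - 2.
have ax : a < x by rewrite /a; have := ler_norm (- x); rewrite normrN; lra.
have a0 : a < 0 by rewrite /a; have := normr_ge0 x; lra.
apply: (@near_eq_is_derive _ _ _ (fun y => FN f a y - FN f a 0)).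
  near=> y.
  have ay : a < y by near: y; exact: lt_nbhsr.
  have by_ : - `|y| - 1 < y by have := ler_norm (- y); rewrite normrN; lra.
  have b0 : - `|y| - 1 < 0 by have := normr_ge0 y; lra.
  exact: FNE.
have d := FND cf ax.
by apply: is_derive_eq; rewrite subr0.
Unshelve. all: by end_near. Qed.

End calculus.

(** * Exponentially decaying functions and half-line integrals *)

Section halfline.
Context {R : realType}.
Implicit Types (f g F u : R -> R) (x y z : R).

Lemma cont_add f g : continuous f -> continuous g -> continuous (fun x => f x + g x).
Proof. by move=> cf cg x; apply: cvgD; [exact: cf|exact: cg]. Qed.

Lemma cont_sub f g : continuous f -> continuous g -> continuous (fun x => f x - g x).
Proof. by move=> cf cg x; apply: cvgB; [exact: cf|exact: cg]. Qed.

Lemma cont_mul f g : continuous f -> continuous g -> continuous (fun x => f x * g x).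
Proof. by move=> cf cg x; apply: cvgM; [exact: cf|exact: cg]. Qed.

Lemma cont_sq f : continuous f -> continuous (fun x => f x ^+ 2).
Proof. by move=> cf; exact: (cont_mul cf cf). Qed.

Lemma cont_cst (c : R) : continuous (fun _ : R => c).
Proof. by move=> x; exact: cvg_cst. Qed.

Lemma cont_scale (c : R) f : continuous f -> continuous (fun x => c * f x).
Proof. by move=> cf; exact: (cont_mul (@cont_cst c) cf). Qed.

Lemma cont_comp f g : continuous f -> continuous g -> continuous (fun x => f (g x)).
Proof. by move=> cf cg x; apply: (@continuous_comp _ _ _ g f); [exact: cg|exact: cf]. Qed.

Lemma cont_expR (c : R) : continuous (fun x : R => expR (c * x)).
Proof.
by apply: cont_comp; [exact: continuous_expR|apply: cont_scale => x; exact: cvg_id].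
Qed.

Definition exp_decay f := continuous f /\ exists C mu : R,
  0 < mu /\ forall x, 0 <= x -> `|f x| <= C * expR (- mu * x).

Lemma dec_cont f : exp_decay f -> continuous f. Proof. by case. Qed.

Lemma dec_bdd f : exp_decay f -> exists2 B : R, 0 < B & forall x, 0 <= x -> `|f x| <= B.
Proof.
move=> [_ [C [mu [mu0 fC]]]].
have C0 : 0 <= C by have := fC 0 (lexx _); rewrite mulr0 expR0 mulr1; apply: le_trans.
exists (C + 1) => [|x x0]; first by lra.
apply: le_trans (fC x x0) _; apply: (@le_trans _ _ C); last by lra.
rewrite ler_piMr// -expR0 ler_expR.
by rewrite mulNr oppr_le0 mulr_ge0// ltW.
Qed.

Lemma dec_le K f g : continuous g -> exp_decay f ->
  (forall x, 0 <= x -> `|g x| <= K * `|f x|) -> exp_decay g.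
Proof.
move=> cg [_ [C [mu [mu0 fC]]]] gf; split=> //.
exists (`|K| * C), mu; split=> // x x0.
apply: le_trans (gf x x0) _; rewrite -mulrA.
apply: (@le_trans _ _ (`|K| * `|f x|)); first by rewrite ler_wpM2r// ler_norm.
by rewrite ler_wpM2l// fC.
Qed.

Lemma dec_scale c f : exp_decay f -> exp_decay (fun x => c * f x).
Proof.
move=> df; apply: (@dec_le `|c| f) => //; first exact: cont_scale (dec_cont df).
by move=> x _; rewrite normrM.
Qed.

Lemma dec_add f g : exp_decay f -> exp_decay g -> exp_decay (fun x => f x + g x).
Proof.
move=> [cf [C [mu [mu0 fC]]]] [cg [D [nu [nu0 gD]]]]; split; first exact: cont_add.
have C0 : 0 <= C by have := fC 0 (lexx _); rewrite mulr0 expR0 mulr1; apply: le_trans.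
have D0 : 0 <= D by have := gD 0 (lexx _); rewrite mulr0 expR0 mulr1; apply: le_trans.
exists (C + D), (Num.min mu nu); split; first by rewrite lt_min mu0.
move=> x x0; apply: le_trans (ler_normD _ _) _; rewrite mulrDl lerD//.
- apply: le_trans (fC x x0) _; rewrite ler_wpM2l// ler_expR ler_wpM2r// lerN2.
  by rewrite ge_min lexx.
- apply: le_trans (gD x x0) _; rewrite ler_wpM2l// ler_expR ler_wpM2r// lerN2.
  by rewrite ge_min lexx orbT.
Qed.

Lemma dec_sub f g : exp_decay f -> exp_decay g -> exp_decay (fun x => f x - g x).
Proof.
move=> df dg; have := dec_add df (dec_scale (-1) dg).
by under [X in exp_decay X -> _]eq_fun do rewrite mulN1r.
Qed.

Lemma dec_mul_bdd K f g : continuous g -> (forall x, 0 <= x -> `|g x| <= K) ->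
  exp_decay f -> exp_decay (fun x => g x * f x).
Proof.
move=> cg gK df; apply: (@dec_le K f) => //.
  exact: cont_mul cg (dec_cont df).
by move=> x x0; rewrite normrM ler_wpM2r// gK.
Qed.

Lemma dec_mul f g : exp_decay f -> exp_decay g -> exp_decay (fun x => f x * g x).
Proof.
by move=> df dg; have [B _ fB] := dec_bdd df; apply: dec_mul_bdd fB dg; apply: dec_cont.
Qed.

Lemma dec_sq f : exp_decay f -> exp_decay (fun x => f x ^+ 2).
Proof. by move=> df; exact: (dec_mul df df). Qed.

Lemma expR_cvg0 (mu : R) : 0 < mu -> expR (- mu * x) @[x --> +oo] --> 0.
Proof.
move=> mu0.
have : (fun x => mu * x) x @[x --> +oo] --> +oo.
  by apply: gt0_cvgMry => //; exact: cvg_id.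
move=> /(cvg_comp _ _) /(_ (@cvgr_expR R)).
by under [X in X @ _ --> _]eq_fun do rewrite /= -mulNr.
Qed.

Lemma dec_cvg0 f : exp_decay f -> f x @[x --> +oo] --> 0.
Proof.
move=> [_ [C [mu [mu0 fC]]]].
apply: norm_cvg0.
apply: (@squeeze_cvgr _ _ _ _ (fun=> 0) (fun x => C * expR (- mu * x))).
- near=> x; rewrite normr_ge0 fC//.
- exact: cvg_cst.
- by rewrite -[X in _ --> X](mulr0 C); apply: cvgMl_tmp; exact: expR_cvg0.
Unshelve. all: by end_near. Qed.

Lemma le_of_has_deriv F f (a b : R) : has_deriv F f -> a <= b ->
  (forall x, a < x < b -> 0 <= f x) -> F a <= F b.
Proof. by move=> dF ab f0; apply: (le_of_deriv_ge0 ab _ f0) => x _; exact: dF. Qed.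

Definition Int f : R := lim (prim f x @[x --> +oo]).

Lemma Int_unique f l : prim f x @[x --> +oo] --> l -> Int f = l.
Proof. by move=> fl; exact: cvg_lim fl. Qed.

Definition half_deriv F f := forall y, 0 <= y -> is_derive y 1 F (f y).

Lemma prim_eq f F (x : R) : continuous f -> 0 <= x ->
  half_deriv F f -> prim f x = F x - F 0.
Proof.
move=> cf x0 dF; have dP := primD cf.
have dG y : 0 <= y -> is_derive y 1 (fun y => prim f y - F y) 0.
  by move=> y0; have := dF y y0 => d; have d' := dP y; apply: is_derive_eq; rewrite subrr.
have dGN y : 0 <= y -> is_derive y 1 (fun y => F y - prim f y) 0.
  by move=> y0; have := dF y y0 => d; have d' := dP y; apply: is_derive_eq; rewrite subrr.
have h1 : prim f 0 - F 0 <= prim f x - F x.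
  by apply: (@le_of_deriv_ge0 _ (fun y => prim f y - F y) (fun=> 0)) => // y /andP[y0 _]; exact: dG.
have h2 : F 0 - prim f 0 <= F x - prim f x.
  by apply: (@le_of_deriv_ge0 _ (fun y => F y - prim f y) (fun=> 0)) => // y /andP[y0 _]; exact: dGN.
move: h1 h2; rewrite prim0; lra.
Qed.

Lemma prim_le f g (a b : R) : continuous f -> continuous g -> a <= b ->
  (forall x, a < x < b -> f x <= g x) -> prim f b - prim f a <= prim g b - prim g a.
Proof.
move=> cf cg ab fg.
have dP := primD cf; have dQ := primD cg.
suff : prim g a - prim f a <= prim g b - prim f b by lra.
apply: (@le_of_has_deriv (fun y => prim g y - prim f y) (fun y => g y - f y)) => //.
  by move=> y; have := dP y; have := dQ y => d1 d2; exact: is_deriveB.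
by move=> y yab; rewrite subr_ge0 fg.
Qed.

Lemma prim_le0 f g x : continuous f -> continuous g -> 0 <= x ->
  (forall y, 0 < y < x -> f y <= g y) -> prim f x <= prim g x.
Proof. by move=> cf cg x0 /(prim_le cf cg x0); rewrite !prim0 !subr0. Qed.

Lemma is_derive_expRM (c x : R) : is_derive x 1 (fun y => expR (c * y)) (c * expR (c * x)).
Proof.
have -> : (fun y => expR (c * y)) = expR \o (fun y : R => c * y) by [].
by apply: is_derive_eq; rewrite [_ *: _]mulr1 mulrC.
Qed.

Lemma prim_exp (C mu x : R) : 0 < mu -> 0 <= x ->
  prim (fun y => C * expR (- mu * y)) x = C / mu * (1 - expR (- mu * x)).
Proof.
move=> mu0 x0.
rewrite (@prim_eq _ (fun y => - (C / mu) * expR (- mu * y)) x)//.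
- by rewrite mulr0 expR0; ring.
- by apply: cont_scale; exact: cont_expR.
- move=> y _; have d := is_derive_expRM (- mu) y; apply: is_derive_eq.
  by rewrite ?scaleRE; field; lra.
Qed.

(** Adding the majorant C exp(-mu y) makes the integrand nonnegative, hence its
    primitive monotone and bounded, and the primitive of the majorant is
    explicit. *)
Lemma Int_cvg f : exp_decay f -> prim f x @[x --> +oo] --> Int f.
Proof.
move=> [cf [C [mu [mu0 fC]]]]; rewrite /Int.
pose e (y : R) := C * expR (- mu * y).
have ce : continuous e by apply: cont_scale; exact: cont_expR.
have C0 : 0 <= C by have := fC 0 (lexx _); rewrite mulr0 expR0 mulr1; apply: le_trans.
pose h x := prim (fun y => f y + e y) (Num.max 0 x).
have cfe : continuous (fun y => f y + e y) by exact: cont_add.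
have hE : forall x, 0 <= x -> h x = prim f x + C / mu * (1 - expR (- mu * x)).
  move=> x x0; rewrite /h max_r// -prim_exp//.
  rewrite (@prim_eq _ (fun y => prim f y + prim e y)) ?prim0 ?addr0 ?subr0//.
  move=> y _; have := primD cf y; have := primD ce y => d1 d2; exact: is_deriveD.
have hnd : nondecreasing_fun h.
  move=> x y xy; apply: (@le_of_has_deriv _ _ _ _ (primD cfe)).
    by rewrite ge_max !le_max lexx xy orbT.
  move=> z /andP[]; rewrite gt_max => /andP[z0 _] _.
  by have := fC z (ltW z0); rewrite ler_norml -/(e z) => /andP[]; lra.
have hub : has_ubound (range h).
  exists (2 * (C / mu)) => _ [x _ <-].
  apply: (@le_trans _ _ (h (Num.max 0 x))); first by apply: hnd; rewrite le_max lexx orbT.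
  have x0 : 0 <= Num.max 0 x by rewrite le_max lexx.
  rewrite hE//; set y := Num.max 0 x in x0 *.
  have h1 : prim f y <= C / mu * (1 - expR (- mu * y)).
    rewrite -prim_exp//; apply: prim_le0 => // z /andP[z0 _].
    by have := fC z (ltW z0); rewrite ler_norml -/(e z) => /andP[]; lra.
  have h2 : C / mu * (1 - expR (- mu * y)) <= C / mu.
    by rewrite ler_piMr ?divr_ge0 ?(ltW mu0)// gerBl expR_ge0.
  by lra.
have hcvg := nondecreasing_cvgr hnd hub.
have ecvg := expR_cvg0 mu0.
have : (h x - C / mu * (1 - expR (- mu * x))) @[x --> +oo] --> sup (range h) - C / mu * (1 - 0).
  apply: cvgB => //; apply: cvgMl_tmp; apply: cvgB => //; exact: cvg_cst.
move=> cv; apply: (cvgP (sup (range h) - C / mu * (1 - 0))).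
apply: cvg_trans cv; apply: near_eq_cvg; near=> x.
by rewrite hE ?addrK//; near: x; apply: nbhs_pinfty_ge; rewrite num_real.
Unshelve. all: by end_near. Qed.

Lemma Int_FTC f F l : continuous f -> F x @[x --> +oo] --> l ->
  half_deriv F f -> Int f = l - F 0.
Proof.
move=> cf Fl dF; apply: Int_unique.
have : (F x - F 0) @[x --> +oo] --> l - F 0 by apply: cvgB => //; exact: cvg_cst.
apply: cvg_trans; apply: near_eq_cvg; near=> x.
by rewrite (prim_eq cf _ dF)//; near: x; apply: nbhs_pinfty_ge; rewrite num_real.
Unshelve. all: by end_near. Qed.

Lemma IntD f g : exp_decay f -> exp_decay g -> Int (fun x => f x + g x) = Int f + Int g.
Proof.
move=> df dg; apply: Int_unique.
have : (prim f x + prim g x) @[x --> +oo] --> Int f + Int g by apply: cvgD; exact: Int_cvg.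
apply: cvg_trans; apply: near_eq_cvg; near=> x.
have x0 : 0 <= x by near: x; apply: nbhs_pinfty_ge; rewrite num_real.
have cD := cont_add (dec_cont df) (dec_cont dg).
have dD : half_deriv (fun y => prim f y + prim g y) (fun y => f y + g y).
  move=> y _; have := primD (dec_cont df) y; have := primD (dec_cont dg) y => d1 d2.
  exact: is_deriveD.
by rewrite (prim_eq cD x0 dD) !prim0 addr0 subr0.
Unshelve. all: by end_near. Qed.

Lemma IntZ c f : exp_decay f -> Int (fun x => c * f x) = c * Int f.
Proof.
move=> df; apply: Int_unique.
have : (c * prim f x) @[x --> +oo] --> c * Int f by apply: cvgMl_tmp; exact: Int_cvg.
apply: cvg_trans; apply: near_eq_cvg; near=> x.
have x0 : 0 <= x by near: x; apply: nbhs_pinfty_ge; rewrite num_real.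
have cD := cont_scale (c := c) (dec_cont df).
have dD : half_deriv (fun y => c * prim f y) (fun y => c * f y).
  by move=> y _; have d := primD (dec_cont df) y; apply: is_derive_eq.
by rewrite (prim_eq cD x0 dD) prim0 mulr0 subr0.
Unshelve. all: by end_near. Qed.

Lemma IntB f g : exp_decay f -> exp_decay g -> Int (fun x => f x - g x) = Int f - Int g.
Proof.
move=> df dg; rewrite -mulN1r -IntZ// -IntD//; last exact: dec_scale.
by congr Int; apply/funext => x; rewrite mulN1r.
Qed.

Lemma Int_ge_prim f (x : R) : exp_decay f -> 0 <= x -> (forall y, x <= y -> 0 <= f y) ->
  prim f x <= Int f.
Proof.
move=> df x0 f0.
apply: (cvgr_to_ge (Int_cvg df)); near=> y.
apply: (le_of_has_deriv (primD (dec_cont df))).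
  by near: y; apply: nbhs_pinfty_ge; rewrite num_real.
by move=> z /andP[/ltW xz _]; exact: f0.
Unshelve. all: by end_near. Qed.

Lemma Int_le f g : exp_decay f -> exp_decay g -> (forall x, 0 <= x -> f x <= g x) -> Int f <= Int g.
Proof.
move=> df dg fg; apply: (ler_cvg_to (Int_cvg df) (Int_cvg dg)); near=> y.
apply: prim_le0; [exact: dec_cont|exact: dec_cont| |].
  by near: y; apply: nbhs_pinfty_ge; rewrite num_real.
by move=> z /andP[/ltW xz _]; exact: fg.
Unshelve. all: by end_near. Qed.

Lemma Int_ge0 f : exp_decay f -> (forall x, 0 <= x -> 0 <= f x) -> 0 <= Int f.
Proof. by move=> df f0; have := Int_ge_prim df (lexx 0) f0; rewrite prim0. Qed.

Lemma Int_gt0 f : exp_decay f -> (forall x, 0 <= x -> 0 < f x) -> 0 < Int f.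
Proof.
move=> df f0.
have : prim f 1 <= Int f.
  by apply: Int_ge_prim => // y y1; apply: ltW; apply: f0; apply: le_trans y1.
apply: lt_le_trans.
have [||c] := @MVT R (prim f) f 0 1 ltr01.
- by move=> x _; exact: primD (dec_cont df) x.
- exact/continuous_subspaceT/has_deriv_continuous/primD/dec_cont.
rewrite in_itv/= => /andP[c0 _]; rewrite prim0 !subr0 mulr1 => ->.
by apply: f0; exact: ltW.
Qed.

End halfline.

(** * The Green function of the half-line *)

Section green.
Context {R : realType}.
Implicit Types (f g F u : R -> R) (x y z C mu : R).
Variables (om : R) (w : R -> R).
Hypotheses (om0 : 0 < om) (cw : continuous w) (we : forall x, w (- x) = w x)
  (w0 : forall x, 0 < w x) (dw : exp_decay w).

Let ep (x : R) := expR (om * x).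
Let em (x : R) := expR (- om * x).

Let epem x : ep x * em x = 1.
Proof. by rewrite /ep /em -expRD mulNr subrr expR0. Qed.

Let wp x := ep x * w x.
Let wm x := em x * w x.

Let cwp : continuous wp. Proof. by apply: cont_mul => //; exact: cont_expR. Qed.
Let cwm : continuous wm. Proof. by apply: cont_mul => //; exact: cont_expR. Qed.

Let dwm : exp_decay wm.
Proof.
apply: (@dec_mul_bdd _ 1) => //; first exact: cont_expR.
move=> x x0; rewrite ger0_norm ?expR_ge0// -expR0 ler_expR.
by rewrite mulNr oppr_le0 mulr_ge0// ltW.
Qed.

Let A := prim wp.
Let B := prim wm.
Let D := Int wm.

(* Variation of constants: (Rr + Qq) / (2 om) is the convolution of w with
   exp (- om |x|) / (2 om), for w even. Rr carries the sources beyond x, Qq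
   those below x and their mirror images. *)
Let Rr x := ep x * (D - B x).
Let Qq x := em x * (D + A x).

Let dR : has_deriv Rr (fun x => om * Rr x - w x).
Proof.
move=> x; have := is_derive_expRM om x; have := primD cwm x => d1 d2.
rewrite /Rr /ep; apply: is_derive_eq.
rewrite ?scaleRE /wm.
have e1 := epem x; rewrite -/(ep x).
transitivity (om * (ep x * (D - B x)) - ep x * em x * w x); first by ring.
by rewrite e1 mul1r.
Qed.

Let dQ : has_deriv Qq (fun x => - om * Qq x + w x).
Proof.
move=> x; have := is_derive_expRM (- om) x; have := primD cwp x => d1 d2.
rewrite /Qq /em; apply: is_derive_eq.
rewrite ?scaleRE /wp.
have e1 := epem x; rewrite -/(em x).
transitivity (- om * (em x * (D + A x)) + ep x * em x * w x); first by ring.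
by rewrite e1 mul1r.
Qed.

Let AN x : A (- x) = - B x.
Proof.
have dG y : is_derive y 1 (fun z => A (- z) + B z) 0.
  have d1 : is_derive y 1 (fun z => A (- z)) (- wp (- y)).
    have dA : is_derive (- y) 1 A (wp (- y)) by exact: primD.
    have -> : (fun z => A (- z)) = A \o -%R by [].
    by apply: is_derive_eq; rewrite mulrN mulr1.
  have d2 : is_derive y 1 B (wm y) by exact: primD.
  apply: is_derive_eq; rewrite /wp /wm we /ep /em mulrN mulNr; ring.
have := is_derive_0_is_cst x 0 dG.
by rewrite /= oppr0 /A /B !prim0 addr0; lra.
Qed.

Let BN x : B (- x) = - A x.
Proof. by rewrite -{2}[x]opprK AN opprK. Qed.

Let RN x : Rr (- x) = Qq x.
Proof. by rewrite /Rr /Qq BN opprK /ep /em mulrN mulNr. Qed.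

Let QN x : Qq (- x) = Rr x. Proof. by rewrite -RN opprK. Qed.

Let D0 : 0 < D.
Proof. by apply: Int_gt0 => // x _; rewrite mulr_gt0 ?expR_gt0. Qed.

Let R_ge0 x : 0 <= x -> 0 <= Rr x.
Proof.
move=> x0; rewrite mulr_ge0 ?expR_ge0// subr_ge0.
by apply: Int_ge_prim => // y _; rewrite ltW// mulr_gt0 ?expR_gt0.
Qed.

Let Q_gt0 x : 0 <= x -> 0 < Qq x.
Proof.
move=> x0; rewrite mulr_gt0 ?expR_gt0// ltr_wpDr//.
rewrite -(prim0 wp); apply: (le_of_has_deriv (primD cwp)) => // y _.
by rewrite ltW// mulr_gt0 ?expR_gt0.
Qed.

(* Comparison with the explicit answer to the source C exp (- mu x). The case
   mu = 0 yields the maximum principle, small mu > 0 the decay. *)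
Let bound C mu : 0 <= mu < om -> (forall x, 0 <= x -> w x <= C * expR (- mu * x)) ->
  forall x, 0 <= x -> Rr x + Qq x <= (C / (om + mu) + C / (om - mu)) * expR (- mu * x).
Proof.
move=> /andP[mu0 muom] wC.
have C0 : 0 <= C.
  by have := wC 0 (lexx _); rewrite mulr0 expR0 mulr1; apply: le_trans; exact: ltW.
have s0 : 0 < om + mu by rewrite ltr_wpDr.
have t0 : 0 < om - mu by rewrite subr_gt0.
have hR x : 0 <= x -> D - B x <= C / (om + mu) * expR (- (om + mu) * x).
  move=> x0; rewrite lerBlDr.
  apply: (cvgr_to_le (Int_cvg dwm)); near=> y.
  have xy : x <= y by near: y; apply: nbhs_pinfty_ge; rewrite num_real.
  have dG : has_deriv (fun z => - (C / (om + mu)) * expR (- (om + mu) * z) - B z)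
      (fun z => C * expR (- (om + mu) * z) - wm z).
    move=> z; have := is_derive_expRM (- (om + mu)) z; have := primD cwm z => d1 d2.
    by apply: is_derive_eq; rewrite ?scaleRE; field; lra.
  have := le_of_has_deriv dG xy; rewrite -/B => h.
  suff : - (C / (om + mu)) * expR (- (om + mu) * x) - B x <=
     - (C / (om + mu)) * expR (- (om + mu) * y) - B y.
    have : 0 <= (C / (om + mu)) * expR (- (om + mu) * y).
      by rewrite mulr_ge0 ?expR_ge0// divr_ge0// ltW.
    rewrite !mulNr; lra.
  apply: h => z /andP[xz _]; rewrite subr_ge0.
  have -> : C * expR (- (om + mu) * z) = em z * (C * expR (- mu * z)).
    by rewrite opprD mulrDl expRD /em; ring.
  by rewrite ler_wpM2l ?expR_ge0// wC// ltW// (le_lt_trans x0).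
have hD : D <= C / (om - mu).
  have := hR 0 (lexx _); rewrite /B prim0 subr0 mulr0 expR0 mulr1 => h.
  by apply: le_trans h _; rewrite ler_wpM2l// lef_pV2 ?posrE//; lra.
move=> x x0.
have hA : A x <= C / (om - mu) * (expR ((om - mu) * x) - 1).
  have dG : has_deriv (fun z => (C / (om - mu)) * expR ((om - mu) * z) - A z)
      (fun z => C * expR ((om - mu) * z) - wp z).
    move=> z; have := is_derive_expRM (om - mu) z; have := primD cwp z => d1 d2.
    by apply: is_derive_eq; rewrite ?scaleRE; field; lra.
  have := le_of_has_deriv dG x0; rewrite /A prim0 mulr0 expR0 mulr1 subr0 => h.
  suff : C / (om - mu) <= C / (om - mu) * expR ((om - mu) * x) - prim wp x by lra.
  apply: h => z /andP[xz _]; rewrite subr_ge0.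
  have -> : C * expR ((om - mu) * z) = ep z * (C * expR (- mu * z)).
    by rewrite mulrDl expRD /ep; ring.
  by rewrite ler_wpM2l ?expR_ge0// wC// ltW.
rewrite mulrDl lerD//.
  have -> : expR (- mu * x) = ep x * expR (- (om + mu) * x).
    by rewrite /ep -expRD; congr expR; ring.
  by rewrite /Rr mulrCA ler_wpM2l ?expR_ge0// hR.
have -> : expR (- mu * x) = em x * expR ((om - mu) * x).
  by rewrite /em -expRD; congr expR; ring.
rewrite /Qq mulrCA ler_wpM2l ?expR_ge0//.
move: hA hD; lra.
Unshelve. all: by end_near. Qed.

(** The slope bound holds since v' and om v are the difference and the sum of
    the same two nonnegative contributions. It yields the Lipschitz
    bounds and the Harnack inequality for the iterates. *)
Lemma green_solution : exists v dv : R -> R,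
  [/\ has_deriv v dv, has_deriv dv (fun x => om ^+ 2 * v x - w x),
      (forall x, v (- x) = v x) /\ dv 0 = 0 &
   [/\ (forall x, 0 < v x), (forall x, 0 <= x -> `|dv x| <= om * v x),
       exp_decay v, exp_decay dv &
       forall S, (forall x, 0 <= x -> w x <= S) -> forall x, 0 <= x -> v x <= S / om ^+ 2]].
Proof.
pose v x := (2 * om)^-1 * (Rr x + Qq x).
pose dv x := 2^-1 * (Rr x - Qq x).
have hv : has_deriv v dv.
  move=> x; have := dR x; have := dQ x => d1 d2; apply: is_derive_eq.
  by rewrite ?scaleRE /dv; field; rewrite gt_eqF.
have hdv : has_deriv dv (fun x => om ^+ 2 * v x - w x).
  move=> x; have := dR x; have := dQ x => d1 d2; apply: is_derive_eq.
  by rewrite ?scaleRE /v; field; rewrite gt_eqF.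
have ve x : v (- x) = v x.
  by rewrite /v RN QN addrC.
have vp0 x : 0 <= x -> 0 < v x.
  move=> x0; rewrite mulr_gt0 ?invr_gt0 ?mulr_gt0//.
  by rewrite ltr_wpDl ?R_ge0 ?Q_gt0.
have vb x : 0 <= x -> `|dv x| <= om * v x.
  move=> x0; have -> : om * v x = 2^-1 * (Rr x + Qq x) by rewrite /v; field; rewrite gt_eqF.
  have := R_ge0 x0; have := Q_gt0 x0.
  by rewrite /dv ler_norml; lra.
have vC C mu : 0 <= mu < om -> (forall x, 0 <= x -> w x <= C * expR (- mu * x)) ->
   forall x, 0 <= x -> v x <= C / (om ^+ 2 - mu ^+ 2) * expR (- mu * x).
  move=> muom wC x x0; have /andP[mu0 muo] := muom.
  have := bound muom wC x0.
  have -> : C / (om ^+ 2 - mu ^+ 2) * expR (- mu * x) =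
     (2 * om)^-1 * ((C / (om + mu) + C / (om - mu)) * expR (- mu * x)).
    field; have -> : om ^+ 2 - mu ^+ 2 = (om - mu) * (om + mu) by ring.
    by rewrite mulf_neq0 ?andbT//=; lra.
  by move=> h; rewrite ler_wpM2l// invr_ge0 mulr_ge0// ltW.
have dv0 : exp_decay v.
  split; first exact: has_deriv_continuous hv.
  have [_ [C [mu [mu0 wC]]]] := dw.
  have C0 : 0 <= C by have := wC 0 (lexx _); rewrite mulr0 expR0 mulr1; apply: le_trans.
  pose nu := Num.min mu (om / 2).
  have nu0 : 0 < nu by rewrite lt_min mu0/= divr_gt0.
  have nuo : nu < om by rewrite gt_min; apply/orP; right; have := om0; lra.
  exists (C / (om ^+ 2 - nu ^+ 2)), nu; split=> // x x0.
  rewrite gtr0_norm ?vp0//; apply: vC => //; first by rewrite (ltW nu0).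
  move=> y y0; apply: le_trans (ler_norm _) _; apply: le_trans (wC y y0) _.
  rewrite ler_wpM2l// ler_expR ler_wpM2r// lerN2.
  by rewrite ge_min lexx.
exists v, dv; split=> //.
  split=> //; rewrite /dv -{1}oppr0 RN subrr mulr0//.
split=> //.
- by move=> x; have [/vp0//|/ltW x0] := leP 0 x; rewrite -ve vp0// oppr_ge0.
- apply: (dec_le _ dv0); first exact: has_deriv_continuous hdv.
  by move=> x x0; rewrite (gtr0_norm (vp0 x x0)); exact: vb.
- move=> S wS x x0; have := @vC S 0 _ _ x x0.
  rewrite expr0n subr0 oppr0 mul0r expR0 mulr1; apply; first by rewrite lexx.
  by move=> y y0; rewrite mul0r expR0 mulr1 wS.
Qed.

End green.

(** * Power-like nonlinearities *)

Section power_like.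
Context {R : realType}.
Implicit Types (r s t x y : R).

Lemma le_of_deriv_ge0_oo (F f : R -> R) (a b : R) : continuous F -> a <= b ->
  (forall x, a < x < b -> is_derive x 1 F (f x)) ->
  (forall x, a < x < b -> 0 <= f x) -> F a <= F b.
Proof.
move=> cF ab dF f0; move: ab; rewrite le_eqVlt => /predU1P[->//|ab].
have cF' : {within `[a, b], continuous F} by exact: continuous_subspaceT.
have dF' x : x \in `]a, b[ -> is_derive x 1 F (f x) by rewrite in_itv; exact: dF.
have [c] := MVT ab dF' cF'.
rewrite in_itv/= => cab FE; rewrite -subr_ge0 FE mulr_ge0 ?f0// subr_ge0 ltW//.
Qed.

(** Truncating the base at 0 makes the power continuous on the whole line. *)
Definition ppow r s := Num.max 0 s `^ r.

Lemma ppowE r s : 0 <= s -> ppow r s = s `^ r.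
Proof. by move=> s0; rewrite /ppow max_r. Qed.

Lemma powR_continuous_gt0 r s : 0 < s -> {for s, continuous (fun t : R => t `^ r)}.
Proof.
move=> s0; apply: differentiable_continuous; apply/derivable1_diffP.
by apply: ex_derive; exact: is_derive1_powR.
Qed.

Lemma near_continuous (f g : R -> R) x : (\near x, f x = g x) ->
  {for x, continuous f} -> {for x, continuous g}.
Proof.
move=> fg cf; have e := nbhs_singleton fg; rewrite /= in e.
rewrite /prop_for/= /continuous_at -e.
by apply: cvg_trans cf; apply: near_eq_cvg; apply: filterS fg => y ->.
Qed.

Lemma ppow_continuous r : 0 < r -> continuous (ppow r).
Proof.
move=> r0 s; have [s0|s0|<-] := ltgtP 0 s.
- apply: (@near_continuous (fun t => t `^ r) _ s); last exact: powR_continuous_gt0.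
  by near=> t; rewrite ppowE// ltW//; near: t; exact: lt_nbhsr.
- apply: (@near_continuous (fun=> 0) _ s); last exact: cvg_cst.
  near=> t; rewrite /ppow max_l ?powR0 ?gt_eqF//.
  by apply/ltW; near: t; exact: lt_nbhsl.
- rewrite /continuous_at /ppow maxxx powR0 ?gt_eqF//.
  apply/cvgrPdist_le => /= e e0; near=> t.
  rewrite sub0r normrN ger0_norm ?powR_ge0//.
  have -> : e = (e `^ r^-1) `^ r by rewrite -powRrM mulVf ?gt_eqF// powRr1// ltW.
  apply: ge0_ler_powR; rewrite ?nnegrE ?powR_ge0 ?(ltW r0)// ?le_max ?lexx//.
  rewrite ge_max powR_ge0/=.
  apply/ltW; near: t; apply: lt_nbhsl; exact: powR_gt0.
Unshelve. all: by end_near. Qed.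

Variables (p b : R) (h : R -> R).
Hypotheses (p2 : 2 < p) (b1 : 1 <= b).
Hypotheses (ch : continuous h)
  (hb : forall s, 0 < s -> b^-1 * s `^ (p - 1) <= h s <= b * s `^ (p - 1))
  (hmon : forall s t, 0 < s -> s <= t -> h s / s <= h t / t).

Let b0 : 0 < b. Proof. exact: lt_le_trans b1. Qed.

Lemma powRB1 s r : 0 < s -> s `^ r = s * s `^ (r - 1).
Proof.
move=> s0; rewrite -{2}(powRr1 (ltW s0)) -powRD; first by rewrite addrC subrK.
by rewrite (gt_eqF s0) implybT.
Qed.

Lemma powRp s : 0 < s -> s `^ p = s * s * s `^ (p - 2).
Proof.
move=> s0; rewrite powRB1// (powRB1 (p - 1))// mulrA.
by congr (_ * _ `^ _); ring.
Qed.

Lemma powRp1 s : 0 < s -> s `^ (p - 1) = s * s `^ (p - 2).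
Proof. by move=> s0; rewrite powRB1//; congr (_ * _ `^ _); ring. Qed.

Lemma h_gt0 s : 0 < s -> 0 < h s.
Proof.
move=> s0; have /andP[+ _] := hb s0; apply: lt_le_trans.
by rewrite mulr_gt0 ?powR_gt0 ?invr_gt0.
Qed.

Lemma h_le_lin s S : 0 < s -> s <= S -> h s <= b * S `^ (p - 2) * s.
Proof.
move=> s0 sS; have /andP[_ +] := hb s0; move=> /le_trans; apply.
rewrite powRp1// mulrCA mulrC ler_wpM2r ?(ltW s0)//  ler_wpM2l ?(ltW b0)//.
have S0 := le_trans (ltW s0) sS; have p20 : 0 <= p - 2 by have := p2; lra.
by apply: ge0_ler_powR; rewrite ?nnegrE ?(ltW s0).
Qed.

Definition primitive_h := prim h.
Let H := primitive_h.

Lemma HD : has_deriv H h. Proof. exact: primD. Qed.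

Lemma H0 : H 0 = 0. Proof. exact: prim0. Qed.

Let dpow s : 0 < s -> is_derive s 1 (ppow p) (p * s `^ (p - 1)).
Proof.
move=> s0; apply: (near_eq_is_derive (f := fun t => t `^ p)).
  by near=> t; rewrite ppowE// ltW//; near: t; exact: lt_nbhsr.
exact: is_derive1_powR.
Unshelve. all: by end_near. Qed.

Let cpow : continuous (ppow p). Proof. apply: ppow_continuous; have := p2; lra. Qed.
Let cH : continuous H. Proof. exact: has_deriv_continuous HD. Qed.

Lemma H_ge s : 0 <= s -> b^-1 * s `^ p / p <= H s.
Proof.
move=> s0.
have cF : continuous (fun t => H t - b^-1 / p * ppow p t).
  by apply: cont_sub => //; apply: cont_scale.
have := @le_of_deriv_ge0_oo _ (fun t => h t - b^-1 * t `^ (p - 1)) _ _ cF s0.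
rewrite H0 ppowE// ppowE// powR0 ?mulr0 ?subrr; last by rewrite gt_eqF//; have := p2; lra.
rewrite subr_ge0 (mulrAC _ p^-1); apply.
- move=> t /andP[t0 _]; have := HD t; have := dpow t0 => d1 d2.
  by apply: is_derive_eq; rewrite ?scaleRE; field; rewrite ?gt_eqF//; have := p2; lra.
- by move=> t /andP[t0 _]; rewrite subr_ge0; have /andP[] := hb t0.
Qed.

Lemma H_le s : 0 <= s -> H s <= b * s `^ p / p.
Proof.
move=> s0.
have cF : continuous (fun t => b / p * ppow p t - H t).
  by apply: cont_sub => //; apply: cont_scale.
have := @le_of_deriv_ge0_oo _ (fun t => b * t `^ (p - 1) - h t) _ _ cF s0.
rewrite H0 ppowE// ppowE// powR0 ?mulr0 ?subrr; last by rewrite gt_eqF//; have := p2; lra.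
rewrite subr_ge0 (mulrAC _ p^-1); apply.
- move=> t /andP[t0 _]; have := HD t; have := dpow t0 => d1 d2.
  by apply: is_derive_eq; rewrite ?scaleRE; field; rewrite ?gt_eqF//; have := p2; lra.
- by move=> t /andP[t0 _]; rewrite subr_ge0; have /andP[] := hb t0.
Qed.

(** The Ambrosetti-Rabinowitz condition, with constant b^2 / p < 1/2 once b is
    close to 1. *)
Lemma H_le_AR s : 0 < s -> H s <= b ^+ 2 / p * (h s * s).
Proof.
move=> s0; apply: le_trans (H_le (ltW s0)) _.
have /andP[+ _] := hb s0; rewrite ler_pdivrMl// => hs.
have p0 : 0 < p by have := p2; lra.
rewrite (powRB1 p s0).
have -> : b * (s * s `^ (p - 1)) / p = b / p * s * s `^ (p - 1) by ring.
have -> : b ^+ 2 / p * (h s * s) = b / p * s * (b * h s) by ring.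
by rewrite ler_wpM2l// mulr_ge0 ?divr_ge0// ltW.
Qed.

Lemma H_ge0 s : 0 <= s -> 0 <= H s.
Proof.
move=> s0; apply: le_trans (H_ge s0).
by rewrite !mulr_ge0 ?invr_ge0 ?powR_ge0 ?(ltW b0)//; have := p2; lra.
Qed.

(** The tangent-line inequality for H as a convex function of t^2: its
    derivative with respect to t^2 is h(t) / (2 t), which is nondecreasing. *)
Lemma H_convex s t : 0 < s -> 0 <= t -> H s + 2^-1 * (h s / s) * (t ^+ 2 - s ^+ 2) <= H t.
Proof.
move=> s0 t0; set g := h s / s.
have dK x : is_derive x 1 (fun x => H x - 2^-1 * g * x ^+ 2) (h x - g * x).
  have := HD x => d1; apply: is_derive_eq.
  by rewrite ?expr1 ?scaleRE; field.
have dKN x : is_derive x 1 (fun x => 2^-1 * g * x ^+ 2 - H x) (g * x - h x).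
  have := HD x => d1; apply: is_derive_eq.
  by rewrite ?expr1 ?scaleRE; field.
have hE x : 0 < x -> h x = h x / x * x by move=> x0; rewrite divfK// gt_eqF.
suff : H s - 2^-1 * g * s ^+ 2 <= H t - 2^-1 * g * t ^+ 2 by lra.
have [st|/ltW ts] := leP s t.
  apply: (@le_of_has_deriv _ _ _ _ _ dK st) => x /andP[sx _].
  have x0 := lt_trans s0 sx.
  by rewrite subr_ge0 hE// ler_wpM2r ?(ltW x0)// hmon// ltW.
have := @le_of_has_deriv _ _ _ _ _ dKN ts.
suff h1 : forall x, t < x < s -> 0 <= g * x - h x by move=> /(_ h1); lra.
move=> x /andP[tx xs]; have x0 := le_lt_trans t0 tx.
by rewrite subr_ge0 (hE x)// ler_wpM2r ?(ltW x0)// hmon// ltW.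
Qed.

End power_like.

(** * The energy on the half-line *)

Section functional.
Context {R : realType}.
Implicit Types (u v du dv : R -> R) (r s t x y : R).

(** Pointwise exponential decay makes every integral below converge and is
    preserved by the solution operator of the linear problem. *)
Definition admissible u du :=
  [/\ has_deriv u du, forall x, 0 < u x, exp_decay u & exp_decay du].

Lemma admissible_scale (tau : R) u du : 0 < tau -> admissible u du ->
  admissible (fun x => tau * u x) (fun x => tau * du x).
Proof.
move=> t0 [hu u0 cu cdu]; split.
- by move=> x; have d := hu x; apply: is_derive_eq.
- by move=> x; rewrite mulr_gt0.
- exact: dec_scale.
- exact: dec_scale.
Qed.

(** Add c u^2 to the primitive of u'^2 + c^2 u^2: the derivative of the sum is
    the square (u' + c u)^2. *)
Lemma sobolev_sup (c : R) u du x : has_deriv u du -> exp_decay u -> exp_decay du -> 0 <= x ->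
  c * u x ^+ 2 <= Int (fun y => du y ^+ 2 + c ^+ 2 * u y ^+ 2).
Proof.
move=> hu cu cdu x0.
have dI : exp_decay (fun y => du y ^+ 2 + c ^+ 2 * u y ^+ 2).
  by apply: dec_add; [exact: dec_sq|apply: dec_scale; exact: dec_sq].
pose F y := prim (fun y => du y ^+ 2 + c ^+ 2 * u y ^+ 2) y + c * u y ^+ 2.
have hF : has_deriv F (fun y => (du y + c * u y) ^+ 2).
  move=> y; have := primD (dec_cont dI) y; have := hu y => d1 d2.
  by apply: is_derive_eq; rewrite ?scaleRE; ring.
have Fx : c * u x ^+ 2 <= F x.
  rewrite /F lerDr; set G := (fun y => _ + _).
  rewrite -[X in X <= _](prim0 G).
  apply: (le_of_has_deriv (primD (dec_cont dI)) x0) => y _.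
  apply: addr_ge0; first exact: sqr_ge0. by apply: mulr_ge0; exact: sqr_ge0.
apply: le_trans Fx _.
have Fl : F y @[y --> +oo] --> Int (fun y => du y ^+ 2 + c ^+ 2 * u y ^+ 2) + c * 0.
  by apply: cvgD; [exact: Int_cvg|apply: cvgMl_tmp; apply: dec_cvg0; exact: dec_sq].
rewrite mulr0 addr0 in Fl.
apply: (cvgr_to_ge Fl); near=> y.
apply: (le_of_has_deriv hF); first by near: y; apply: nbhs_pinfty_ge; rewrite num_real.
by move=> z _; rewrite sqr_ge0.
Unshelve. all: by end_near. Qed.

(** Integration by parts; the boundary term vanishes by the Neumann condition. *)
Lemma Int_green u du dv w : has_deriv u du -> exp_decay u -> exp_decay du ->
  exp_decay dv -> half_deriv dv w -> continuous w -> dv 0 = 0 ->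
  Int (fun x => dv x * du x + w x * u x) = 0.
Proof.
move=> hu cu cdu cdv hdv cw dv0.
have -> : 0 = 0 - dv 0 * u 0 :> R by rewrite dv0 mul0r subr0.
apply: (@Int_FTC _ _ (fun x => dv x * u x)).
- by apply: cont_add; apply: cont_mul => //; exact: dec_cont.
- exact: dec_cvg0 (dec_mul cdv cu).
- move=> y y0; have := hdv y y0; have := hu y => d1 d2.
  by apply: is_derive_eq; rewrite ?scaleRE; ring.
Qed.

Variables (p b : R) (h : R -> R).
Hypotheses (p2 : 2 < p) (b1 : 1 <= b).
Hypotheses (ch : continuous h)
  (hb : forall s, 0 < s -> b^-1 * s `^ (p - 1) <= h s <= b * s `^ (p - 1))
  (hmon : forall s t, 0 < s -> s <= t -> h s / s <= h t / t).
Let H := prim h.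

Let b0 : 0 < b. Proof. exact: lt_le_trans b1. Qed.

Variables (V : R -> R) (V0 om : R).
Hypotheses (cV : continuous V) (V00 : 0 < V0) (V0V : forall x, V0 <= V x)
  (Vom : forall x, V x <= om ^+ 2).

Let Vbd x : 0 <= x -> `|V x| <= om ^+ 2.
Proof. by move=> _; rewrite ger0_norm ?Vom// (le_trans (ltW V00)). Qed.

Definition quad u du := Int (fun x => du x ^+ 2 + V x * u x ^+ 2).
Definition react u := Int (fun x => h (u x) * u x).
Definition energy u du := Int (fun x => 2^-1 * (du x ^+ 2 + V x * u x ^+ 2) - H (u x)).
Definition balanced u du := quad u du = react u.

Section decs.
Variables (u du : R -> R).
Hypothesis (au : admissible u du).

Let u0 x : 0 < u x. Proof. by case: au. Qed.
Let cu : exp_decay u. Proof. by case: au. Qed.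
Let cdu : exp_decay du. Proof. by case: au. Qed.

Lemma dec_h : exp_decay (fun x => h (u x)).
Proof.
have [B B0 uB] := dec_bdd cu.
apply: (@dec_le _ (b * B `^ (p - 2)) u) => //.
  exact: cont_comp ch (dec_cont cu).
move=> x x0; rewrite (gtr0_norm (u0 x)) gtr0_norm ?(h_gt0 b1 hb)//.
by apply: (h_le_lin p2 b1 hb) => //; rewrite -(gtr0_norm (u0 x)) uB.
Qed.

Lemma dec_hu : exp_decay (fun x => h (u x) * u x).
Proof. exact: (dec_mul dec_h cu). Qed.

Lemma dec_H : exp_decay (fun x => H (u x)).
Proof.
apply: (@dec_le _ (b ^+ 2 / p) (fun x => h (u x) * u x)); last first.
- move=> x x0; rewrite ger0_norm; last by apply: (H_ge0 p2 b1 ch hb); exact: ltW.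
  rewrite gtr0_norm; last by rewrite mulr_gt0// (h_gt0 b1 hb).
  exact: (H_le_AR p2 b1 ch hb).
- exact: dec_hu.
- by apply: cont_comp; [exact: has_deriv_continuous (primD ch)|exact: dec_cont].
Qed.

Lemma dec_V (v : R -> R) : exp_decay v -> exp_decay (fun x => V x * v x).
Proof. move=> cv; exact: (dec_mul_bdd cV Vbd cv). Qed.

Lemma dec_quad : exp_decay (fun x => du x ^+ 2 + V x * u x ^+ 2).
Proof. by apply: dec_add; [|apply: dec_V]; exact: dec_sq. Qed.

Lemma dec_energy : exp_decay (fun x => 2^-1 * (du x ^+ 2 + V x * u x ^+ 2) - H (u x)).
Proof. by apply: dec_sub; [apply: dec_scale; exact: dec_quad|exact: dec_H]. Qed.

Lemma energyE : energy u du = 2^-1 * quad u du - Int (fun x => H (u x)).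
Proof.
by rewrite /energy IntB ?IntZ//; [exact: dec_quad|apply: dec_scale; exact: dec_quad|exact: dec_H].
Qed.

Lemma quad_gt0 : 0 < quad u du.
Proof.
apply: Int_gt0; first exact: dec_quad.
move=> x x0; rewrite ltr_wpDl ?sqr_ge0// mulr_gt0 ?exprn_gt0//.
exact: lt_le_trans (V0V x).
Qed.

Lemma sup_le_quad x : 0 <= x -> u x ^+ 2 <= quad u du / Num.sqrt V0.
Proof.
move=> x0; have [hu _ _ _] := au.
have s0 : 0 < Num.sqrt V0 by rewrite sqrtr_gt0.
rewrite ler_pdivlMr// mulrC; apply: le_trans (sobolev_sup (Num.sqrt V0) hu cu cdu x0) _.
rewrite sqr_sqrtr ?(ltW V00)//; apply: Int_le; last 1 first.
- by move=> y _; rewrite lerD2l ler_wpM2r ?sqr_ge0.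
- by apply: dec_add; [exact: dec_sq|apply: dec_scale; exact: dec_sq].
- exact: dec_quad.
Qed.

Lemma energy_ge : balanced u du -> (2^-1 - b ^+ 2 / p) * quad u du <= energy u du.
Proof.
move=> bu; rewrite energyE mulrBl lerB// bu /react -IntZ; last exact: dec_hu.
apply: Int_le; [exact: dec_H|apply: dec_scale; exact: dec_hu|].
by move=> x _; exact: (H_le_AR p2 b1 ch hb).
Qed.

(** A balanced function cannot be small: below the level S with
    b S^(p-2) = V0 the potential term outweighs the reaction. *)
Lemma balanced_sup (S : R) : balanced u du -> 0 < S -> (forall x, 0 <= x -> u x <= S) ->
  V0 <= b * S `^ (p - 2).
Proof.
move=> bu S0 uS; rewrite leNgt; apply/negP => lt.
have : quad u du <= (b * S `^ (p - 2) / V0) * quad u du.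
  rewrite {1}bu /react -IntZ; last exact: dec_quad.
  apply: Int_le; [exact: dec_hu|apply: dec_scale; exact: dec_quad|].
  move=> x x0; have hx := h_le_lin p2 b1 hb (u0 x) (uS x x0).
  apply: (@le_trans _ _ (b * S `^ (p - 2) * u x ^+ 2)).
    by rewrite expr2 mulrA ler_wpM2r// ltW.
  rewrite -(mulrA (b * _) V0^-1) ler_wpM2l ?mulr_ge0 ?powR_ge0 ?(ltW b0)//.
  rewrite mulrC ler_pdivlMr// mulrC; apply: (@le_trans _ _ (V x * u x ^+ 2)).
    by rewrite ler_wpM2r ?sqr_ge0.
  by rewrite lerDr sqr_ge0.
rewrite leNgt => /negP; apply; rewrite gtr_pMl ?quad_gt0//.
by rewrite ltr_pdivrMr// mul1r.
Qed.

End decs.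

(** The convexity of H in the square, applied pointwise at u and tau v. *)
Lemma energy_scale_le u du v dv (tau : R) : admissible u du -> admissible v dv -> 0 <= tau ->
  forall x, 0 <= x ->
  2^-1 * ((tau * dv x) ^+ 2 + V x * (tau * v x) ^+ 2) - H (tau * v x) <=
  2^-1 * tau ^+ 2 * (dv x ^+ 2 + V x * v x ^+ 2 - h (u x) / u x * v x ^+ 2)
  + (2^-1 * (h (u x) * u x) - H (u x)).
Proof.
move=> [_ u0 _ _] [_ v0 _ _] t0 x x0.
have tv : 0 <= tau * v x by rewrite mulr_ge0// ltW.
have := H_convex ch hmon (u0 x) tv; rewrite /primitive_h -/H.
have -> : h (u x) * u x = h (u x) / u x * u x ^+ 2 by field; rewrite gt_eqF.
set g := h (u x) / u x; lra.
Qed.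

(** As a function of tau^2 the quadratic part of the energy is linear and H is
    convex, so the energy is concave along the ray. *)
Lemma energy_ray_le u du (tau : R) : admissible u du -> balanced u du -> 0 < tau ->
  energy (fun x => tau * u x) (fun x => tau * du x) <= energy u du.
Proof.
move=> au bu t0.
have at_ := admissible_scale t0 au.
pose z x := du x ^+ 2 + V x * u x ^+ 2 - h (u x) * u x.
have dz : exp_decay z by apply: dec_sub; [exact: dec_quad|exact: dec_hu au].
have Iz : Int z = 0.
  by rewrite /z IntB; [apply/eqP; rewrite subr_eq0; apply/eqP|exact: dec_quad|exact: dec_hu au].
have -> : energy u du = energy u du + (2^-1 * tau ^+ 2 - 2^-1) * Int z by rewrite Iz mulr0 addr0.
have du_ := dec_energy au.
rewrite -IntZ// -IntD//; last exact: dec_scale.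
apply: Int_le; [exact: dec_energy at_|apply: dec_add => //; exact: dec_scale|].
move=> x x0; apply: le_trans (energy_scale_le au au (ltW t0) x0) _.
have [_ u0 _ _] := au.
have -> : h (u x) / u x * u x ^+ 2 = h (u x) * u x by field; rewrite gt_eqF.
rewrite /z; lra.
Qed.

(** After the convexity bound only quadratic terms remain. Green's formula
    tested with v and with u, and the balance of u, allow adding integrals equal
    to zero; what is left is the weighted square
    (om^2 - V + h(u)/u) (v - u)^2 >= 0. *)
Lemma energy_step u du v dv w (tau : R) :
  admissible u du -> balanced u du -> admissible v dv ->
  (forall x, 0 <= x -> w x = (om ^+ 2 - V x) * u x + h (u x)) ->
  has_deriv dv (fun x => om ^+ 2 * v x - w x) -> dv 0 = 0 -> 0 < tau ->
  energy (fun x => tau * v x) (fun x => tau * dv x) <= energy u du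
  - 2^-1 * tau ^+ 2 * Int (fun x => (dv x - du x) ^+ 2 + om ^+ 2 * (v x - u x) ^+ 2).
Proof.
move=> au bu av wE hdv dv0 t0.
have [hu u0 cu cdu] := au; have [hv v0 cv cdv] := av.
have at_ := admissible_scale t0 av.
pose w0 x := om ^+ 2 * v x - ((om ^+ 2 - V x) * u x + h (u x)).
have dw0 : exp_decay w0.
  apply: dec_sub; first exact: dec_scale.
  apply: dec_add; last exact: dec_h au.
  apply: (@dec_mul_bdd _ (om ^+ 2)) => //.
    by apply: cont_sub => //; exact: cont_cst.
  move=> x x0; rewrite ger0_norm ?subr_ge0// gerBl.
  exact: le_trans (ltW V00) _.
have hdv' : half_deriv dv w0 by move=> x x0; rewrite /w0 -wE//; exact: hdv.
pose z1 x := dv x * dv x + w0 x * v x.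
pose z2 x := dv x * du x + w0 x * u x.
pose z3 x := du x ^+ 2 + V x * u x ^+ 2 - h (u x) * u x.
pose z4 x := (dv x - du x) ^+ 2 + om ^+ 2 * (v x - u x) ^+ 2.
have dz1 : exp_decay z1 by apply: dec_add; exact: dec_mul.
have dz2 : exp_decay z2 by apply: dec_add; exact: dec_mul.
have dz3 : exp_decay z3 by apply: dec_sub; [exact: dec_quad|exact: dec_hu au].
have dz4 : exp_decay z4.
  apply: dec_add; first by apply: dec_sq; exact: dec_sub.
  by apply: dec_scale; apply: dec_sq; exact: dec_sub.
have I1 : Int z1 = 0 by apply: (Int_green hv cv cdv cdv hdv' (dec_cont dw0) dv0).
have I2 : Int z2 = 0 by apply: (Int_green hu cu cdu cdv hdv' (dec_cont dw0) dv0).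
have I3 : Int z3 = 0.
  by rewrite /z3 IntB; [apply/eqP; rewrite subr_eq0; apply/eqP|exact: dec_quad|exact: dec_hu au].
have du_ := dec_energy au.
set t2 := 2^-1 * tau ^+ 2.
have -> : energy u du - t2 * Int z4 = energy u du + (- t2) * Int z4
    + tau ^+ 2 * Int z1 + (- tau ^+ 2) * Int z2 + (t2 - 2^-1) * Int z3.
  by rewrite I1 I2 I3 !mulr0 !addr0 mulNr.
have e1 := dec_scale (- t2) dz4; have e2 := dec_scale (tau ^+ 2) dz1.
have e3 := dec_scale (- tau ^+ 2) dz2; have e4 := dec_scale (t2 - 2^-1) dz3.
have f1 := dec_add du_ e1; have f2 := dec_add f1 e2; have f3 := dec_add f2 e3.
have f4 := dec_add f3 e4.
rewrite /energy -!IntZ// -IntD// -IntD// -IntD// -IntD//.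
apply: Int_le => //; first exact: dec_energy at_.
move=> x x0; apply: le_trans (energy_scale_le au av (ltW t0) x0) _.
rewrite /z1 /z2 /z3 /z4 /w0 -/t2.
have hu_ : h (u x) = h (u x) / u x * u x by rewrite divfK// gt_eqF.
set g := h (u x) / u x in hu_ *.
set a := om ^+ 2 - V x + g.
have a0 : 0 <= a.
  by rewrite addr_ge0 ?subr_ge0// divr_ge0 ?ltW// (h_gt0 b1 hb).
have t20 : 0 <= t2 by rewrite /t2 mulr_ge0 ?sqr_ge0// invr_ge0.
have key : 0 <= t2 * (a * (v x - u x) ^+ 2) by rewrite mulr_ge0// mulr_ge0// sqr_ge0.
rewrite hu_ -subr_ge0; move: key; rewrite /a.
have -> : tau ^+ 2 = 2 * t2 by rewrite /t2; field.
move=> key; apply: le_trans key _.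
rewrite le_eqVlt; apply/orP; left; apply/eqP; ring.
Qed.

End functional.

(** * Rays and the Nehari set *)

Section ray.
Context {R : realType}.
Implicit Types (u v du dv : R -> R) (r s t x y : R).
Variables (p b : R) (h : R -> R).
Hypotheses (p2 : 2 < p) (b1 : 1 <= b).
Hypotheses (ch : continuous h)
  (hb : forall s, 0 < s -> b^-1 * s `^ (p - 1) <= h s <= b * s `^ (p - 1)).
Variables (V : R -> R) (V0 om : R).
Hypotheses (cV : continuous V) (V00 : 0 < V0) (V0V : forall x, V0 <= V x)
  (Vom : forall x, V x <= om ^+ 2).

Let b0 : 0 < b. Proof. exact: lt_le_trans b1. Qed.

Lemma dec_powR (r : R) v : 1 < r -> (forall x, 0 < v x) -> exp_decay v -> exp_decay (fun x => v x `^ r).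
Proof.
move=> r1 v0 cv; have [B B0 vB] := dec_bdd cv.
apply: (@dec_le _ (B `^ (r - 1)) v) => //.
  move=> x; apply: (@continuous_comp _ _ _ v (fun t => t `^ r)).
    exact: dec_cont.
  exact: powR_continuous_gt0.
move=> x x0; rewrite !ger0_norm ?powR_ge0 ?(ltW (v0 x))// powRB1//.
rewrite mulrC ler_wpM2r ?(ltW (v0 x))//.
apply: ge0_ler_powR; rewrite ?nnegrE ?(ltW (v0 x)) ?(ltW B0)//; first by lra.
by rewrite -(gtr0_norm (v0 x)) vB.
Qed.

Section one_ray.
Variables (v dv : R -> R).
Hypothesis (av : admissible v dv).
Let v0 x : 0 < v x. Proof. by case: av. Qed.
Let cv : exp_decay v. Proof. by case: av. Qed.

Definition power_mass := Int (fun x => v x `^ p).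
Let Y := power_mass.

Let dY : exp_decay (fun x => v x `^ p). Proof. apply: dec_powR => //; have := p2; lra. Qed.

Lemma power_mass_gt0 : 0 < Y.
Proof. by apply: Int_gt0 => // x _; rewrite powR_gt0. Qed.

Let dhs t : 0 < t -> exp_decay (fun x => h (t * v x) * (t * v x)).
Proof. by move=> t0; apply: (dec_hu p2 b1 ch hb (admissible_scale t0 av)). Qed.

Lemma react_bounds t : 0 < t ->
  b^-1 * t `^ p * Y <= react h (fun x => t * v x) <= b * t `^ p * Y.
Proof.
move=> t0; rewrite /Y /power_mass -!IntZ//; apply/andP; split.
- apply: Int_le; [exact: dec_scale|exact: dhs|] => x _.
  have tv : 0 < t * v x by rewrite mulr_gt0.
  have /andP[+ _] := hb tv.
  rewrite -mulrA -powRM ?(ltW t0) ?(ltW (v0 x))// (powRB1 p tv) => hs.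
  by rewrite mulrCA mulrC ler_wpM2r// ltW.
- apply: Int_le; [exact: dhs|exact: dec_scale|] => x _.
  have tv : 0 < t * v x by rewrite mulr_gt0.
  have /andP[_ +] := hb tv.
  rewrite -mulrA -powRM ?(ltW t0) ?(ltW (v0 x))// (powRB1 p tv) => hs.
  by rewrite [leRHS]mulrCA [leRHS]mulrC ler_wpM2r// ltW.
Qed.

Lemma quad_scale t : quad V (fun x => t * v x) (fun x => t * dv x) = t ^+ 2 * quad V v dv.
Proof.
rewrite /quad -IntZ; last exact: (dec_quad cV V00 V0V Vom av).
by congr Int; apply/funext => x; ring.
Qed.

(** Uniform continuity of h on the compact range of the values involved, with v
    itself as the integrable weight. *)
Lemma react_continuous t : 0 < t -> {for t, continuous (fun s => react h (fun x => s * v x))}.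
Proof.
move=> t0; have [B B0 vB] := dec_bdd cv.
have I0 : 0 < Int v by apply: Int_gt0 => // x _.
apply/cvgrPdist_le => /= e e0.
pose e' := e / Int v; have e'0 : 0 < e' by rewrite divr_gt0.
have := proj1 (compact_near_coveringP _) (@segment_compact R 0 B).
move=> /(_ R (nbhs t) (fun s y => `|h (t * y) * t - h (s * y) * s| <= e') _).
have cov : forall y : R, `[0, B]%classic y ->
    \forall y' \near y & s \near t, `|h (t * y') * t - h (s * y') * s| <= e'.
  move=> y _.
  have : (fun z : R * R => h (t * z.1) * t - h (z.2 * z.1) * z.2) z @[z --> (y, t)] -->
      h (t * y) * t - h (t * y) * t.
    apply: cvgB; apply: cvgM.
    - apply: (@cvg_comp _ _ _ (fun z : R * R => t * z.1) h _ (nbhs (t * y))); last exact: ch.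
      by apply: cvgMl_tmp; exact: cvg_fst.
    - exact: cvg_cst.
    - apply: (@cvg_comp _ _ _ (fun z : R * R => z.2 * z.1) h _ (nbhs (t * y))); last exact: ch.
      by apply: cvgM; [exact: cvg_snd|exact: cvg_fst].
    - exact: cvg_snd.
  rewrite subrr => /cvgrPdist_le /(_ e' e'0).
  by apply: filterS => -[y' s] /=; rewrite sub0r normrN.
move=> /(_ cov) near_t.
near=> s.
have s0 : 0 < s by near: s; exact: lt_nbhsr.
have ns : forall y, 0 <= y <= B -> `|h (t * y) * t - h (s * y) * s| <= e'.
  by move=> y yB; apply: (near near_t s).
have -> : e = e' * Int v by rewrite /e' divfK// gt_eqF.
have dd := dec_sub (dhs t0) (dhs s0).
have de := dec_scale e' cv.
have key x : 0 <= x ->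
   `|h (t * v x) * (t * v x) - h (s * v x) * (s * v x)| <= e' * v x.
  move=> x0; rewrite !mulrA -mulrBl normrM (gtr0_norm (v0 x)) ler_wpM2r ?(ltW (v0 x))//.
  by rewrite ns// ltW//= -(gtr0_norm (v0 x)) vB.
rewrite /react -IntB; [|exact: dhs..].
rewrite -IntZ// ler_norml -mulN1r -IntZ//; apply/andP; split; apply: Int_le => //.
- exact: dec_scale.
- by move=> x /key; rewrite mulN1r ler_norml => /andP[].
- by move=> x /key; rewrite ler_norml => /andP[].
Unshelve. all: by end_near. Qed.

Lemma balanced_scale_bounds t : 0 < t ->
  balanced h V (fun x => t * v x) (fun x => t * dv x) ->
  b^-1 * t `^ (p - 2) * Y <= quad V v dv <= b * t `^ (p - 2) * Y.
Proof.
move=> t0; rewrite /balanced quad_scale => bal.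
have := react_bounds t0; rewrite -bal (powRp p t0).
have t20 : 0 < t ^+ 2 by rewrite exprn_gt0.
have -> : b^-1 * (t * t * t `^ (p - 2)) * Y = t ^+ 2 * (b^-1 * t `^ (p - 2) * Y) by ring.
have -> : b * (t * t * t `^ (p - 2)) * Y = t ^+ 2 * (b * t `^ (p - 2) * Y) by ring.
by rewrite !ler_pM2l.
Qed.

(** The two-sided power bounds on the reaction confine the crossing to an
    explicit interval, on which the intermediate value theorem applies. *)
Lemma balanced_scale_exists : exists2 t : R, 0 < t &
  balanced h V (fun x => t * v x) (fun x => t * dv x).
Proof.
have Q0 : 0 < quad V v dv by exact: (quad_gt0 cV V00 V0V Vom av).
have Y0 := power_mass_gt0.
have p20 : 0 < p - 2 by have := p2; lra.
set Q := quad V v dv in Q0.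
pose t1 := (Q / (b * Y)) `^ (p - 2)^-1; pose t2 := (b * Q / Y) `^ (p - 2)^-1.
have t10 : 0 < t1 by rewrite powR_gt0// divr_gt0// mulr_gt0.
have t20 : 0 < t2 by rewrite powR_gt0// divr_gt0// mulr_gt0.
have t1E : t1 `^ (p - 2) = Q / (b * Y).
  rewrite /t1 -powRrM mulVf ?gt_eqF// powRr1//.
  by rewrite divr_ge0 ?mulr_ge0// ltW.
have t2E : t2 `^ (p - 2) = b * Q / Y.
  rewrite /t2 -powRrM mulVf ?gt_eqF// powRr1//.
  by rewrite divr_ge0 ?mulr_ge0// ltW.
have t12 : t1 <= t2.
  apply: ge0_ler_powR; rewrite ?nnegrE ?invr_ge0 ?(ltW p20)//.
  - by rewrite divr_ge0 ?mulr_ge0// ltW.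
  - by rewrite divr_ge0 ?mulr_ge0// ltW.
  - rewrite ler_pdivrMr ?mulr_gt0//.
    have -> : b * Q / Y * (b * Y) = b ^+ 2 * Q by field; rewrite gt_eqF.
    by rewrite ler_peMl ?(ltW Q0)// exprn_ege1.
pose K t := react h (fun x => t * v x) - t ^+ 2 * Q.
have cK : {within `[t1, t2], continuous K}.
  apply: continuous_in_subspaceT => t; rewrite inE/= in_itv/= => /andP[t1t _].
  apply: cvgB; first by apply: react_continuous; exact: lt_le_trans t1t.
  by apply: cvgMr_tmp; exact: exprn_continuous.
have K1 : K t1 <= 0.
  rewrite /K subr_le0; have /andP[_ h1] := react_bounds t10; apply: le_trans h1 _.
  rewrite (powRp p t10) t1E.
  have -> // : b * (t1 * t1 * (Q / (b * Y))) * Y = t1 ^+ 2 * Q.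
  by field; rewrite !gt_eqF.
have K2 : 0 <= K t2.
  rewrite /K subr_ge0; have /andP[h1 _] := react_bounds t20; apply: le_trans h1.
  rewrite (powRp p t20) t2E.
  have -> // : b^-1 * (t2 * t2 * (b * Q / Y)) * Y = t2 ^+ 2 * Q.
  by field; rewrite !gt_eqF.
have [|t] := IVT t12 cK (v := 0).
  by rewrite ge_min K1/= le_max K2 orbT.
rewrite in_itv/= => /andP[t1t _] Kt; exists t; first exact: lt_le_trans t1t.
apply/eqP; rewrite quad_scale -/Q eq_sym -subr_eq0; apply/eqP; exact: Kt.
Qed.

End one_ray.
End ray.

(** * A descent iteration on the Nehari set *)

Section iteration.
Context {R : realType}.
Implicit Types (u v du dv : R -> R) (r s t x y : R) (n : nat).
Variables (p b : R) (h : R -> R).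
Hypotheses (p2 : 2 < p) (b1 : 1 <= b) (bp : b ^+ 2 < p / 2).
Hypotheses (ch : continuous h)
  (hb : forall s, 0 < s -> b^-1 * s `^ (p - 1) <= h s <= b * s `^ (p - 1))
  (hmon : forall s t, 0 < s -> s <= t -> h s / s <= h t / t).
Variables (V : R -> R) (V0 om : R).
Hypotheses (cV : continuous V) (V00 : 0 < V0) (V0V : forall x, V0 <= V x)
  (om0 : 0 < om) (Vom : forall x, V x <= om ^+ 2).

Let b0 : 0 < b. Proof. exact: lt_le_trans b1. Qed.

(** Reflected in x, since the Green function of the half-line was obtained by
    even extension. *)
Definition source u x := (om ^+ 2 - V `|x|) * u `|x| + h (u `|x|).

Definition dist2 u du v dv : R :=
  Int (fun x => (dv x - du x) ^+ 2 + om ^+ 2 * (v x - u x) ^+ 2).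

Lemma next_iterate u du : admissible u du -> balanced h V u du ->
  exists (v dv : R -> R) (tau : R),
  [/\ admissible v dv, 0 < tau,
      admissible (fun x => tau * v x) (fun x => tau * dv x) /\
      balanced h V (fun x => tau * v x) (fun x => tau * dv x),
      energy h V (fun x => tau * v x) (fun x => tau * dv x) <= energy h V u du
        - 2^-1 * tau ^+ 2 * dist2 u du v dv &
   [/\ has_deriv dv (fun x => om ^+ 2 * v x - source u x), dv 0 = 0,
      (forall x, v (- x) = v x), (forall x, 0 <= x -> `|dv x| <= om * v x) &
      forall S, (forall x, 0 <= x -> u x <= S) ->
        forall x, 0 <= x -> v x <= (om ^+ 2 + b * S `^ (p - 2)) * S / om ^+ 2]].
Proof.
move=> au bu; have [hu u0 cu cdu] := au.
have cn : continuous (fun x : R => `|x|) by exact: norm_continuous.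
have cua : continuous (fun x => u `|x|) by exact: cont_comp (dec_cont cu) cn.
have cw : continuous (source u).
  apply: cont_add; last exact: cont_comp ch cua.
  apply: cont_mul => //; apply: cont_sub; first exact: cont_cst.
  exact: cont_comp cV cn.
have we x : source u (- x) = source u x by rewrite /source normrN.
have w0 x : 0 < source u x.
  rewrite ltr_wpDl ?(h_gt0 b1 hb)// mulr_ge0 ?subr_ge0//.
  exact: ltW.
have wE x : 0 <= x -> source u x = (om ^+ 2 - V x) * u x + h (u x).
  by move=> x0; rewrite /source ger0_norm.
have dw : exp_decay (source u).
  have [B B0 uB] := dec_bdd cu.
  apply: (@dec_le _ (om ^+ 2 + b * B `^ (p - 2)) u) => // x x0.
  rewrite !gtr0_norm// wE// [leRHS]mulrDl lerD//.
    rewrite ler_wpM2r ?(ltW (u0 x))// gerBl.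
    exact: le_trans (ltW V00) _.
  by apply: (h_le_lin p2 b1 hb) => //; rewrite -(gtr0_norm (u0 x)) uB.
have [v [dv [hv hdv [ve dv0] [v0 dvb cv cdv vS]]]] := green_solution om0 cw we w0 dw.
have av : admissible v dv by split.
have [tau t0 bt] := balanced_scale_exists p2 b1 ch hb cV V00 V0V Vom av.
exists v, dv, tau; split.
- exact: av.
- exact: t0.
- by split; [exact: (admissible_scale t0 av)|exact: bt].
- exact: (energy_step p2 b1 ch hb hmon cV V00 V0V Vom au bu av wE hdv dv0 t0).
- split; [exact: hdv|exact: dv0|exact: ve|exact: dvb|move=> S uS].
  apply: vS => x x0; rewrite wE// [leRHS]mulrDl lerD//.
    apply: (@le_trans _ _ (om ^+ 2 * u x)).
      rewrite ler_wpM2r ?(ltW (u0 x))// gerBl.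
      exact: le_trans (ltW V00) _.
    by rewrite ler_wpM2l ?sqr_ge0// uS.
  have uSx := uS x x0.
  apply: le_trans (h_le_lin p2 b1 hb (u0 x) uSx) _.
  by rewrite ler_wpM2l// mulr_ge0 ?powR_ge0// ltW.
Qed.

Record iterates (U DU W DW : nat -> R -> R) (T : nat -> R) : Prop := Iterates {
  it_adm : forall n, admissible (U n) (DU n) ;
  it_bal : forall n, balanced h V (U n) (DU n) ;
  it_W : forall n, admissible (W n) (DW n) ;
  it_T : forall n, 0 < T n ;
  it_U : forall n x, U n.+1 x = T n * W n x ;
  it_energy : forall n, energy h V (U n.+1) (DU n.+1) <= energy h V (U n) (DU n)
        - 2^-1 * T n ^+ 2 * dist2 (U n) (DU n) (W n) (DW n) ;
  it_ode : forall n, has_deriv (DW n) (fun x => om ^+ 2 * W n x - source (U n) x) ;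
  it_DW0 : forall n, DW n 0 = 0 ;
  it_even : forall n x, W n (- x) = W n x ;
  it_slope : forall n x, 0 <= x -> `|DW n x| <= om * W n x ;
  it_sup : forall n S, (forall x, 0 <= x -> U n x <= S) ->
        forall x, 0 <= x -> W n x <= (om ^+ 2 + b * S `^ (p - 2)) * S / om ^+ 2 }.

Lemma iterates_exist u du : admissible u du -> balanced h V u du ->
  exists U DU W DW T, [/\ iterates U DU W DW T, U 0%N = u & DU 0%N = du].
Proof.
move=> au bu.
pose st := {q : (R -> R) * (R -> R) | admissible q.1 q.2 /\ balanced h V q.1 q.2}.
pose good (q : st) (z : (R -> R) * (R -> R) * R) :=
  let u := (sval q).1 in let du := (sval q).2 in
  let v := z.1.1 in let dv := z.1.2 in let tau := z.2 in
  [/\ admissible v dv, 0 < tau,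
      admissible (fun x => tau * v x) (fun x => tau * dv x) /\
      balanced h V (fun x => tau * v x) (fun x => tau * dv x),
      energy h V (fun x => tau * v x) (fun x => tau * dv x) <= energy h V u du
        - 2^-1 * tau ^+ 2 * dist2 u du v dv &
   [/\ has_deriv dv (fun x => om ^+ 2 * v x - source u x), dv 0 = 0,
      (forall x, v (- x) = v x), (forall x, 0 <= x -> `|dv x| <= om * v x) &
      forall S, (forall x, 0 <= x -> u x <= S) ->
        forall x, 0 <= x -> v x <= (om ^+ 2 + b * S `^ (p - 2)) * S / om ^+ 2]].
have ex q : exists z, good q z.
  by case: q => -[u' du'] [au' bu']; have [v [dv [tau ?]]] := next_iterate au' bu';
    exists (v, dv, tau).
have [N NP] := choice ex.
pose nx (q : st) : st := exist _ (fun x => (N q).2 * (N q).1.1 x, fun x => (N q).2 * (N q).1.2 x)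
  (let: And5 _ _ ab _ _ := NP q in ab).
pose q0 : st := exist _ (u, du) (conj au bu).
pose Q n := iter n nx q0.
exists (fun n => (sval (Q n)).1), (fun n => (sval (Q n)).2),
  (fun n => (N (Q n)).1.1), (fun n => (N (Q n)).1.2), (fun n => (N (Q n)).2).
split; [|by []|by []].
have QS n : Q n.+1 = nx (Q n) by [].
split.
- by move=> n; have [] := svalP (Q n).
- by move=> n; have [] := svalP (Q n).
- by move=> n; have [] := NP (Q n).
- by move=> n; have [] := NP (Q n).
- by move=> n x; rewrite QS.
- by move=> n; rewrite QS; have [] := NP (Q n).
- by move=> n; have [_ _ _ _ []] := NP (Q n).
- by move=> n; have [_ _ _ _ []] := NP (Q n).
- by move=> n; have [_ _ _ _ []] := NP (Q n).
- by move=> n; have [_ _ _ _ []] := NP (Q n).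
- by move=> n; have [_ _ _ _ []] := NP (Q n).
Qed.

Section bounds.
Variables (U DU W DW : nat -> R -> R) (T : nat -> R) (E0 : R).
Hypotheses (it : iterates U DU W DW T) (E0P : energy h V (U 0%N) (DU 0%N) <= E0).

Let th := 2^-1 - b ^+ 2 / p.
Let th0 : 0 < th.
Proof.
rewrite subr_gt0 ltr_pdivrMr; last by have := p2; lra.
by rewrite mulrC.
Qed.

Let Uadm n := it_adm it n.
Let U0 n x : 0 < U n x. Proof. by case: (Uadm n). Qed.
Let W0 n x : 0 < W n x. Proof. by case: (it_W it n). Qed.

Lemma dist2_ge0 n : 0 <= dist2 (U n) (DU n) (W n) (DW n).
Proof.
have [_ _ cu cdu] := Uadm n; have [_ _ cv cdv] := it_W it n.
apply: Int_ge0; last by move=> x _; rewrite addr_ge0 ?sqr_ge0// mulr_ge0 ?sqr_ge0.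
apply: dec_add; first by apply: dec_sq; exact: dec_sub.
by apply: dec_scale; apply: dec_sq; exact: dec_sub.
Qed.

Lemma energy_le0 n : energy h V (U n) (DU n) <= E0.
Proof.
elim: n => [//|n IH]; apply: le_trans (it_energy it n) _; apply: le_trans IH.
by rewrite gerBl mulr_ge0 ?dist2_ge0// mulr_ge0 ?sqr_ge0.
Qed.

Lemma energy_U_ge n : th * quad V (U n) (DU n) <= energy h V (U n) (DU n).
Proof. exact: (energy_ge p2 b1 ch hb cV V00 V0V Vom (Uadm n) (it_bal it n)). Qed.

Lemma quad_U_gt0 n : 0 < quad V (U n) (DU n).
Proof. exact: (quad_gt0 cV V00 V0V Vom (Uadm n)). Qed.

Lemma quad_U_le n : quad V (U n) (DU n) <= E0 / th.
Proof.
rewrite ler_pdivlMr// mulrC; exact: le_trans (energy_U_ge n) (energy_le0 n).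
Qed.

(** Coercivity of the energy on balanced functions composed with the Sobolev
    bound. The constant involves neither the upper bound om of V nor h beyond
    its closeness b to the power, so it is uniform in the perturbation. *)
Definition sup_bound := Num.sqrt (E0 / (2^-1 - b ^+ 2 / p) / Num.sqrt V0).
Let M := sup_bound.

Lemma U_le n x : 0 <= x -> U n x <= M.
Proof.
move=> x0; rewrite -(ger0_norm (ltW (U0 n x))) -sqrtr_sqr; apply: ler_wsqrtr.
apply: le_trans (sup_le_quad cV V00 V0V Vom (Uadm n) x0) _.
by rewrite ler_wpM2r ?invr_ge0 ?sqrtr_ge0// quad_U_le.
Qed.

Definition W_bound := (om ^+ 2 + b * sup_bound `^ (p - 2)) * sup_bound / om ^+ 2.

Lemma W_le n x : W n x <= W_bound.
Proof.
wlog x0 : x / 0 <= x.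
  by move=> H; have [/H//|/ltW x0] := leP 0 x; rewrite -(it_even it) H// oppr_ge0.
by apply: (it_sup it) => // y; exact: U_le.
Qed.

Lemma W_bound_gt0 : 0 < W_bound.
Proof. exact: lt_le_trans (W0 0 0) (W_le 0 0). Qed.

(** The energies decrease to a limit, so the drops tend to 0. The factors T n
    stay away from 0: W n is bounded, whereas T n * W n is balanced and hence
    not small. *)
Lemma dist2_cvg0 : dist2 (U n) (DU n) (W n) (DW n) @[n --> \oo] --> 0.
Proof.
have [e eE] : exists e : nat -> R, forall n, e n = energy h V (U n) (DU n) by eexists.
have p20 : 0 < p - 2 by have := p2; lra.
pose t0 := (V0 / b) `^ (p - 2)^-1 / W_bound.
have t00 : 0 < t0 by rewrite divr_gt0 ?W_bound_gt0// powR_gt0// divr_gt0.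
have Tt n : t0 <= T n.
  rewrite ler_pdivrMr ?W_bound_gt0//.
  have TW0 : 0 < T n * W_bound by rewrite mulr_gt0 ?W_bound_gt0// (it_T it).
  have UW x : 0 <= x -> U n.+1 x <= T n * W_bound.
    by move=> x0; rewrite (it_U it) ler_wpM2l ?W_le// ltW// (it_T it).
  have hV := balanced_sup p2 b1 ch hb cV V00 V0V Vom (Uadm n.+1) (it_bal it n.+1) TW0 UW.
  have -> : T n * W_bound = ((T n * W_bound) `^ (p - 2)) `^ (p - 2)^-1.
    by rewrite -powRrM mulfV ?gt_eqF// powRr1// ltW.
  apply: ge0_ler_powR; rewrite ?nnegrE ?invr_ge0 ?(ltW p20) ?powR_ge0//.
    by rewrite divr_ge0// ltW.
  by rewrite ler_pdivrMr// mulrC.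
have enoninc : nonincreasing_seq e.
  apply/nonincreasing_seqP => n; rewrite !eE; apply: le_trans (it_energy it n) _.
  by rewrite gerBl mulr_ge0 ?dist2_ge0// mulr_ge0 ?sqr_ge0.
have elb : has_lbound (range e).
  exists 0 => _ [n _ <-]; rewrite eE; apply: le_trans (energy_U_ge n).
  by rewrite mulr_ge0 ?ltW// quad_U_gt0.
have ecvg := nonincreasing_is_cvgn enoninc elb.
have ecvg' : e n.+1 @[n --> \oo] --> limn e by rewrite (cvg_shiftS e).
have dcvg : (2 / t0 ^+ 2) * (e n - e n.+1) @[n --> \oo] --> 0.
  have : (2 / t0 ^+ 2) * (e n - e n.+1) @[n --> \oo] --> (2 / t0 ^+ 2) * (limn e - limn e).
    have h1 : (e n - e n.+1) @[n --> \oo] --> limn e - limn e by exact: (cvgB ecvg ecvg').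
    exact: (cvgMl_tmp (a := 2 / t0 ^+ 2) h1).
  by rewrite subrr mulr0.
apply: (@squeeze_cvgr _ _ _ _ (fun=> 0) (fun n => (2 / t0 ^+ 2) * (e n - e n.+1))) => //; last exact: cvg_cst.
near=> n; rewrite dist2_ge0/=.
rewrite mulrAC ler_pdivlMr ?exprn_gt0//.
have h1 := it_energy it n; rewrite -!eE in h1.
have h2 : t0 ^+ 2 <= T n ^+ 2 by rewrite lerXn2r ?nnegrE ?(ltW t00) ?(ltW (it_T it n)).
have := ler_wpM2l (dist2_ge0 n) h2; lra.
Unshelve. all: by end_near. Qed.

Lemma W_sub_U (e : R) : 0 < e ->
  \forall n \near \oo, forall x, 0 <= x -> `|W n x - U n x| <= e.
Proof.
move=> e0; have e20 : 0 < om * e ^+ 2 by rewrite mulr_gt0// exprn_gt0.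
have /cvgrPdist_le /(_ _ e20) := dist2_cvg0.
apply: filterS => n; rewrite sub0r normrN ger0_norm ?dist2_ge0// => hn x x0.
have [hu _ cu cdu] := Uadm n; have [hv _ cv cdv] := it_W it n.
have hd : has_deriv (fun x => W n x - U n x) (fun x => DW n x - DU n x).
  by move=> y; have := hu y; have := hv y => d1 d2; exact: is_deriveB.
have := sobolev_sup om hd (dec_sub cv cu) (dec_sub cdv cdu) x0.
move=> /le_trans /(_ hn); rewrite ler_pM2l// => h2.
by rewrite -(ger0_norm (ltW e0)) -!sqrtr_sqr ler_wsqrtr.
Qed.

Lemma prim_U2_le n (X : R) : 0 <= X -> prim (fun x => U n x ^+ 2) X <= E0 / th / V0.
Proof.
move=> X0; have [_ _ cu _] := Uadm n.
apply: le_trans (Int_ge_prim (dec_sq cu) X0 _) _; first by move=> y _; rewrite sqr_ge0.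
rewrite ler_pdivlMr// mulrC -IntZ; last exact: dec_sq.
apply: le_trans (quad_U_le n); apply: Int_le.
- by apply: dec_scale; exact: dec_sq.
- exact: (dec_quad cV V00 V0V Vom (Uadm n)).
- move=> x _; apply: (@le_trans _ _ (V x * U n x ^+ 2)).
    by rewrite ler_wpM2r ?sqr_ge0.
  by rewrite lerDr sqr_ge0.
Qed.

End bounds.
End iteration.

(** * Limits of the iterates along an ultrafilter *)

Section prim_more.
Context {R : realType}.
Implicit Types (f g : R -> R) (x y X e c : R).

Lemma prim_odd f x : continuous f -> (forall y, f (- y) = f y) -> prim f (- x) = - prim f x.
Proof.
move=> cf fe.
have dG y : is_derive y 1 (fun z => prim f (- z) + prim f z) 0.
  have d1 : is_derive y 1 (fun z => prim f (- z)) (- f (- y)).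
    have dA : is_derive (- y) 1 (prim f) (f (- y)) by exact: primD.
    have -> : (fun z => prim f (- z)) = prim f \o -%R by [].
    by apply: is_derive_eq; rewrite mulrN mulr1.
  have d2 : is_derive y 1 (prim f) (f y) by exact: primD.
  by apply: is_derive_eq; rewrite fe addNr.
have := is_derive_0_is_cst x 0 dG.
by rewrite /= oppr0 prim0 addr0; lra.
Qed.

Lemma prim_even f x : continuous f -> (forall y, f (- y) = - f y) -> prim f (- x) = prim f x.
Proof.
move=> cf fe.
have dG y : is_derive y 1 (fun z => prim f (- z) - prim f z) 0.
  have d1 : is_derive y 1 (fun z => prim f (- z)) (- f (- y)).
    have dA : is_derive (- y) 1 (prim f) (f (- y)) by exact: primD.
    have -> : (fun z => prim f (- z)) = prim f \o -%R by [].
    by apply: is_derive_eq; rewrite mulrN mulr1.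
  have d2 : is_derive y 1 (prim f) (f y) by exact: primD.
  by apply: is_derive_eq; rewrite fe opprK subrr.
have := is_derive_0_is_cst x 0 dG.
by rewrite /= oppr0 prim0 subr0; lra.
Qed.

Lemma primZ c f x : continuous f -> 0 <= x -> prim (fun y => c * f y) x = c * prim f x.
Proof.
move=> cf x0.
have hd : half_deriv (fun y => c * prim f y) (fun y => c * f y).
  by move=> y _; have d := primD cf y; apply: is_derive_eq.
by rewrite (prim_eq (cont_scale (c := c) cf) x0 hd) prim0 mulr0 subr0.
Qed.

Lemma prim_addc e f x : continuous f -> 0 <= x -> prim (fun y => f y + e) x = prim f x + e * x.
Proof.
move=> cf x0.
have hd : half_deriv (fun y => prim f y + e * y) (fun y => f y + e).
  by move=> y _; have d := primD cf y; apply: is_derive_eq; rewrite ?scaleRE; ring.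
rewrite (prim_eq _ x0 hd) ?prim0 ?mulr0 ?addr0 ?subr0//.
by apply: cont_add => //; exact: cont_cst.
Qed.

Lemma prim_dist e f g x : continuous f -> continuous g -> 0 <= x ->
  (forall y, 0 <= y <= x -> `|f y - g y| <= e) -> `|prim f x - prim g x| <= e * x.
Proof.
move=> cf cg x0 fg.
have ce (k : R -> R) : continuous k -> continuous (fun y => k y + e).
  by move=> ck; apply: cont_add => //; exact: cont_cst.
have h1 : prim f x <= prim g x + e * x.
  rewrite -prim_addc//; apply: prim_le0 => // [|y /andP[y0 yx]]; first exact: ce.
  have : `|f y - g y| <= e by apply: fg; rewrite !ltW.
  by rewrite ler_norml => /andP[]; lra.
have h2 : prim g x <= prim f x + e * x.
  rewrite -prim_addc//; apply: prim_le0 => // [|y /andP[y0 yx]]; first exact: ce.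
  have : `|f y - g y| <= e by apply: fg; rewrite !ltW.
  by rewrite ler_norml => /andP[]; lra.
by rewrite ler_norml; lra.
Qed.

Lemma prim_ext f g x : continuous f -> continuous g -> 0 <= x ->
  (forall y, 0 <= y -> f y = g y) -> prim f x = prim g x.
Proof.
move=> cf cg x0 fg; apply/eqP; rewrite eq_le; apply/andP.
by split; apply: prim_le0 => // y /andP[/ltW y0 _]; rewrite fg.
Qed.

End prim_more.

Section filter_limits.
Context {R : realType}.
Implicit Types (x y X e c : R) (n : nat).

Lemma cvgR_unique (T : Type) (F : set_system T) (f : T -> R) (l l' : R) :
  ProperFilter F -> f t @[t --> F] --> l -> f t @[t --> F] --> l' -> l = l'.
Proof.
by move=> FF fl fl'; transitivity (lim (f @ F)); [apply/esym|]; exact: cvg_lim.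
Qed.

Lemma ultra_bounded_cvg (T : Type) (F : set_system T) (f : T -> R) (a b : R) :
  UltraFilter F -> (forall t, a <= f t <= b) -> exists l : R, f t @[t --> F] --> l.
Proof.
move=> UF fab.
have Fab : (fmap f F) `[a, b]%classic.
  by apply: (@filterS _ F _ setT) => [t _|]; [rewrite /= in_itv/=; exact: fab|exact: filterT].
have [l [_ cl]] := @segment_compact R a b (fmap f F) _ Fab; exists l => B lB.
have [//|FB] := in_ultra_setVsetC (f @^-1` B) UF.
have [x [nBx Bx]] := cl (~` B) B FB lB.
by have := nBx Bx.
Qed.

Variables (F : set_system nat).
Context {FF : ProperFilter F}.

Definition locally_uniform (G : nat -> R -> R) (g : R -> R) := forall X e, 0 < e ->
  \forall n \near F, forall y, 0 <= y <= X -> `|G n y - g y| <= e.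

(** Convergence along the product filter is what equi-continuity provides, and
    it passes through compositions and products; compactness of segments then
    turns it into local uniform convergence. *)
Definition joint_limit (G : nat -> R -> R) (g : R -> R) := forall y,
  (fun z : R * nat => G z.2 z.1) @ (filter_prod (nbhs y) F) --> g y.

Lemma locally_uniform_joint G g : continuous g -> joint_limit G g -> locally_uniform G g.
Proof.
move=> cg Gg X e e0.
have := proj1 (compact_near_coveringP _) (@segment_compact R 0 X).
move=> /(_ nat F (fun n y => `|G n y - g y| <= e) _).
have cov : forall y : R, `[0, X]%classic y ->
    \forall y' \near y & n \near F, `|G n y' - g y'| <= e.
  move=> y _.
  have g1 : (fun z : R * nat => g z.1) @ (filter_prod (nbhs y) F) --> g y.
    by apply: (@cvg_comp _ _ _ fst g _ (nbhs y)); [exact: cvg_fst|exact: cg].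
  have : (fun z : R * nat => G z.2 z.1 - g z.1) @ (filter_prod (nbhs y) F) --> g y - g y.
    by apply: cvgB => //; exact: Gg.
  rewrite subrr => /cvgrPdist_le /(_ e e0).
  by apply: filterS => -[y' n] /=; rewrite sub0r normrN.
move=> /(_ cov); apply: filterS => n h y yX; apply: h => /=.
by rewrite in_itv.
Qed.

Lemma locally_uniform_prim (G : nat -> R -> R) g :
  (forall n, continuous (G n)) -> continuous g -> locally_uniform G g ->
  locally_uniform (fun n => prim (G n)) (prim g).
Proof.
move=> cG cg Gg X e e0.
have [X0|X0] := leP X 0.
  near=> n => y /andP[y0 yX].
  have -> : y = 0 by apply/eqP; rewrite eq_le y0 (le_trans yX X0).
  by rewrite !prim0 subrr normr0 ltW.
have e'0 : 0 < e / X by rewrite divr_gt0.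
have := Gg X _ e'0; apply: filterS => n h y /andP[y0 yX].
apply: (@le_trans _ _ (e / X * y)).
  apply: prim_dist => // z /andP[z0 zy]; apply: h.
  by rewrite z0 (le_trans zy).
by rewrite mulrAC ler_pdivrMr// ler_wpM2l// ltW.
Unshelve. all: by end_near. Qed.

Lemma locally_uniform_cvg G g x : locally_uniform G g -> 0 <= x ->
  G n x @[n --> F] --> g x.
Proof.
move=> Gg x0; apply/cvgrPdist_le => e e0.
by have := Gg x e e0; apply: filterS => n h; rewrite distrC h// x0 lexx.
Qed.

End filter_limits.

Section limit.
Context {R : realType}.
Implicit Types (u v du dv : R -> R) (r s t x y : R) (n : nat).
Variables (p b : R) (h : R -> R).
Hypotheses (p2 : 2 < p) (b1 : 1 <= b) (bp : b ^+ 2 < p / 2).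
Hypotheses (ch : continuous h)
  (hb : forall s, 0 < s -> b^-1 * s `^ (p - 1) <= h s <= b * s `^ (p - 1)).
Variables (V : R -> R) (V0 om : R).
Hypotheses (cV : continuous V) (V00 : 0 < V0) (V0V : forall x, V0 <= V x)
  (om0 : 0 < om) (Vom : forall x, V x <= om ^+ 2) (Ve : forall x, V (- x) = V x).
Variables (U DU W DW : nat -> R -> R) (T : nat -> R) (E0 : R).
Hypotheses (it : iterates p b h V om U DU W DW T)
  (E0P : energy h V (U 0%N) (DU 0%N) <= E0).
Variables (sg L : R).
Hypotheses (sg0 : 0 < sg) (Usg : forall n, exists2 x, 0 <= x <= L & sg <= U n x).

Let S := W_bound p b V0 om E0.
Let Kl := om * S.

Let S0 : 0 < S.
Proof. exact: (W_bound_gt0 p2 b1 bp ch hb cV V00 V0V Vom it E0P). Qed.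
Let Kl0 : 0 < Kl. Proof. by rewrite mulr_gt0. Qed.

Let WS n x : W n x <= S.
Proof. exact: (W_le p2 b1 bp ch hb cV V00 V0V Vom it E0P). Qed.

Let W0 n x : 0 < W n x. Proof. by case: (it_W it n). Qed.

Let Wabs n x : W n `|x| = W n x.
Proof. by have [x0|x0] := ger0P x; rewrite ?(it_even it). Qed.

Let Vabs x : V `|x| = V x.
Proof. by have [x0|x0] := ger0P x; rewrite ?Ve. Qed.

(* The slope bound and the sup bound make the iterates equi-Lipschitz. *)
Let W_lip n x y : `|W n x - W n y| <= Kl * `|x - y|.
Proof.
rewrite -(Wabs n x) -(Wabs n y); apply: (@le_trans _ _ (Kl * `| `|x| - `|y| |)); last first.
  by rewrite ler_wpM2l ?(ltW Kl0)// ler_dist_dist.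
have := normr_ge0 x; have := normr_ge0 y.
move: `|x| `|y| => {}x {}y y0 x0.
wlog xy : x y x0 y0 / x <= y.
  move=> wh; have [/wh|/ltW /wh] := leP x y; first exact.
  by rewrite distrC (distrC x); apply.
have [hv _ _ _] := it_W it n.
have d1 : has_deriv (fun z => Kl * z - W n z) (fun z => Kl - DW n z).
  by move=> z; have d := hv z; apply: is_derive_eq; rewrite ?scaleRE; ring.
have d2 : has_deriv (fun z => Kl * z + W n z) (fun z => Kl + DW n z).
  by move=> z; have d := hv z; apply: is_derive_eq; rewrite ?scaleRE; ring.
have sl z : x < z < y -> `|DW n z| <= Kl.
  move=> /andP[xz _]; apply: le_trans (it_slope it _ _) _.
    exact: le_trans (ltW xz).
  by rewrite ler_wpM2l ?(ltW om0).
have h1 := le_of_has_deriv d1 xy; have h2 := le_of_has_deriv d2 xy.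
have k1 : forall z, x < z < y -> 0 <= Kl - DW n z.
  by move=> z /sl; rewrite ler_norml => /andP[]; lra.
have k2 : forall z, x < z < y -> 0 <= Kl + DW n z.
  by move=> z /sl; rewrite ler_norml => /andP[]; lra.
rewrite [`|x - y|]distrC (ger0_norm (_ : 0 <= y - x)) ?subr_ge0//.
by rewrite ler_norml; have := h1 k1; have := h2 k2; lra.
Qed.

Section ultra.
Variable (F : set_system nat).
Hypotheses (UF : UltraFilter F) (FN : \oo `<=` F).
Let FF : ProperFilter F := @ultra_proper _ _ UF.
Local Existing Instance FF.

Variable (w : R -> R).
Hypothesis (Ww : forall x, W n x @[n --> F] --> w x).

Let we x : w (- x) = w x.
Proof.
have := @Ww (- x); under [X in X @ _ --> _]eq_fun do rewrite (it_even it).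
by move=> h1; exact: (cvgR_unique FF h1 (@Ww x)).
Qed.

Let w_lip x y : `|w x - w y| <= Kl * `|x - y|.
Proof.
have : `|W n x - W n y| @[n --> F] --> `|w x - w y| by apply: cvg_norm; exact: cvgB.
by move=> /cvgr_to_le; apply; near=> n; exact: W_lip.
Unshelve. all: by end_near. Qed.

Let cw : continuous w.
Proof.
move=> x; apply/cvgrPdist_le => /= e e0.
have e0' : 0 < e / Kl by rewrite divr_gt0.
near=> y; apply: le_trans (w_lip x y) _.
rewrite mulrC -ler_pdivlMr// ltW//; near: y; exact: nbhsx_ballx.
Unshelve. all: by end_near. Qed.

Let jW : joint_limit F (fun n y => W n `|y|) w.
Proof.
move=> y; apply/cvgrPdist_le => /= e e0.
have e20 : 0 < e / 2 by rewrite divr_gt0.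
have e0' : 0 < e / 2 / Kl by rewrite divr_gt0.
have /cvgrPdist_le /(_ _ e20) h1 := @Ww y.
exists (ball y (e / 2 / Kl), [set n | `|w y - W n y| <= e / 2]) => //=.
  by split => //; exact: nbhsx_ballx.
move=> [y' n] /= [by' hn]; rewrite Wabs.
have -> : w y - W n y' = (w y - W n y) + (W n y - W n y') by ring.
apply: le_trans (ler_normD _ _) _; rewrite (splitr e) lerD//.
apply: le_trans (W_lip n y y') _.
by rewrite mulrC -ler_pdivlMr// ltW.
Qed.

Let jU : joint_limit F (fun n y => U n `|y|) w.
Proof.
move=> y; apply/cvgrPdist_le => /= e e0.
have e20 : 0 < e / 2 by rewrite divr_gt0.
have /cvgrPdist_le /(_ _ e20) h1 := @jW y.
have h2 := FN (W_sub_U p2 b1 bp ch hb cV V00 V0V om0 Vom it E0P e20).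
have h3 : filter_prod (nbhs y) F
    [set z : R * nat | forall x, 0 <= x -> `|W z.2 x - U z.2 x| <= e / 2].
  by exists (setT, [set n | forall x, 0 <= x -> `|W n x - U n x| <= e / 2]) => //=;
    [split => //; exact: filterT|move=> [y' n] /= []].
apply: filterS2 h1 h3 => -[y' n] /= a1 a2.
have -> : w y - U n `|y'| = (w y - W n `|y'|) + (W n `|y'| - U n `|y'|) by ring.
by apply: le_trans (ler_normD _ _) _; rewrite (splitr e) lerD// a2.
Qed.

Let G n y := om ^+ 2 * W n y - source h V om (U n) y.
Let g y := V y * w y - h (w y).

Let cg : continuous g.
Proof. by apply: cont_sub; [exact: cont_mul|exact: cont_comp]. Qed.

Let GE n y : G n y = om ^+ 2 * W n `|y| - ((om ^+ 2 - V y) * U n `|y| + h (U n `|y|)).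
Proof. by rewrite /G /source Wabs Vabs. Qed.

Let jG : joint_limit F G g.
Proof.
move=> y; have -> : g y = om ^+ 2 * w y - ((om ^+ 2 - V y) * w y + h (w y)).
  by rewrite /g; ring.
rewrite [X in X @ _ --> _](_ : _ = fun z : R * nat => om ^+ 2 * W z.2 `|z.1| -
   ((om ^+ 2 - V z.1) * U z.2 `|z.1| + h (U z.2 `|z.1|))); last first.
  by apply/funext => z; exact: GE.
apply: cvgB; first by apply: cvgMl_tmp; exact: jW.
apply: cvgD; last first.
  by apply: (@cvg_comp _ _ _ (fun z : R * nat => U z.2 `|z.1|) h _ (nbhs (w y)));
    [exact: jU|exact: ch].
apply: cvgM; last exact: jU.
apply: cvgB; first exact: cvg_cst.
by apply: (@cvg_comp _ _ _ fst V _ (nbhs y)); [exact: cvg_fst|exact: cV].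
Qed.

Let cG n : continuous (G n).
Proof.
have [hv _ _ _] := it_W it n; have [hu _ _ _] := it_adm it n.
have cUa : continuous (fun y => U n `|y|).
  by apply: cont_comp; [exact: has_deriv_continuous hu|exact: norm_continuous].
rewrite (_ : G n = fun y => om ^+ 2 * W n y - ((om ^+ 2 - V y) * U n `|y| + h (U n `|y|))).
  apply: cont_sub; first by apply: cont_scale; exact: has_deriv_continuous hv.
  apply: cont_add; last exact: cont_comp.
  by apply: cont_mul => //; apply: cont_sub => //; exact: cont_cst.
by apply/funext => y; rewrite GE Wabs.
Qed.

Let luG : locally_uniform F G g.
Proof. exact: locally_uniform_joint. Qed.

Let DWE n x : 0 <= x -> DW n x = prim (G n) x.
Proof.
move=> x0; rewrite (prim_eq (@cG n) x0 (F := DW n)) ?(it_DW0 it) ?subr0//.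
by move=> y _; exact: (it_ode it).
Qed.

Let luDW : locally_uniform F DW (prim g).
Proof.
move=> X e e0; have lu := @locally_uniform_prim R F FF G g cG cg luG.
by have := lu X e e0; apply: filterS => n hn y yX; rewrite DWE ?hn//; case/andP: yX.
Qed.

Let cDW n : continuous (DW n). Proof. exact: has_deriv_continuous (it_ode it n). Qed.

Let cpg : continuous (prim g). Proof. exact: has_deriv_continuous (primD cg). Qed.

(* The equation passes to the limit in integrated form. *)
Let wE : w = fun x => w 0 + prim (prim g) x.
Proof.
have pos x : 0 <= x -> w x = w 0 + prim (prim g) x.
  move=> x0; apply/eqP; rewrite -subr_eq0; apply/eqP.
  have l1 := locally_uniform_cvg (locally_uniform_prim cDW cpg luDW) x0.
  have l2 : (W n x - (W n 0 + prim (DW n) x)) @[n --> F] -->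
      w x - (w 0 + prim (prim g) x).
    by apply: cvgB; [exact: Ww|apply: cvgD; [exact: Ww|exact: l1]].
  apply: (cvgR_unique FF l2).
  rewrite [X in X @ _ --> _](_ : _ = fun=> 0); first exact: cvg_cst.
  apply/funext => n; rewrite (prim_eq (@cDW n) x0 (F := W n)); first by ring.
  by have [hv _ _ _] := it_W it n => y _; exact: hv.
apply/funext => x; have [x0|/ltW x0] := leP 0 x; first exact: pos.
rewrite -we pos ?oppr_ge0// prim_even// => y; apply: prim_odd => // z.
by rewrite /g Ve we.
Qed.

Let slope x : 0 <= x -> `|prim g x| <= om * w x.
Proof.
move=> x0.
have l1 : `|DW n x| @[n --> F] --> `|prim g x|.
  by apply: cvg_norm; exact: locally_uniform_cvg luDW x0.
have l2 : (om * W n x) @[n --> F] --> om * w x by apply: cvgMl_tmp.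
by apply: (ler_cvg_to l1 l2); near=> n; exact: (it_slope it).
Unshelve. all: by end_near. Qed.

(* Gronwall for |v'| <= om v. *)
Let harnack n x y : 0 <= x -> 0 <= y -> W n y * expR (- om * `|x - y|) <= W n x.
Proof.
move=> x0 y0; have [hv _ _ _] := it_W it n.
have [xy|/ltW yx] := leP x y.
  have d1 : has_deriv (fun z => - (expR (- om * z) * W n z))
      (fun z => expR (- om * z) * (om * W n z - DW n z)).
    move=> z; have d := hv z; have d' := is_derive_expRM (- om) z.
    by apply: is_derive_eq; rewrite ?scaleRE; ring.
  have := le_of_has_deriv d1 xy.
  have k : forall z, x < z < y -> 0 <= expR (- om * z) * (om * W n z - DW n z).
    move=> z /andP[xz _]; rewrite mulr_ge0 ?expR_ge0// subr_ge0.
    by apply: le_trans (ler_norm _) _; apply: (it_slope it); exact: le_trans (ltW xz).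
  move=> /(_ k); rewrite lerN2 => hh.
  rewrite distrC ger0_norm ?subr_ge0//.
  have -> : expR (- om * (y - x)) = expR (- om * y) / expR (- om * x).
    by rewrite -expRN -expRD; congr expR; ring.
  rewrite mulrA ler_pdivrMr ?expR_gt0//; move: hh; lra.
have d1 : has_deriv (fun z => expR (om * z) * W n z)
    (fun z => expR (om * z) * (om * W n z + DW n z)).
  move=> z; have d := hv z; have d' := is_derive_expRM om z.
  by apply: is_derive_eq; rewrite ?scaleRE; ring.
have := le_of_has_deriv d1 yx.
have k : forall z, y < z < x -> 0 <= expR (om * z) * (om * W n z + DW n z).
  move=> z /andP[xz _]; rewrite mulr_ge0 ?expR_ge0//.
  have := it_slope it n (le_trans y0 (ltW xz)).
  by rewrite ler_norml => /andP[]; lra.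
move=> /(_ k) hh.
rewrite ger0_norm ?subr_ge0//.
have -> : expR (- om * (x - y)) = expR (om * y) / expR (om * x).
  by rewrite -expRN -expRD; congr expR; ring.
rewrite mulrA ler_pdivrMr ?expR_gt0//; move: hh; lra.
Qed.

Let w_gt0 x : 0 < w x.
Proof.
wlog x0 : x / 0 <= x.
  by move=> H; have [/H//|/ltW x0] := leP 0 x; rewrite -we H// oppr_ge0.
have L0 : 0 <= L by have [z /andP[z0 zL] _] := Usg 0; exact: le_trans zL.
apply: (@lt_le_trans _ _ (sg / 2 * expR (- om * (x + L)))).
  by rewrite mulr_gt0 ?expR_gt0// divr_gt0.
apply: (cvgr_to_ge (@Ww x)).
have sg2 : 0 < sg / 2 by rewrite divr_gt0.
have h2 := FN (W_sub_U p2 b1 bp ch hb cV V00 V0V om0 Vom it E0P sg2).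
apply: filterS h2 => n hn.
have [z /andP[z0 zL] sz] := Usg n.
apply: le_trans (harnack n x0 z0).
have h3 : sg / 2 <= W n z.
  by have := hn z z0; rewrite ler_norml => /andP[]; lra.
apply: ler_pM; rewrite ?expR_ge0 ?(ltW sg2)// ler_expR !mulNr lerN2 ler_wpM2l ?(ltW om0)//.
by rewrite ler_norml; lra.
Qed.

Let w_le x : w x <= sup_bound p b V0 E0.
Proof.
wlog x0 : x / 0 <= x.
  by move=> H; have [/H//|/ltW x0] := leP 0 x; rewrite -we H// oppr_ge0.
have l : U n x @[n --> F] --> w x.
  have lu : locally_uniform F (fun n y => U n `|y|) w by exact: locally_uniform_joint.
  have l1 := @locally_uniform_cvg R F FF _ w x lu x0.
  by rewrite /= ger0_norm// in l1.
by apply: (cvgr_to_le l); near=> n; exact: (U_le p2 b1 bp ch hb cV V00 V0V Vom it E0P).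
Unshelve. all: by end_near. Qed.

Let prim_w2 X : 0 <= X -> prim (fun x => w x ^+ 2) X <= E0 / (2^-1 - b ^+ 2 / p) / V0.
Proof.
move=> X0.
have j2 : joint_limit F (fun n y => U n `|y| ^+ 2) (fun y => w y ^+ 2).
  by move=> y; apply: cvgM; exact: jU.
have cUa n : continuous (fun y => U n `|y| ^+ 2).
  have [hu _ _ _] := it_adm it n; apply: cont_sq.
  by apply: cont_comp; [exact: has_deriv_continuous hu|exact: norm_continuous].
have lu0 : locally_uniform F (fun n y => U n `|y| ^+ 2) (fun y => w y ^+ 2).
  by apply: locally_uniform_joint; [exact: cont_sq|exact: j2].
have lu := @locally_uniform_prim R F FF _ _ cUa (cont_sq cw) lu0.
have l := @locally_uniform_cvg R F FF _ _ X lu X0.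
apply: (cvgr_to_le l); near=> n.
have [_ _ cu _] := it_adm it n.
rewrite (@prim_ext _ _ (fun y => U n y ^+ 2) X)//.
- exact: (prim_U2_le p2 b1 bp ch hb cV V00 V0V Vom it E0P).
- by apply: cont_sq; exact: dec_cont.
- by move=> y y0; rewrite ger0_norm.
Unshelve. all: by end_near. Qed.

Lemma ultra_limit_solution :
  has_deriv w (prim g) /\ [/\ has_deriv (prim g) (fun x => V x * w x - h (w x)),
    (forall x, w (- x) = w x), (forall x, 0 < w x <= sup_bound p b V0 E0) &
    exists C : R, forall X, 0 <= X ->
      prim (fun x => w x ^+ 2) X <= C /\ prim (fun x => prim g x ^+ 2) X <= C].
Proof.
split.
  have hw : has_deriv (fun x => w 0 + prim (prim g) x) (prim g).
    by move=> x; have d := primD cpg x; apply: is_derive_eq; ring.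
  by move=> x; have := hw x; rewrite -wE.
split.
- exact: primD.
- exact: we.
- by move=> x; rewrite w_gt0 w_le.
- set C := E0 / (2^-1 - b ^+ 2 / p) / V0.
  exists (Num.max C (om ^+ 2 * C)) => X X0; split.
    by rewrite le_max prim_w2.
  rewrite le_max; apply/orP; right.
  apply: (@le_trans _ _ (om ^+ 2 * prim (fun x => w x ^+ 2) X)); last first.
    by rewrite ler_wpM2l ?sqr_ge0// prim_w2.
  rewrite -primZ//; last exact: cont_sq.
  apply: prim_le0 => //; [exact: cont_sq|by apply: cont_scale; exact: cont_sq|].
  move=> y /andP[/ltW y0 _]; rewrite -exprMn -[leLHS]real_normK ?num_real//.
  have omw : 0 <= om * w y by rewrite mulr_ge0// ltW.
  by rewrite lerXn2r ?nnegrE// slope.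
Qed.

End ultra.

(** The ultrafilter spares the extraction of a subsequence: each bounded
    sequence of values converges along it. *)
Lemma iterates_limit : exists w dw : R -> R,
  has_deriv w dw /\ [/\ has_deriv dw (fun x => V x * w x - h (w x)),
    (forall x, w (- x) = w x), (forall x, 0 < w x <= sup_bound p b V0 E0) &
    exists C : R, forall X, 0 <= X ->
      prim (fun x => w x ^+ 2) X <= C /\ prim (fun x => dw x ^+ 2) X <= C].
Proof.
have [F [UF FN]] := @ultraFilterLemma nat \oo _.
have ex x : exists l : R, W n x @[n --> F] --> l.
  have WS' n : 0 <= W n x <= S by rewrite (ltW (W0 n x)) WS.
  exact: (ultra_bounded_cvg UF WS').
have [w Ww] := choice ex.
exists w, (prim (fun y => V y * w y - h (w y))).
exact: (ultra_limit_solution UF FN Ww).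
Qed.

End limit.

(** * Calibration of the autonomous energy *)

Section calibration.
Context {R : realType}.
Implicit Types (r s t x y z : R).
Variable (p : R).
Hypothesis (p2 : 2 < p).

Let p20 : 0 < p - 2. Proof. have := p2; lra. Qed.

(** The first integral of the equation normalised to amplitude and rate 1:
    along the soliton, w' = - psi(w). *)
Definition psi z := Num.max 0 z * Num.sqrt (1 - ppow (p - 2) z).

Lemma psi_continuous : continuous psi.
Proof.
apply: cont_mul.
  move=> z; apply: continuous_max; [exact: cvg_cst|exact: cvg_id].
apply: cont_comp; first exact: sqrt_continuous.
by apply: cont_sub; [exact: cont_cst|exact: ppow_continuous].
Qed.

Definition Psi := prim psi.

Lemma PsiD : has_deriv Psi psi. Proof. exact: primD psi_continuous. Qed.

Lemma psiE z : 0 <= z -> psi z = z * Num.sqrt (1 - z `^ (p - 2)).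
Proof. by move=> z0; rewrite /psi ppowE// max_r. Qed.

Lemma psi_ge0 z : 0 <= psi z.
Proof. by rewrite /psi mulr_ge0 ?sqrtr_ge0// le_max lexx. Qed.

Lemma psi_sq z : 0 <= z <= 1 -> psi z ^+ 2 = z ^+ 2 * (1 - z `^ (p - 2)).
Proof.
move=> /andP[z0 z1]; rewrite psiE// exprMn sqr_sqrtr// subr_ge0.
have e : (1 : R) `^ (p - 2) = 1 by rewrite powR1.
by rewrite -[leRHS]e; apply: ge0_ler_powR; rewrite ?nnegrE ?(ltW p20)// ler01.
Qed.

Lemma Psi0 : Psi 0 = 0. Proof. exact: prim0. Qed.

Lemma Psi_le z : 0 <= z -> Psi z <= z ^+ 2 / 2.
Proof.
move=> z0.
have d : has_deriv (fun t => t ^+ 2 / 2 - Psi t) (fun t => t - psi t).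
  by move=> t; have d := PsiD t; apply: is_derive_eq; rewrite ?scaleRE; field.
have := le_of_has_deriv d z0; rewrite Psi0 expr0n mul0r subrr subr_ge0; apply.
move=> t /andP[t0 _]; rewrite subr_ge0 psiE ?(ltW t0)// ler_piMr ?(ltW t0)//.
rewrite -[leRHS]sqrtr1 ler_wsqrtr// gerBl powR_ge0//.
Qed.

(** The quotient psi(t) / t is nonincreasing. *)
Lemma Psi_ge z : 0 <= z -> z * psi z / 2 <= Psi z.
Proof.
move=> z0; set k := Num.sqrt (1 - z `^ (p - 2)).
have d : has_deriv (fun t => Psi t - k * t ^+ 2 / 2) (fun t => psi t - k * t).
  by move=> t; have d := PsiD t; apply: is_derive_eq; rewrite ?scaleRE; field.
have := le_of_has_deriv d z0; rewrite Psi0 expr0n mulr0 mul0r subrr subr_ge0.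
rewrite psiE// -/k => h.
have -> : z * (z * k) / 2 = k * z ^+ 2 / 2 by ring.
apply: h => t /andP[t0 tz]; rewrite subr_ge0 psiE ?(ltW t0)// mulrC ler_wpM2l ?(ltW t0)//.
by rewrite /k ler_wsqrtr// lerB//; apply: ge0_ler_powR; 
  rewrite ?nnegrE ?(ltW p20) ?(ltW t0) ?(ltW tz)// (le_trans (ltW t0)) ?ltW.
Qed.

Definition Psi_one := Psi 1.

Variables (b m : R).
Hypotheses (b1 : 1 <= b) (m0 : 0 < m).

Let b0 : 0 < b. Proof. exact: lt_le_trans b1. Qed.

(** Amplitude and decay rate of the solitary wave of
    -w'' + (m^2/b) w = b w^(p-1). *)
Definition peak := (p * m ^+ 2 / (2 * b ^+ 2)) `^ (p - 2)^-1.
Definition rate := m / Num.sqrt b.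

Let peak0 : 0 < peak.
Proof.
rewrite powR_gt0// divr_gt0 ?mulr_gt0 ?exprn_gt0//; have := p2; lra.
Qed.

Let rate0 : 0 < rate. Proof. by rewrite divr_gt0 ?sqrtr_gt0. Qed.

Lemma peak_gt0 : 0 < peak. Proof. exact: peak0. Qed.
Lemma rate_gt0 : 0 < rate. Proof. exact: rate0. Qed.

Lemma rate_sq : rate ^+ 2 = m ^+ 2 / b.
Proof. by rewrite /rate exprMn exprVn sqr_sqrtr// ltW. Qed.

Lemma peak_pow : peak `^ (p - 2) = p * m ^+ 2 / (2 * b ^+ 2).
Proof.
rewrite /peak -powRrM mulVf ?gt_eqF// powRr1//.
have pp : 0 <= p by have := p2; lra.
by rewrite divr_ge0// mulr_ge0// sqr_ge0.
Qed.

(** The cost, in the limiting energy, of a monotone transition from 0 to s. *)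
Definition Phi s := peak ^+ 2 * rate * Psi (s / peak).
Definition dPhi s := peak * rate * psi (s / peak).

Lemma PhiD : has_deriv Phi dPhi.
Proof.
move=> s.
have d : is_derive (s / peak) 1 Psi (psi (s / peak)) by exact: PsiD.
have d' : is_derive s 1 (fun t => t / peak) peak^-1.
  by apply: is_derive_eq; rewrite ?scaleRE; ring.
have dc : is_derive s 1 (Psi \o (fun t => t / peak)) (psi (s / peak) / peak).
  by apply: is_derive_eq; rewrite ?scaleRE; ring.
rewrite /dPhi.
have -> : Phi = (fun s => peak ^+ 2 * rate * (Psi \o (fun t => t / peak)) s) by [].
by apply: is_derive_eq; rewrite ?scaleRE; field; rewrite gt_eqF.
Qed.

Lemma Phi0 : Phi 0 = 0. Proof. by rewrite /Phi mul0r Psi0 mulr0. Qed.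

Lemma Phi_peak : Phi peak = peak ^+ 2 * rate * Psi_one.
Proof. by rewrite /Phi divff// gt_eqF. Qed.

Lemma Phi_le s : 0 <= s -> Phi s <= rate * s ^+ 2 / 2.
Proof.
move=> s0; rewrite /Phi.
have -> : rate * s ^+ 2 / 2 = peak ^+ 2 * rate * ((s / peak) ^+ 2 / 2).
  by field; rewrite gt_eqF.
rewrite ler_wpM2l//; first by rewrite mulr_ge0 ?sqr_ge0// ltW.
by apply: Psi_le; rewrite divr_ge0// ltW.
Qed.

Lemma dPhi_ge0 s : 0 <= dPhi s.
Proof. by rewrite /dPhi mulr_ge0 ?psi_ge0// mulr_ge0// ltW. Qed.

(** The first integral of the limiting equation at zero energy. *)
Lemma dPhi_sq s : 0 <= s <= peak ->
  dPhi s ^+ 2 = m ^+ 2 / b * s ^+ 2 - 2 * (b * s `^ p / p).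
Proof.
move=> /andP[s0 sp]; rewrite /dPhi exprMn psi_sq; last first.
  by rewrite divr_ge0 ?(ltW peak0)//= ler_pdivrMr// mul1r.
have [->|s_] := eqVneq s 0.
  rewrite mul0r !expr0n/= powR0 ?mul0r ?mulr0 ?mul0r ?mulr0 ?subrr//.
  by rewrite gt_eqF//; have := p2; lra.
have s0' : 0 < s by rewrite lt_def s_.
have pn : p != 0 by rewrite gt_eqF//; have := p2; lra.
have key : (s / peak) `^ (p - 2) = s `^ (p - 2) * (2 * b ^+ 2) / (p * m ^+ 2).
  have e : s `^ (p - 2) = (s / peak) `^ (p - 2) * (p * m ^+ 2 / (2 * b ^+ 2)).
    by rewrite -peak_pow -powRM ?divr_ge0 ?(ltW peak0)// divfK// gt_eqF.
  by rewrite e; field; rewrite ?pn !gt_eqF.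
rewrite key (powRp p s0') exprMn rate_sq.
by field; rewrite ?pn !gt_eqF.
Qed.

End calibration.

(** * Low energy prevents escape to infinity *)

Section escape.
Context {R : realType}.
Implicit Types (u v du dv : R -> R) (r s t x y : R) (n : nat).
Variables (p b m : R) (h : R -> R).
Hypotheses (p2 : 2 < p) (b1 : 1 < b) (m0 : 0 < m).
Hypotheses (ch : continuous h)
  (hb : forall s, 0 < s -> b^-1 * s `^ (p - 1) <= h s <= b * s `^ (p - 1))
  (hmon : forall s t, 0 < s -> s <= t -> h s / s <= h t / t).
Variables (V : R -> R) (V0 om : R).
Hypotheses (cV : continuous V) (V00 : 0 < V0) (V0V : forall x, V0 <= V x)
  (Vom : forall x, V x <= om ^+ 2).

Let b1' : 1 <= b. Proof. exact: ltW. Qed.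
Let b0 : 0 < b. Proof. exact: lt_le_trans b1'. Qed.
Let p20 : 0 < p - 2. Proof. have := p2; lra. Qed.
Let A := peak p b m.
Let A0 : 0 < A. Proof. exact: peak_gt0. Qed.

(** Up to L the energy density is nonnegative because u is small there. From L
    on it dominates |(Phi o u)'|, and Phi o u climbs from Phi(u(L)) to Phi(A)
    and comes back down to 0. *)
Lemma escape_energy u du (L x0 : R) : admissible u du ->
  (forall x, 0 <= x -> u x <= A) -> u x0 = A -> 0 <= L -> L <= x0 ->
  (forall x, L <= x -> m ^+ 2 / b <= V x) ->
  (forall x, 0 <= x <= L -> b * u x `^ (p - 2) / p <= V0 / 2) ->
  2 * Phi p b m A - Phi p b m (u L) <= energy h V u du.
Proof.
move=> au uA ux0 L0 Lx0 VL small.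
have [hu u0 cu cdu] := au.
have de := dec_energy p2 b1' ch hb cV V00 V0V Vom au.
rewrite /energy; set e := (fun x => _) in de *.
have hP : has_deriv (fun x => Phi p b m (u x)) (fun x => dPhi p b m (u x) * du x).
  move=> x; have d1 := hu x.
  have d2 : is_derive (u x) 1 (Phi p b m) (dPhi p b m (u x)) by exact: PhiD.
  have -> : (fun x => Phi p b m (u x)) = Phi p b m \o u by [].
  by apply: is_derive_eq.
have e_ge x : L <= x -> `|dPhi p b m (u x) * du x| <= e x.
  move=> Lx; have x0' : 0 <= x by exact: le_trans Lx.
  have ux : 0 <= u x <= A by rewrite (ltW (u0 x)) uA.
  have sq := dPhi_sq p2 b1' m0 ux.
  have Hl := H_le p2 ch hb (ltW (u0 x)).
  rewrite normrM (ger0_norm (dPhi_ge0 p2 b1' m0 _)) /e.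
  have hV : m ^+ 2 / b * u x ^+ 2 <= V x * u x ^+ 2 by rewrite ler_wpM2r ?sqr_ge0// VL.
  have am : dPhi p b m (u x) * `|du x| <= 2^-1 * (dPhi p b m (u x) ^+ 2 + `|du x| ^+ 2).
    have := sqr_ge0 (dPhi p b m (u x) - `|du x|); rewrite sqrrB; lra.
  rewrite real_normK ?num_real// in am.
  apply: le_trans am _; rewrite sq; move: Hl; rewrite /primitive_h; lra.
have pe := primD (dec_cont de).
have s1 : 0 <= prim e L.
  rewrite -[leLHS](prim0 e); apply: (le_of_has_deriv pe L0) => x /andP[/ltW x0' /ltW xL].
  have sm := small x; rewrite x0' xL in sm; have {}sm := sm isT.
  have Hl := H_le p2 ch hb (ltW (u0 x)); rewrite (powRp p (u0 x)) in Hl.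
  have h1 : b * u x `^ (p - 2) / p * u x ^+ 2 <= V0 / 2 * u x ^+ 2.
    by rewrite ler_wpM2r ?sqr_ge0.
  have h2 : V0 * u x ^+ 2 <= V x * u x ^+ 2 by rewrite ler_wpM2r ?sqr_ge0.
  have h3 := sqr_ge0 (du x).
  have h4 : b * (u x * u x * u x `^ (p - 2)) / p = b * u x `^ (p - 2) / p * u x ^+ 2 by ring.
  rewrite /e; move: Hl; rewrite h4 /primitive_h; lra.
have s2 : Phi p b m A - Phi p b m (u L) <= prim e x0 - prim e L.
  have d : has_deriv (fun x => prim e x - Phi p b m (u x))
      (fun x => e x - dPhi p b m (u x) * du x).
    by move=> x; have := pe x; have := hP x => d1 d2; exact: is_deriveB.
  have := le_of_has_deriv d Lx0; rewrite ux0 => hh.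
  suff : prim e L - Phi p b m (u L) <= prim e x0 - Phi p b m A by lra.
  apply: hh => x /andP[/ltW Lx _]; rewrite subr_ge0.
  by apply: le_trans (e_ge x Lx); exact: ler_norm.
have s3 : Phi p b m A <= Int e - prim e x0.
  have d : has_deriv (fun x => prim e x + Phi p b m (u x))
      (fun x => e x + dPhi p b m (u x) * du x).
    by move=> x; have := pe x; have := hP x => d1 d2; exact: is_deriveD.
  have l : (prim e x + Phi p b m (u x)) @[x --> +oo] --> Int e + Phi p b m 0.
    apply: cvgD; first exact: Int_cvg.
    apply: (@cvg_comp _ _ _ u (Phi p b m) _ (nbhs 0)); first exact: dec_cvg0.
    by apply: has_deriv_continuous; apply: PhiD.
  rewrite Phi0 addr0 in l.
  suff : prim e x0 + Phi p b m (u x0) <= Int e by rewrite ux0; lra.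
  apply: (cvgr_to_ge l); near=> y.
  apply: (le_of_has_deriv d).
    by near: y; apply: nbhs_pinfty_ge; rewrite num_real.
  move=> z /andP[/ltW xz _]; have Lz := le_trans Lx0 xz.
  have := e_ge z Lz; rewrite ler_norml => /andP[]; lra.
lra.
Unshelve. all: by end_near. Qed.

Lemma admissible_max u du : admissible u du ->
  exists2 x0 : R, 0 <= x0 & forall x, 0 <= x -> u x <= u x0.
Proof.
move=> [hu u0 cu cdu].
have /cvgrPdist_le /(_ _ (u0 0)) [X [_ hX]] := dec_cvg0 cu.
pose X' := Num.max 0 X + 1.
have mx : 0 <= Num.max 0 X by rewrite le_max lexx.
have mX : X <= Num.max 0 X by rewrite le_max lexx orbT.
have X0 : 0 <= X' by rewrite /X' addr_ge0.
have [c] := EVT_max X0 (continuous_subspaceT (dec_cont cu)).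
rewrite in_itv/= => /andP[c0 _] hc; exists c => // x x0.
have [xX|Xx] := leP x X'; first by apply: hc; rewrite in_itv/= x0.
apply: (@le_trans _ _ (u 0)); last by apply: hc; rewrite in_itv/= lexx.
have : `|0 - u x| <= u 0.
  by apply: hX; apply: le_lt_trans Xx; rewrite /X'; lra.
by rewrite sub0r normrN gtr0_norm.
Qed.

Variables (U DU W DW : nat -> R -> R) (T : nat -> R) (E0 : R).
Hypotheses (it : iterates p b h V om U DU W DW T)
  (E0P : energy h V (U 0%N) (DU 0%N) <= E0).
Hypothesis (E0lt : E0 < 2 * Phi p b m A).
Hypothesis (Vlim : V x @[x --> +oo] --> m ^+ 2).

(** An iterate that is tiny on [0, L] may be rescaled to have maximum A, which
    only lowers the energy since a balanced function tops its ray. As its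
    maximum was bounded below, the rescaled function is still tiny on [0, L],
    so its energy is nearly 2 Phi(A), above the energy of the starting point. *)
Lemma iterates_nonvanishing : exists sg L : R, 0 < sg /\
  forall n, exists2 x, 0 <= x <= L & sg <= U n x.
Proof.
have mb : 0 < m ^+ 2 - m ^+ 2 / b.
  by rewrite subr_gt0 ltr_pdivrMr// ltr_pMr// exprn_gt0.
have /cvgrPdist_le /(_ _ mb) [L1 [_ hL1]] := Vlim.
pose L := Num.max 0 L1 + 1.
have mx : 0 <= Num.max 0 L1 by rewrite le_max lexx.
have mL : L1 <= Num.max 0 L1 by rewrite le_max lexx orbT.
have L0 : 0 <= L by rewrite /L addr_ge0.
have VL x : L <= x -> m ^+ 2 / b <= V x.
  move=> Lx; have : `|m ^+ 2 - V x| <= m ^+ 2 - m ^+ 2 / b.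
    by apply: hL1; apply: lt_le_trans Lx; rewrite /L; lra.
  by rewrite ler_norml => /andP[]; lra.
pose smin := (V0 / b) `^ (p - 2)^-1.
have smin0 : 0 < smin by rewrite powR_gt0// divr_gt0.
set D := 2 * Phi p b m A - E0.
have D0 : 0 < D by rewrite subr_gt0.
have rt0 : 0 < rate b m by exact: rate_gt0.
pose th1 := (p * V0 / (2 * b)) `^ (p - 2)^-1.
have p0 : 0 < p by have := p2; lra.
have th10 : 0 < th1 by rewrite powR_gt0// divr_gt0// mulr_gt0.
pose th := Num.min (Num.min th1 (A / 2)) (Num.min 1 (D / rate b m)).
have th0 : 0 < th by rewrite /th !lt_min th10 ltr01 (divr_gt0 A0)// (divr_gt0 D0).
have thth1 : th <= th1 by rewrite /th !ge_min lexx.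
have thA : th < A by rewrite /th !gt_min; apply/orP; left; apply/orP; right; have := A0; lra.
have thPhi : rate b m * th ^+ 2 / 2 < D.
  have t1 : th <= 1 by rewrite /th !ge_min lexx orbT.
  have t2 : th <= D / rate b m by rewrite /th !ge_min lexx !orbT.
  have t3 : rate b m * th <= D by rewrite mulrC -ler_pdivlMr.
  have t4 : rate b m * th ^+ 2 <= rate b m * th.
    by rewrite ler_wpM2l ?(ltW rt0)// expr2 ler_piMr// ltW.
  lra.
have th_small t : 0 < t -> t <= th -> b * t `^ (p - 2) / p <= V0 / 2.
  move=> t0 tth.
  have : t `^ (p - 2) <= p * V0 / (2 * b).
    have -> : p * V0 / (2 * b) = th1 `^ (p - 2).
      rewrite /th1 -powRrM mulVf ?gt_eqF// powRr1//.
      by rewrite divr_ge0// ?mulr_ge0// ltW.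
    by apply: ge0_ler_powR; rewrite ?nnegrE ?(ltW p20) ?(ltW t0) ?(ltW th10)// (le_trans tth).
  move=> hh; apply: (@le_trans _ _ (b * (p * V0 / (2 * b)) / p)).
    by rewrite ler_wpM2r ?invr_ge0 ?(ltW p0)// ler_wpM2l ?(ltW b0).
  by rewrite le_eqVlt; apply/orP; left; apply/eqP; field; rewrite !gt_eqF.
exists (th * smin / A), L; split; first by rewrite divr_gt0// mulr_gt0.
move=> n; apply: contrapT => nex.
have lt_sg x : 0 <= x <= L -> U n x < th * smin / A.
  move=> xL; rewrite ltNge; apply/negP => le; apply: nex; by exists x.
have au := it_adm it n; have bu := it_bal it n.
have [x0 x00 xmax] := admissible_max au.
have [_ U0 _ _] := au.
set s := U n x0.
have s0 : 0 < s by exact: U0.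
have smins : smin <= s.
  have hV := balanced_sup p2 b1' ch hb cV V00 V0V Vom au bu s0 xmax.
  have -> : s = (s `^ (p - 2)) `^ (p - 2)^-1.
    by rewrite -powRrM mulfV ?gt_eqF// powRr1// ltW.
  apply: ge0_ler_powR; rewrite ?nnegrE ?invr_ge0 ?(ltW p20) ?powR_ge0//.
    by rewrite divr_ge0// ltW.
  by rewrite ler_pdivrMr// mulrC.
pose tau := A / s; have tau0 : 0 < tau by rewrite divr_gt0.
have at_ := admissible_scale tau0 au.
have ray := energy_ray_le p2 b1' ch hb hmon cV V00 V0V Vom au bu tau0.
have small x : 0 <= x <= L -> tau * U n x <= th.
  move=> xL; apply: (@le_trans _ _ (A / smin * (th * smin / A))).
    apply: ler_pM; rewrite ?(ltW tau0) ?(ltW (U0 x)) ?(ltW (lt_sg x xL))//.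
    by rewrite /tau ler_wpM2l ?(ltW A0)// lef_pV2 ?posrE.
  by rewrite le_eqVlt; apply/orP; left; apply/eqP; field; rewrite !gt_eqF.
have tmax x : 0 <= x -> tau * U n x <= A.
  move=> x0'; have -> : A = tau * s by rewrite /tau divfK// gt_eqF.
  by rewrite ler_wpM2l ?(ltW tau0)// xmax.
have tx0 : tau * U n x0 = A by rewrite /tau divfK// gt_eqF.
have Lx0 : L <= x0.
  rewrite leNgt; apply/negP => /ltW x0L.
  have := small x0; rewrite x00 x0L tx0 => /(_ isT).
  by rewrite leNgt thA.
have tU0 x : 0 < tau * U n x by rewrite mulr_gt0.
have := @escape_energy _ _ L x0 at_ tmax tx0 L0 Lx0 VL.
have sm : forall x, 0 <= x <= L -> b * (tau * U n x) `^ (p - 2) / p <= V0 / 2.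
  by move=> x xL; apply: th_small => //; exact: small.
move=> /(_ sm) low.
have hE := energy_le0 it E0P n.
have LL : 0 <= L <= L by rewrite L0 lexx.
have hP := Phi_le p2 b1' m0 (ltW (tU0 L)).
have sq : (tau * U n L) ^+ 2 <= th ^+ 2.
  by rewrite lerXn2r ?nnegrE ?(ltW (tU0 L)) ?(ltW th0)// small.
have sq' : rate b m * (tau * U n L) ^+ 2 <= rate b m * th ^+ 2.
  by rewrite ler_wpM2l// ltW.
have k1 := le_trans (le_trans low ray) hE.
have k2 : Phi p b m (tau * U n L) < D.
  by apply: le_lt_trans thPhi; apply: le_trans hP _; rewrite ler_wpM2r.
by move: k1; rewrite lerBlDr -lerBlDl leNgt k2.
Qed.

End escape.

(** * A soliton centred off the origin *)

Section soliton.
Context {R : realType}.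
Implicit Types (r s t x y z : R).
Variables (p m : R).
Hypotheses (p2 : 2 < p) (m0 : 0 < m).

Let p20 : 0 < p - 2. Proof. have := p2; lra. Qed.
Let p0 : 0 < p. Proof. have := p2; lra. Qed.

Let bt := (p - 2) * m / 2.
Let bt0 : 0 < bt. Proof. by rewrite /bt divr_gt0// mulr_gt0. Qed.

(* Hyperbolic cosine and sine of bt x: the soliton is a power of 1 / cosh. *)
Let ec x := (expR (bt * x) + expR (- bt * x)) / 2.
Let es x := (expR (bt * x) - expR (- bt * x)) / 2.

Let ec0 x : 0 < ec x. Proof. by rewrite divr_gt0// addr_gt0 ?expR_gt0. Qed.

Let hec : has_deriv ec (fun x => bt * es x).
Proof.
move=> x; have := is_derive_expRM bt x; have := is_derive_expRM (- bt) x => d1 d2.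
by rewrite /ec /es; apply: is_derive_eq; rewrite ?scaleRE; ring.
Qed.

Let hes : has_deriv es (fun x => bt * ec x).
Proof.
move=> x; have := is_derive_expRM bt x; have := is_derive_expRM (- bt) x => d1 d2.
by rewrite /ec /es; apply: is_derive_eq; rewrite ?scaleRE; ring.
Qed.

Let ecs x : ec x ^+ 2 - es x ^+ 2 = 1.
Proof.
rewrite /ec /es mulNr expRN; have := expR_gt0 (bt * x).
by move: (expR _) => e e0; field; rewrite gt_eqF.
Qed.

Let ecN x : ec (- x) = ec x. Proof. by rewrite /ec mulrN mulrNN mulNr addrC. Qed.
Let esN x : es (- x) = - es x. Proof. by rewrite /es mulrN mulrNN mulNr; ring. Qed.

Let es_ge0 x : 0 <= x -> 0 <= es x.
Proof.
move=> x0; rewrite divr_ge0// subr_ge0 ler_expR mulNr -subr_ge0 opprK addr_ge0//;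
  by rewrite mulr_ge0// ltW.
Qed.

Let a := peak p 1 m.
Let a0 : 0 < a. Proof. exact: peak_gt0. Qed.
Let ga := 2 / (p - 2).

Let W x := a * ec x `^ (- ga).
Let dW x := - m * W x * (es x / ec x).

Let W0 x : 0 < W x. Proof. by rewrite mulr_gt0// powR_gt0. Qed.

Let WN x : W (- x) = W x. Proof. by rewrite /W ecN. Qed.
Let dWN x : dW (- x) = - dW x.
Proof. by rewrite /dW WN ecN esN; ring. Qed.

Let ga_bt : ga * bt = m. Proof. by rewrite /ga /bt; field; rewrite gt_eqF. Qed.

Let hW : has_deriv W dW.
Proof.
move=> x; have d1 := hec x; have d2 := is_derive1_powR (- ga) (ec0 x).
have d3 : is_derive x 1 ((fun s => s `^ (- ga)) \o ec)
    (- ga * ec x `^ (- ga - 1) * (bt * es x)).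
  by apply: is_derive_eq; rewrite ?scaleRE; ring.
have -> : W = (fun y => a * ((fun s => s `^ (- ga)) \o ec) y) by [].
apply: is_derive_eq; rewrite ?scaleRE /dW /W.
rewrite (powRB1 (- ga) (ec0 x)) -ga_bt.
by field; rewrite gt_eqF.
Qed.

Let Wp2 x : W x `^ (p - 2) = p * m ^+ 2 / 2 / ec x ^+ 2.
Proof.
rewrite /W powRM ?powR_ge0 ?(ltW a0)// peak_pow// -powRrM.
have -> : - ga * (p - 2) = - 2%:R by rewrite /ga; field; rewrite gt_eqF.
by rewrite powR_invn ?(ltW (ec0 x))// expr1n mulr1.
Qed.

Let hdW : has_deriv dW (fun x => m ^+ 2 * W x - W x `^ (p - 1)).
Proof.
move=> x; have d1 := hW x; have d2 := hec x; have d3 := hes x.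
have d4 : is_derive x 1 (fun y => (ec y)^-1) (- (ec x) ^- 2 *: (bt * es x)).
  by apply: is_deriveV; rewrite gt_eqF.
rewrite /dW; apply: is_derive_eq; rewrite ?scaleRE.
rewrite -/W -/dW (powRp1 p (W0 x)) Wp2 {1}/dW.
have e1 : ec x ^+ 2 = 1 + es x ^+ 2 by have := ecs x; lra.
have e0 := ec0 x; have bE : m * p / 2 = m + bt by rewrite /bt; field.
have -> : p * m ^+ 2 / 2 / ec x ^+ 2 = m * (m + bt) / ec x ^+ 2 by rewrite -bE; field; rewrite gt_eqF.
have en : ec x != 0 by rewrite gt_eqF.
apply: (mulIf (expf_neq0 2 en)).
transitivity (m ^+ 2 * W x * es x ^+ 2 - m * W x * bt * (ec x ^+ 2 - es x ^+ 2)).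
  by field.
transitivity (m ^+ 2 * W x * ec x ^+ 2 - W x * (m * (m + bt))); last by field.
by rewrite ecs e1; ring.
Qed.

Let dW_sq x : dW x ^+ 2 = m ^+ 2 * W x ^+ 2 - 2 * (W x `^ p / p).
Proof.
rewrite (powRp p (W0 x)) Wp2 /dW.
have e1 : es x ^+ 2 = ec x ^+ 2 - 1 by have := ecs x; lra.
transitivity (m ^+ 2 * W x ^+ 2 * es x ^+ 2 / ec x ^+ 2); first by field; rewrite gt_eqF.
by rewrite e1; field; rewrite !gt_eqF.
Qed.

Let W_at0 : W 0 = a.
Proof.
rewrite /W /ec !mulr0 expR0 divff//.
by rewrite powR1 mulr1.
Qed.

Let dW_le x : `|dW x| <= m * W x.
Proof.
have h : `|es x / ec x| <= 1.
  rewrite normrM normfV (gtr0_norm (ec0 x)) ler_pdivrMr// mul1r /es /ec.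
  rewrite ler_norml; have := expR_gt0 (bt * x); have := expR_gt0 (- bt * x); lra.
rewrite /dW mulNr normrM normrN normrM (gtr0_norm m0) (gtr0_norm (W0 x)).
by rewrite ler_piMr// mulr_ge0// ltW.
Qed.

Let dW_sign x : 0 <= x -> dW x <= 0.
Proof.
move=> x0; rewrite /dW !mulNr oppr_le0.
apply: mulr_ge0; first by apply: mulr_ge0; exact: ltW.
by apply: divr_ge0; [exact: es_ge0|exact: ltW].
Qed.

Let W_le_a x : W x <= a.
Proof.
wlog x0 : x / 0 <= x.
  by move=> H; have [/H//|/ltW x0] := leP 0 x; rewrite -WN H// oppr_ge0.
rewrite -W_at0 -lerN2; apply: (@le_of_deriv_ge0 _ (fun y => - W y) (fun y => - dW y) 0 x x0).
  by move=> y _; have d := hW y; apply: is_deriveN.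
by move=> y /andP[/ltW y0 _]; rewrite oppr_ge0 dW_sign.
Qed.

Let ga0 : 0 < ga. Proof. by rewrite divr_gt0. Qed.

Let W_decay x : W x <= a * 2 `^ ga * expR (- m * x).
Proof.
rewrite -mulrA /W ler_wpM2l ?(ltW a0)//.
have -> : 2 `^ ga * expR (- m * x) = ((expR (bt * x) / 2) `^ ga)^-1.
  rewrite powRM ?expR_ge0// invfM mulrC; congr (_ * _).
    rewrite -ga_bt mulNr expRN; congr (_^-1).
    by rewrite -expRM; congr expR; ring.
  by rewrite -powRN -[2^-1]powR_inv1// -powRrM mulrNN mul1r.
rewrite powRN lef_pV2 ?posrE ?powR_gt0// ?divr_gt0 ?expR_gt0//.
apply: ge0_ler_powR; rewrite ?nnegrE ?(ltW ga0) ?(ltW (ec0 x)) ?divr_ge0 ?expR_ge0//.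
by rewrite ler_wpM2r// lerDl expR_ge0.
Qed.

(** T compares the slope at 1 with that of pure decay at rate m; its positivity
    makes the energy gain of the off-centre competitor strict. *)
Lemma soliton_profile : exists (W dW : R -> R) (C T : R),
  [/\ [/\ has_deriv W dW, has_deriv dW (fun x => m ^+ 2 * W x - W x `^ (p - 1)) &
         forall x, dW x ^+ 2 = m ^+ 2 * W x ^+ 2 - 2 * (W x `^ p / p)],
      [/\ forall x, 0 < W x, forall x, W (- x) = W x, forall x, dW (- x) = - dW x &
         W 0 = peak p 1 m],
      [/\ forall x, `|dW x| <= m * W x, forall x, 0 <= x -> dW x <= 0,
         forall x, W x <= peak p 1 m & forall x, W x <= C * expR (- m * x)] &
      0 < T /\ dW 1 = - (m * T * W 1)].
Proof.
exists W, dW, (a * 2 `^ ga), (es 1 / ec 1); split.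
- split; [exact: hW|exact: hdW|exact: dW_sq].
- split; [exact: W0|exact: WN|exact: dWN|exact: W_at0].
- split; [exact: dW_le|exact: dW_sign|exact: W_le_a|exact: W_decay].
- split; last by rewrite /dW; ring.
  rewrite divr_gt0// divr_gt0// subr_gt0 ltr_expR mulNr mulr1.
  by have := bt0; lra.
Qed.

End soliton.

Section shifted_soliton.
Context {R : realType}.
Implicit Types (r s t x y z : R).
Variables (p m : R).
Hypotheses (p2 : 2 < p) (m0 : 0 < m).
Let a := peak p 1 m.
Let a0 : 0 < a. Proof. exact: peak_gt0. Qed.

Variables (W dW : R -> R) (C T : R).
Hypotheses (hW : has_deriv W dW) (hdW : has_deriv dW (fun x => m ^+ 2 * W x - W x `^ (p - 1)))
  (dW_sq : forall x, dW x ^+ 2 = m ^+ 2 * W x ^+ 2 - 2 * (W x `^ p / p))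
  (W0 : forall x, 0 < W x) (WN : forall x, W (- x) = W x) (dWN : forall x, dW (- x) = - dW x)
  (W_at0 : W 0 = a) (dW_le : forall x, `|dW x| <= m * W x)
  (dW_sign : forall x, 0 <= x -> dW x <= 0) (W_le_a : forall x, W x <= a)
  (W_decay : forall x, W x <= C * expR (- m * x)) (dW1 : dW 1 = - (m * T * W 1)).

Let shift_deriv (F f : R -> R) y : has_deriv F f -> has_deriv (fun x => F (x - y)) (fun x => f (x - y)).
Proof.
move=> hF x; have d := hF (x - y).
have d' : is_derive x 1 (fun z => z - y) 1 by apply: is_derive_eq; rewrite subr0.
have -> : (fun x => F (x - y)) = F \o (fun z => z - y) by [].
by apply: is_derive_eq; rewrite ?scaleRE; ring.
Qed.

(** The restriction to the half-line of a soliton centred at 1. *)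
Let phi x := W (x - 1).
Let dphi x := dW (x - 1).

Let hphi : has_deriv phi dphi. Proof. exact: shift_deriv. Qed.
Let hdphi : has_deriv dphi (fun x => m ^+ 2 * phi x - phi x `^ (p - 1)).
Proof. exact: (shift_deriv 1 hdW). Qed.

Let phi0 x : 0 < phi x. Proof. exact: W0. Qed.

Let cphi : exp_decay phi.
Proof.
split; first exact: has_deriv_continuous hphi.
exists (C * expR m), m; split=> // x _.
rewrite (gtr0_norm (phi0 x)); apply: le_trans (W_decay _) _.
rewrite -[leRHS]mulrA -expRD le_eqVlt; apply/orP; left; apply/eqP; congr (_ * expR _); ring.
Qed.

Let cdphi : exp_decay dphi.
Proof.
apply: (@dec_le _ m phi) => //; first exact: has_deriv_continuous hdphi.
move=> x _; by rewrite (gtr0_norm (phi0 x)); exact: dW_le.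
Qed.

Let q := phi 0.
Let c := 2 * Phi p 1 m a.

Let q0 : 0 < q. Proof. exact: phi0. Qed.

Let qE : q = W 1. Proof. by rewrite /q /phi sub0r WN. Qed.
Let dqE : dphi 0 = m * T * q.
Proof. by rewrite /dphi sub0r dWN qE dW1 opprK. Qed.

Let dPhiW x : dPhi p 1 m (W x) = `|dW x|.
Proof.
have h := dPhi_sq p2 (lexx 1) m0 (s := W x).
have {}h : dPhi p 1 m (W x) ^+ 2 = dW x ^+ 2.
  by rewrite h ?(ltW (W0 x)) ?W_le_a// dW_sq divr1 mul1r.
rewrite -[LHS]ger0_norm ?dPhi_ge0//.
by rewrite -!sqrtr_sqr h.
Qed.

Let PW := prim (fun x => dW x ^+ 2).
Let cdW2 : continuous (fun x => dW x ^+ 2).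
Proof. by apply: cont_sq; exact: has_deriv_continuous hdW. Qed.

Let hPhiW : has_deriv (fun x => Phi p 1 m (W x)) (fun x => `|dW x| * dW x).
Proof.
move=> x; have d1 := hW x.
have d2 : is_derive (W x) 1 (Phi p 1 m) (dPhi p 1 m (W x)) by exact: PhiD.
have -> : (fun x => Phi p 1 m (W x)) = Phi p 1 m \o W by [].
by apply: is_derive_eq; rewrite dPhiW ?scaleRE; ring.
Qed.

Let PWE x : 0 <= x -> PW x = Phi p 1 m a - Phi p 1 m (W x).
Proof.
move=> x0.
have hd : half_deriv (fun x => - Phi p 1 m (W x)) (fun x => dW x ^+ 2).
  move=> y y0; have d := hPhiW y; apply: is_derive_eq.
  by rewrite ler0_norm ?dW_sign//; ring.
by rewrite /PW (prim_eq cdW2 x0 hd) W_at0; ring.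
Qed.

Let W_cvg0 : W x @[x --> +oo] --> 0.
Proof.
apply: (@squeeze_cvgr _ _ _ _ (fun=> 0) (fun x => C * expR (- m * x))).
- by near=> x; rewrite (ltW (W0 x)) W_decay.
- exact: cvg_cst.
- by rewrite -[X in _ --> X](mulr0 C); apply: cvgMl_tmp; exact: expR_cvg0.
Unshelve. all: by end_near. Qed.

Let cvg_shift1 (F : R -> R) (l : R) : F x @[x --> +oo] --> l -> F (x - 1) @[x --> +oo] --> l.
Proof.
have sh : (fun x : R => x - 1) x @[x --> +oo] --> +oo.
  apply/cvgryPge => B; near=> x.
  have : B + 1 <= x by near: x; apply: nbhs_pinfty_ge; rewrite num_real.
  by lra.
by move=> Fl; apply: (@cvg_comp _ _ _ (fun x : R => x - 1) F _ _ _ sh Fl).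
Unshelve. all: by end_near. Qed.

Let Int_dphi2 : Int (fun x => dphi x ^+ 2) = c - Phi p 1 m q.
Proof.
have hF : has_deriv (fun x => PW (x - 1)) (fun x => dphi x ^+ 2).
  exact: (shift_deriv 1 (primD cdW2)).
have lPW : PW x @[x --> +oo] --> Phi p 1 m a - Phi p 1 m 0.
  have l1 : Phi p 1 m a - Phi p 1 m (W x) @[x --> +oo] --> Phi p 1 m a - Phi p 1 m 0.
    apply: cvgB; first exact: cvg_cst.
    apply: (@cvg_comp _ _ _ W (Phi p 1 m) _ (nbhs 0)); first exact: W_cvg0.
    by apply: has_deriv_continuous; apply: PhiD.
  apply: cvg_trans l1; apply: near_eq_cvg; near=> x.
  by rewrite PWE//; near: x; apply: nbhs_pinfty_ge; rewrite num_real.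
rewrite Phi0 subr0 in lPW.
have hd : half_deriv (fun x => PW (x - 1)) (fun x => dphi x ^+ 2) by move=> y _; exact: hF.
rewrite (Int_FTC _ (cvg_shift1 lPW) hd); last by apply: cont_sq; exact: dec_cont.
rewrite /PW sub0r prim_odd//; last by move=> y; rewrite dWN sqrrN.
by rewrite -/PW PWE// -qE /c; ring.
Unshelve. all: by end_near. Qed.

(* The energy of the discarded tail x < 0, which is the gain over the whole
   soliton. *)
Let Phi_q : m * T * q ^+ 2 / 2 <= Phi p 1 m q.
Proof.
have qa : 0 <= q / a by rewrite divr_ge0 ?ltW.
have h := Psi_ge p2 qa.
have rt : 0 < rate 1 m by exact: rate_gt0.
have -> : m * T * q ^+ 2 / 2 = a ^+ 2 * rate 1 m * (q / a * psi p (q / a) / 2).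
  have h1 : dPhi p 1 m q = m * T * q.
    by rewrite [in LHS]qE dPhiW ler0_norm ?dW_sign// -dWN -dqE /dphi sub0r.
  transitivity (q * dPhi p 1 m q / 2); first by rewrite h1; ring.
  by rewrite /dPhi -/a; field; rewrite gt_eqF.
by rewrite /Phi -/a ler_wpM2l// mulr_ge0 ?sqr_ge0// ltW.
Qed.

Let Int_action : Int (fun x => 2^-1 * (dphi x ^+ 2 + m ^+ 2 * phi x ^+ 2) - phi x `^ p / p)
  <= 2 * Phi p 1 m (peak p 1 m) - m * T * q ^+ 2 / 2.
Proof.
rewrite (_ : (fun x => _) = (fun x => dphi x ^+ 2)); last first.
  apply/funext => x; have := dW_sq (x - 1); rewrite -/(dphi x) -/(phi x) => ->.
  by field; rewrite gt_eqF//; have := p2; lra.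
rewrite Int_dphi2 /c -/a; have := Phi_q; lra.
Qed.

Let Int_virial : Int (fun x => dphi x ^+ 2 + m ^+ 2 * phi x ^+ 2 - phi x `^ p) = - (m * T * q ^+ 2).
Proof.
have -> : - (m * T * q ^+ 2) = 0 - phi 0 * dphi 0 by rewrite dqE -/q; ring.
apply: (@Int_FTC _ _ (fun x => phi x * dphi x)).
- apply: cont_sub; last first.
    move=> x; apply: (@continuous_comp _ _ _ phi (fun t => t `^ p)).
      exact: dec_cont.
    apply: powR_continuous_gt0; exact: phi0.
  by apply: cont_add; [|apply: cont_scale]; apply: cont_sq; exact: dec_cont.
- exact: dec_cvg0 (dec_mul cphi cdphi).
- move=> y _; have d1 := hphi y; have d2 := hdphi y; apply: is_derive_eq.
  by rewrite ?scaleRE (powRB1 p (phi0 y)); ring.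
Qed.

Let phi_growth x : 0 <= x -> phi x <= q * expR (m * x).
Proof.
move=> x0.
have d : has_deriv (fun z => - (phi z * expR (- m * z)))
    (fun z => (m * phi z - dphi z) * expR (- m * z)).
  move=> z; have d1 := hphi z; have d2 := is_derive_expRM (- m) z.
  by apply: is_derive_eq; rewrite ?scaleRE; ring.
have := le_of_has_deriv d x0; rewrite lerN2 mulr0 expR0 mulr1 mulNr expRN -/q => hh.
rewrite -ler_pdivrMr ?expR_gt0//; apply: hh => z _.
apply: mulr_ge0; last exact: expR_ge0.
by rewrite subr_ge0; apply: le_trans (ler_norm _) _; exact: dW_le.
Qed.

Lemma shifted_soliton : exists (phi dphi : R -> R) (q : R),
  [/\ admissible phi dphi, 0 < q &
   [/\ forall x, 0 <= x -> phi x <= q * expR (m * x),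
    Int (fun x => 2^-1 * (dphi x ^+ 2 + m ^+ 2 * phi x ^+ 2) - phi x `^ p / p)
      <= 2 * Phi p 1 m (peak p 1 m) - m * T * q ^+ 2 / 2 &
    Int (fun x => dphi x ^+ 2 + m ^+ 2 * phi x ^+ 2 - phi x `^ p) = - (m * T * q ^+ 2)]].
Proof.
exists phi, dphi, q; split; last 1 first.
- split; [exact: phi_growth|exact: Int_action|exact: Int_virial].
- split; [exact: hphi|exact: phi0|exact: cphi|exact: cdphi].
- exact: q0.
Qed.

End shifted_soliton.

Section competitor_profile.
Context {R : realType}.

(** The growth bound phi <= q e^(m x) measures phi by its value at 0, which is
    what makes the perturbation comparable with the gain. *)
Lemma soliton_competitor (p m : R) : 2 < p -> 0 < m -> exists (phi dphi : R -> R) (q t : R),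
  [/\ admissible phi dphi, 0 < q, 0 < t &
   [/\ forall x, 0 <= x -> phi x <= q * expR (m * x),
    Int (fun x => 2^-1 * (dphi x ^+ 2 + m ^+ 2 * phi x ^+ 2) - phi x `^ p / p)
      <= 2 * Phi p 1 m (peak p 1 m) - m * t * q ^+ 2 / 2 &
    Int (fun x => dphi x ^+ 2 + m ^+ 2 * phi x ^+ 2 - phi x `^ p) = - (m * t * q ^+ 2)]].
Proof.
move=> p2 m0.
have [W [dW [C [T [[h1 h2 h3] [h4 h5 h6 h7] [h8 h9 h10 h11] [T0 dW1]]]]]] := soliton_profile p2 m0.
have [phi [dphi [q [h12 h13 h14]]]] :=
  shifted_soliton p2 m0 h1 h2 h3 h4 h5 h6 h7 h8 h9 h10 h11 dW1.
by exists phi, dphi, q, T; split.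
Qed.

End competitor_profile.

(** * The energy of the competitor *)

Section competitor.
Context {R : realType}.
Implicit Types (r s t x y : R).

Lemma dec_exp (C mu : R) : 0 < mu -> exp_decay (fun x => C * expR (- mu * x)).
Proof.
move=> mu0; split; first by apply: cont_scale; exact: cont_expR.
by exists `|C|, mu; split=> // x _; rewrite normrM (ger0_norm (expR_ge0 _)).
Qed.

Lemma Int_exp (C mu : R) : 0 < mu -> Int (fun x => C * expR (- mu * x)) = C / mu.
Proof.
move=> mu0.
have hd : half_deriv (fun y => - (C / mu) * expR (- mu * y)) (fun y => C * expR (- mu * y)).
  move=> y _; have d := is_derive_expRM (- mu) y; apply: is_derive_eq.
  by rewrite ?scaleRE; field; rewrite gt_eqF.
have l : (- (C / mu) * expR (- mu * y)) @[y --> +oo] --> - (C / mu) * 0.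
  by apply: cvgMl_tmp; exact: expR_cvg0.
rewrite (Int_FTC _ l hd); first by rewrite !mulr0 expR0; ring.
exact: dec_cont (dec_exp C mu0).
Qed.

(** Tangent line of s^(p/2) at 1, read at s = t^2. *)
Lemma powR_tangent (p t : R) : 2 < p -> 0 <= t -> p^-1 + 2^-1 * (t ^+ 2 - 1) <= t `^ p / p.
Proof.
move=> p2 t0; have p0 : 0 < p by lra.
pose g s := ppow (p - 1) s : R.
have cg : continuous g by apply: ppow_continuous; lra.
have gE s : 0 < s -> g s = s `^ (p - 1) by move=> s0; rewrite /g ppowE// ltW.
have hb s : 0 < s -> 1^-1 * s `^ (p - 1) <= g s <= 1 * s `^ (p - 1).
  by move=> s0; rewrite gE// invr1 mul1r lexx.
have gm s r : 0 < s -> s <= r -> g s / s <= g r / r.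
  move=> s0 sr; have r0 := lt_le_trans s0 sr.
  rewrite !gE// !(powRp1 p)// !(mulrAC _ (_ `^ _)) !divff ?gt_eqF// !mul1r.
  by apply: ge0_ler_powR; rewrite ?nnegrE ?(ltW s0) ?(ltW r0)//; lra.
have h1 := H_convex cg gm ltr01 t0.
have h2 := H_le p2 cg hb t0; rewrite mul1r in h2.
have h3 := H_ge p2 (lexx 1) cg hb (ler01 : 0 <= 1 :> R); rewrite invr1 !mul1r powR1 mul1r in h3.
have e : g 1 / 1 = 1 by rewrite gE// powR1 divr1.
rewrite e expr1n in h1; lra.
Qed.

Let competitor_arith (q1 I PY Q Yp t2 G c k b Y : R) : q1 <= I -> (2 - b) * PY <= q1 ->
  (b - 1) * PY <= t2 * (k / 8) -> Yp + 2^-1 * (t2 - 1) * Y <= PY ->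
  t2 * Q <= t2 * (Y - k + k / 2) -> 2^-1 * (Y - k) - Yp <= c - k / 2 ->
  G <= k / 8 * t2 -> 2^-1 * (t2 * Q) - I <= c - G.
Proof. by move=> *; lra. Qed.

Variables (p m : R).
Hypotheses (p2 : 2 < p) (m0 : 0 < m).
Variables (phi dphi : R -> R) (q t : R).
Hypotheses (aphi : admissible phi dphi) (q0 : 0 < q) (t0 : 0 < t)
  (phiq : forall x, 0 <= x -> phi x <= q * expR (m * x)).
Let c := 2 * Phi p 1 m (peak p 1 m).
Let k := m * t * q ^+ 2.
Hypotheses (Iphi : Int (fun x => 2^-1 * (dphi x ^+ 2 + m ^+ 2 * phi x ^+ 2) - phi x `^ p / p)
      <= c - k / 2)
  (Bphi : Int (fun x => dphi x ^+ 2 + m ^+ 2 * phi x ^+ 2 - phi x `^ p) = - k).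

Let p20 : 0 < p - 2. Proof. have := p2; lra. Qed.
Let p0 : 0 < p. Proof. have := p2; lra. Qed.
Let k0 : 0 < k. Proof. by rewrite /k mulr_gt0 ?mulr_gt0 ?exprn_gt0. Qed.

Let Y := power_mass p phi.
Let D := Int (fun x => dphi x ^+ 2).
Hypothesis (D0 : 0 < D).

Let Y0 : 0 < Y. Proof. exact: (power_mass_gt0 p2 aphi). Qed.

(** The last factor is a lower bound for the square of the scaling that
    balances the competitor. *)
Definition gain := m * t * q ^+ 2 / 8 * ((D / (2 * Y)) `^ (p - 2)^-1) ^+ 2.

Lemma gain_gt0 : 0 < gain.
Proof. by rewrite mulr_gt0 ?divr_gt0 ?exprn_gt0// powR_gt0// divr_gt0// mulr_gt0. Qed.

Variables (b : R) (h : R -> R).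
Hypotheses (b1 : 1 < b) (b2 : b < 2) (bY : (b - 1) * Y / p < k / 16).
Hypotheses (ch : continuous h)
  (hb : forall s, 0 < s -> b^-1 * s `^ (p - 1) <= h s <= b * s `^ (p - 1)).
Variables (V : R -> R) (V0 om ka al : R).
Hypotheses (cV : continuous V) (V00 : 0 < V0) (V0V : forall x, V0 <= V x)
  (Vom : forall x, V x <= om ^+ 2)
  (ka0 : 0 < ka) (al2 : 2 * m < al)
  (Vka : forall x, 0 <= x -> V x <= m ^+ 2 + ka * expR (- al * x))
  (kal : ka / (al - 2 * m) <= m * t / 2).

Let b1' : 1 <= b. Proof. exact: ltW. Qed.

Let cphi : exp_decay phi. Proof. by case: aphi. Qed.
Let cdphi : exp_decay dphi. Proof. by case: aphi. Qed.
Let phi0 x : 0 < phi x. Proof. by case: aphi. Qed.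

Let X := Int (fun x => dphi x ^+ 2 + m ^+ 2 * phi x ^+ 2).

Let dX : exp_decay (fun x => dphi x ^+ 2 + m ^+ 2 * phi x ^+ 2).
Proof. by apply: dec_add; [|apply: dec_scale]; exact: dec_sq. Qed.

Let dY : exp_decay (fun x => phi x `^ p).
Proof. by apply: dec_powR => //; have := p2; lra. Qed.

Let XY : X = Y - k.
Proof. by have := Bphi; rewrite IntB// -/X; rewrite /Y /power_mass; lra. Qed.

Let XYp : 2^-1 * X - Y / p <= c - k / 2.
Proof.
have := Iphi; rewrite IntB; [|exact: dec_scale|].
  rewrite IntZ// -/X; under [X in _ - Int X]eq_fun do rewrite mulrC.
  by rewrite IntZ// mulrC -/(power_mass p phi) -/Y mulrC (mulrC p^-1).
by under [X in exp_decay X]eq_fun do rewrite mulrC; exact: dec_scale.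
Qed.

(* The perturbation uses up at most half of the defect k. *)
Let quad_le : quad V phi dphi <= X + k / 2.
Proof.
have am : 0 < al - 2 * m by rewrite subr_gt0.
have de := dec_exp (ka * q ^+ 2) am.
apply: (@le_trans _ _ (X + ka * q ^+ 2 / (al - 2 * m))).
  rewrite -Int_exp// -IntD//; apply: Int_le.
  - exact: (dec_quad cV V00 V0V Vom aphi).
  - exact: dec_add.
  - move=> x x0; rewrite -addrA lerD2l.
    apply: (@le_trans _ _ ((m ^+ 2 + ka * expR (- al * x)) * phi x ^+ 2)).
      by rewrite ler_wpM2r ?sqr_ge0// Vka.
    rewrite mulrDl lerD2l -!mulrA ler_wpM2l ?(ltW ka0)//.
    have -> : expR (- (al - 2 * m) * x) = expR (- al * x) * expR (m * x) ^+ 2.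
      by rewrite expr2 -!expRD; congr expR; ring.
    have -> : q * (q * (expR (- al * x) * expR (m * x) ^+ 2)) =
      expR (- al * x) * (q * expR (m * x)) ^+ 2 by ring.
    rewrite ler_wpM2l ?expR_ge0//.
    have qe : 0 <= q * expR (m * x) by rewrite mulr_ge0 ?expR_ge0// ltW.
    by rewrite lerXn2r ?nnegrE ?(ltW (phi0 x))// phiq.
rewrite lerD2l.
have -> : ka * q ^+ 2 / (al - 2 * m) = ka / (al - 2 * m) * q ^+ 2 by ring.
have -> : k / 2 = m * t / 2 * q ^+ 2 by rewrite /k; ring.
by rewrite ler_wpM2r ?sqr_ge0.
Qed.

(** Along the ray the energy is bounded by the tangent-line inequality for
    s^(p/2), which compares it with its value at tau = 1 without solving for the
    balancing tau; the error from b <> 1 is absorbed by a fraction of k. *)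
Lemma competitor_energy (tau : R) : 0 < tau ->
  balanced h V (fun x => tau * phi x) (fun x => tau * dphi x) ->
  energy h V (fun x => tau * phi x) (fun x => tau * dphi x) <= c - gain.
Proof.
move=> tau0 bal; have at_ := admissible_scale tau0 aphi.
have /andP[lo hi] := balanced_scale_bounds p2 b1' ch hb cV V00 V0V Vom aphi tau0 bal.
rewrite -/Y in lo hi.
have b0 : 0 < b by exact: lt_trans b1.
have QY : quad V phi dphi <= Y by have := quad_le; rewrite XY; have := k0; lra.
have tp0 : 0 <= tau `^ (p - 2) by exact: powR_ge0.
have tp2 : tau `^ (p - 2) <= 2.
  have : b^-1 * tau `^ (p - 2) * Y <= 1 * Y by rewrite mul1r (le_trans lo).
  rewrite ler_pM2r// ler_pdivrMl// mulr1 => hh; apply: le_trans hh _; exact: ltW.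
have D_le : D <= quad V phi dphi.
  apply: Int_le; [exact: dec_sq|exact: (dec_quad cV V00 V0V Vom aphi)|].
  by move=> x _; rewrite lerDl mulr_ge0 ?sqr_ge0// (le_trans (ltW V00)).
have tp1 : D / (2 * Y) <= tau `^ (p - 2).
  have Y2 : 0 < 2 * Y by rewrite pmulr_rgt0.
  rewrite (ler_pdivrMr _ _ Y2); apply: le_trans D_le _; apply: le_trans hi _.
  rewrite mulrA ler_wpM2r ?(ltW Y0)// mulrC ler_wpM2l//; exact: ltW.
have tau1 : (D / (2 * Y)) `^ (p - 2)^-1 <= tau.
  have -> : tau = (tau `^ (p - 2)) `^ (p - 2)^-1.
    by rewrite -powRrM mulfV ?gt_eqF// powRr1// ltW.
  apply: ge0_ler_powR; rewrite ?nnegrE ?invr_ge0 ?(ltW p20)//.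
  by apply: divr_ge0; [exact: ltW D0|apply: mulr_ge0; [exact: ler0n|exact: ltW Y0]].
have gain_le : gain <= k / 8 * tau ^+ 2.
  rewrite /gain ler_wpM2l ?divr_ge0 ?(ltW k0)//.
  by rewrite lerXn2r ?nnegrE ?powR_ge0 ?(ltW tau0).
have IH : b^-1 * tau `^ p * Y / p <= Int (fun x => prim h (tau * phi x)).
  have -> : b^-1 * tau `^ p * Y / p = Int (fun x => b^-1 * tau `^ p / p * phi x `^ p).
    by rewrite IntZ// -/(power_mass p phi) -/Y; ring.
  apply: Int_le; [exact: dec_scale|exact: (dec_H p2 b1' ch hb at_)|].
  move=> x _; have tp : 0 <= tau * phi x by rewrite mulr_ge0 ?ltW.
  apply: le_trans (H_ge p2 b1' ch hb tp).
  by rewrite powRM ?(ltW tau0) ?(ltW (phi0 x))// mulrA (mulrAC _ p^-1).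
rewrite (energyE p2 b1' ch hb cV V00 V0V Vom at_).
rewrite (quad_scale cV V00 V0V Vom aphi).
have tan := powR_tangent p2 (ltW tau0).
set P := tau `^ p / p in tan.
have PE : P = tau ^+ 2 * tau `^ (p - 2) / p by rewrite /P (powRp p tau0).
have IH' : b^-1 * P * Y <= Int (fun x => prim h (tau * phi x)).
  by apply: le_trans IH; rewrite /P mulrA mulrAC.
have binv : 2 - b <= b^-1.
  rewrite -[b^-1]mul1r ler_pdivlMr//; have := sqr_ge0 (b - 1); rewrite sqrrB expr1n mulr1; lra.
have P0 : 0 <= P by rewrite /P divr_ge0 ?powR_ge0 ?ltW.
have PY0 : 0 <= P * Y by apply: mulr_ge0; [exact: P0|exact: ltW Y0].
have e1 : (2 - b) * (P * Y) <= b^-1 * (P * Y) by apply: ler_wpM2r; [exact: PY0|exact: binv].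
have PP : P * p = tau ^+ 2 * tau `^ (p - 2) by rewrite PE divfK// gt_eqF.
have e2 : (b - 1) * (P * Y) <= tau ^+ 2 * (k / 8).
  have -> : (b - 1) * (P * Y) = tau ^+ 2 * tau `^ (p - 2) * ((b - 1) * Y / p).
    by rewrite PE; ring.
  have bY0 : 0 <= (b - 1) * Y / p.
    by apply: divr_ge0; [apply: mulr_ge0; [rewrite subr_ge0 ltW|exact: ltW Y0]|exact: ltW p0].
  rewrite -mulrA ler_wpM2l ?sqr_ge0//.
  apply: (@le_trans _ _ (2 * (k / 16))); last by lra.
  by apply: ler_pM => //; exact: ltW.
have e3 : Y / p + 2^-1 * (tau ^+ 2 - 1) * Y <= P * Y.
  by rewrite (mulrC Y) -mulrDl; apply: ler_wpM2r; [exact: ltW Y0|exact: tan].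
have e4 : tau ^+ 2 * quad V phi dphi <= tau ^+ 2 * (X + k / 2).
  by rewrite ler_wpM2l ?sqr_ge0// quad_le.
have e5 := XYp.
rewrite XY in e4 e5.
by rewrite -(mulrA b^-1) in IH'; exact: (competitor_arith IH' e1 e2 e3 e4 e5 gain_le).
Qed.

End competitor.

(** * Even positive solutions for power-like nonlinearities *)

Section existence.
Context {R : realType}.
Implicit Types (r s t x y : R).

Lemma near_at_right (x : R) (P : R -> Prop) :
  (\forall b \near x, P b) -> \forall b \near x^'+, P b.
Proof. by move=> h; rewrite /at_right near_withinE; apply: filterS h => y Py _. Qed.

Lemma two_Phi_peak_near1 (p m e : R) : 2 < p -> 0 < m -> e < 2 * Phi p 1 m (peak p 1 m) ->
  \forall b \near (1 : R)^'+, e < 2 * Phi p b m (peak p b m).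
Proof.
move=> p2 m0; have p20 : 0 < p - 2 by lra.
rewrite (Phi_peak p2 (lexx 1) m0) => he.
have m20 : 0 < m ^+ 2 by rewrite exprn_gt0.
have p1 : (fun b => peak p b m) b @[b --> (1 : R)] --> peak p 1 m.
  apply: (@cvg_comp _ _ _ (fun b : R => p * m ^+ 2 / (2 * b ^+ 2))
    (fun s => s `^ (p - 2)^-1) _ (nbhs (p * m ^+ 2 / (2 * 1 ^+ 2)))).
    apply: cvgM; first exact: cvg_cst.
    apply: cvgV; first by rewrite expr1n mulr1 pnatr_eq0.
    by apply: cvgMl_tmp; exact: exprn_continuous.
  have p0 : 0 < p by lra.
  by apply: powR_continuous_gt0; rewrite expr1n mulr1 divr_gt0// mulr_gt0.
have r1 : (fun b => rate b m) b @[b --> (1 : R)] --> rate 1 m.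
  apply: cvgMl_tmp; apply: cvgV; first by rewrite sqrtr1.
  exact: sqrt_continuous.
have l1 : (fun b => 2 * (peak p b m ^+ 2 * rate b m * Psi_one p)) b @[b --> (1 : R)] -->
    2 * (peak p 1 m ^+ 2 * rate 1 m * Psi_one p).
  apply: cvgMl_tmp; apply: cvgMr_tmp; apply: cvgM; last exact: r1.
  by apply: cvgM; exact: p1.
have n1 := cvgr_gt _ l1 _ he.
near=> b.
rewrite (Phi_peak p2 _ m0); last by apply/ltW; near: b; exact: nbhs_right_gt.
by near: b; apply: near_at_right; exact: n1.
Unshelve. all: by end_near. Qed.

(** A function with vanishing Dirichlet integral would violate the Sobolev
    bound c u(0)^2 <= int u'^2 + c^2 int u^2 for small c. *)
Lemma dirichlet_gt0 (u du : R -> R) : admissible u du -> 0 < Int (fun x => du x ^+ 2).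
Proof.
move=> [hu u0 cu cdu].
set D := Int _; pose I := Int (fun x => u x ^+ 2).
have I0 : 0 < I by apply: Int_gt0; [exact: dec_sq|move=> x _; rewrite exprn_gt0].
pose e := u 0 ^+ 2 / (2 * I).
have := sobolev_sup e hu cu cdu (lexx 0).
rewrite IntD; [|exact: dec_sq|by apply: dec_scale; exact: dec_sq].
rewrite IntZ; last exact: dec_sq.
rewrite -/D -/I => hh.
have e0 : 0 < e * u 0 ^+ 2 - e ^+ 2 * I.
  have -> : e * u 0 ^+ 2 - e ^+ 2 * I = u 0 ^+ 4 / (4 * I) by rewrite /e; field; rewrite gt_eqF.
  by rewrite divr_gt0 ?exprn_gt0// mulr_gt0.
by lra.
Qed.

(** The constants r, b and E0 are chosen from p and m alone: first the
    competitor and its gain, then b so close to 1 that the perturbed threshold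
    2 Phi(peak) still exceeds E0. *)
Lemma even_positive_solution (p m : R) : 2 < p -> 0 < m ->
  exists r b E0 : R, [/\ 0 < r, 1 < b, b ^+ 2 < p / 2 &
  forall (h V : R -> R) (V0 ka al : R),
  continuous h ->
  (forall s, 0 < s -> b^-1 * s `^ (p - 1) <= h s <= b * s `^ (p - 1)) ->
  (forall s t, 0 < s -> s <= t -> h s / s <= h t / t) ->
  continuous V -> 0 < V0 -> (forall x, V0 <= V x) -> (forall x, V (- x) = V x) ->
  V x @[x --> +oo] --> m ^+ 2 ->
  0 < ka -> 2 * m < al -> (forall x, V x <= m ^+ 2 + ka * expR (- al * `|x|)) ->
  ka / (al - 2 * m) <= r ->
  exists w dw : R -> R,
  has_deriv w dw /\ [/\ has_deriv dw (fun x => V x * w x - h (w x)),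
    (forall x, w (- x) = w x), (forall x, 0 < w x <= sup_bound p b V0 E0) &
    exists C : R, forall X, 0 <= X ->
      prim (fun x => w x ^+ 2) X <= C /\ prim (fun x => dw x ^+ 2) X <= C]].
Proof.
move=> p2 m0.
have [phi [dphi [q [t [aphi q0 t0 [phiq Iphi Bphi]]]]]] := soliton_competitor p2 m0.
have D0 := dirichlet_gt0 aphi.
set c := 2 * Phi p 1 m (peak p 1 m) in Iphi.
pose E0 := c - gain p m phi dphi q t.
have g0 := gain_gt0 p2 m0 aphi q0 t0 D0.
pose Y := power_mass p phi.
have k0 : 0 < m * t * q ^+ 2 / 16 by rewrite divr_gt0// mulr_gt0 ?exprn_gt0// mulr_gt0.
have bex : \forall b \near (1 : R)^'+,
    [/\ 1 < b, b < 2, b ^+ 2 < p / 2 & (b - 1) * Y / p < m * t * q ^+ 2 / 16].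
  have l1 : b @[b --> (1 : R)] --> (1 : R) by exact: cvg_id.
  have l2 : (b ^+ 2) @[b --> (1 : R)] --> (1 : R) ^+ 2 by exact: exprn_continuous.
  have l3 : ((b - 1) * Y / p) @[b --> (1 : R)] --> (1 - 1) * Y / p.
    by apply: cvgMr_tmp; apply: cvgMr_tmp; apply: cvgB => //; exact: cvg_cst.
  rewrite subrr !mul0r in l3; rewrite expr1n in l2.
  have n1 := cvgr_lt _ l1 _ (ltr1n R 2 : 1 < 2 :> R).
  have n2 : \forall b \near (1 : R), b ^+ 2 < p / 2 by apply: (cvgr_lt _ l2); lra.
  have n3 := cvgr_lt _ l3 _ k0.
  near=> b; split.
  - by near: b; exact: nbhs_right_gt.
  - by near: b; apply: near_at_right; exact: n1.
  - by near: b; apply: near_at_right; exact: n2.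
  - by near: b; apply: near_at_right; exact: n3.
have E0c : E0 < c by rewrite /E0 gtrBl.
have bex2 := two_Phi_peak_near1 p2 m0 E0c.
have [b [[b1 b2 bp bY] E0lt]] := filter_ex (filterI bex bex2).
have b1' := ltW b1.
exists (m * t / 2), b, E0; split => //; first by rewrite divr_gt0// mulr_gt0.
move=> h V V0 ka al ch hb hmon cV V00 V0V Ve Vlim ka0 al2 Vka kal.
pose om := Num.sqrt (m ^+ 2 + ka + 1).
have mk0 : 0 < m ^+ 2 + ka + 1 by rewrite !addr_gt0// exprn_gt0.
have om0 : 0 < om by rewrite sqrtr_gt0.
have Vom x : V x <= om ^+ 2.
  rewrite /om sqr_sqrtr ?(ltW mk0)//; apply: le_trans (Vka x) _.
  rewrite -addrA lerD2l; apply: (@le_trans _ _ ka); last by lra.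
  rewrite ler_piMr ?(ltW ka0)// -expR0 ler_expR mulNr oppr_le0 mulr_ge0//.
  by apply: le_trans (ltW al2); rewrite mulr_ge0// ltW.
have Vka' x : 0 <= x -> V x <= m ^+ 2 + ka * expR (- al * x).
  by move=> x0; have := Vka x; rewrite ger0_norm.
have [tau tau0 bal] := balanced_scale_exists p2 b1' ch hb cV V00 V0V Vom aphi.
have en := competitor_energy p2 m0 aphi q0 t0 phiq Iphi Bphi D0 b1 b2 bY ch hb cV V00 V0V Vom
  ka0 al2 Vka' kal tau0 bal.
have at_ := admissible_scale tau0 aphi.
have [U [DU [W [DW [T [it U0E DU0E]]]]]] :=
  iterates_exist p2 b1' ch hb hmon cV V00 V0V om0 Vom at_ bal.
have E0P : energy h V (U 0%N) (DU 0%N) <= E0 by rewrite U0E DU0E.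
have [sg [L [sg0 Usg]]] :=
  iterates_nonvanishing p2 b1 m0 ch hb hmon cV V00 V0V Vom it E0P E0lt Vlim.
exact: (iterates_limit p2 b1' bp ch hb cV V00 V0V om0 Vom Ve it E0P sg0 Usg).
Unshelve. all: by end_near. Qed.

End existence.

(** * From classical to weak solutions *)

Section lebesgue_side.
Context {R : realType}.
Implicit Types (f g u du phi : R -> R) (x y K M : R).
Local Notation mu := (@lebesgue_measure R).

Definition compact_support g := exists M : R, forall x, M < `|x| -> g x = 0.

Lemma compact_support_itv g : compact_support g -> exists2 K : R, 0 < K &
  g \_ `[- K, K]%classic = g.
Proof.
move=> [M gM]; exists (Num.max 0 M + 1).
  by rewrite ltr_wpDl// le_max lexx.
apply/funext => x; rewrite patchE; case: ifPn => // xK.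
apply/esym/gM; rewrite ltNge; apply/negP => xM; move/negP : xK; apply.
rewrite inE/= in_itv/= -ler_norml; apply: le_trans xM _.
by apply: (@le_trans _ _ (Num.max 0 M)); [rewrite le_max lexx orbT|rewrite lerDl].
Qed.

Lemma compact_support_integrable g : continuous g -> compact_support g ->
  mu.-integrable setT (EFin \o g).
Proof.
move=> cg /compact_support_itv [K K0 gK].
rewrite -gK -restrict_EFin.
have mK : measurable (`[- K, K]%classic : set (measurableTypeR R)) by exact: measurable_itv.
exact: (proj1 (integrable_mkcond _ mK) (continuous_integrable_itv (- K) K cg)).
Qed.

Lemma Rintegral_deriv_compact_support G g : has_deriv G g -> continuous g ->
  compact_support G -> compact_support g -> \int[mu]_x g x = 0.
Proof.
move=> hG cg [M GM] [M' gM'].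
pose K := Num.max 0 (Num.max M M') + 1.
have mx : 0 <= Num.max 0 (Num.max M M') by rewrite le_max lexx.
have MK : M <= Num.max 0 (Num.max M M') by rewrite !le_max lexx orbT.
have M'K : M' <= Num.max 0 (Num.max M M') by rewrite !le_max lexx !orbT.
have K0 : 0 < K by rewrite /K; lra.
have gK : g \_ `[- K, K]%classic = g.
  apply/funext => x; rewrite patchE; case: ifPn => // xK.
  apply/esym/gM'; rewrite ltNge; apply/negP => xM; move/negP : xK; apply.
  by rewrite inE/= in_itv/= -ler_norml /K; lra.
have G1 : G K = 0 by apply: GM; rewrite ger0_norm ?(ltW K0)// /K; lra.
have G2 : G (- K) = 0 by apply: GM; rewrite normrN ger0_norm ?(ltW K0)// /K; lra.
rewrite -gK -Rintegral_mkcond /Rintegral.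
have KK : - K < K by lra.
rewrite (@continuous_FTC2 _ g G (- K) K KK).
- by rewrite G1 G2 -EFinB subrr.
- exact: continuous_subspaceT.
- split.
  + by move=> x _; have d := hG x; exact: ex_derive.
  + by apply: cvg_at_right_filter; exact: (has_deriv_continuous hG).
  + by apply: cvg_at_left_filter; exact: (has_deriv_continuous hG).
- by move=> x _; rewrite derive1E; have d := hG x; rewrite derive_val.
Qed.

Lemma even_square_integrable u : continuous u -> (forall x, u (- x) ^+ 2 = u x ^+ 2) ->
  (exists C : R, forall X, 0 <= X -> prim (fun x => u x ^+ 2) X <= C) -> L2 u.
Proof.
move=> cu ue [C uC]; split; first exact: measurable_realfun.continuous_measurable_fun.
pose F X := prim (fun x => u x ^+ 2) (Num.max 0 X).
have cu2 : continuous (fun x => u x ^+ 2) by exact: cont_sq.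
have hP := primD cu2.
have Fnd : nondecreasing_fun F.
  move=> x y xy; apply: (le_of_has_deriv hP).
    by rewrite ge_max !le_max lexx xy orbT.
  by move=> z _; rewrite sqr_ge0.
have Fub : has_ubound (range F) by exists C => _ [x _ <-]; apply: uC; rewrite le_max lexx.
have Fl := nondecreasing_cvgr Fnd Fub.
have Pl : prim (fun x => u x ^+ 2) x @[x --> +oo] --> sup (range F).
  apply: cvg_trans Fl; apply: near_eq_cvg; near=> x.
  by rewrite /F max_r//; near: x; apply: nbhs_pinfty_ge; rewrite num_real.
have Ih : (\int[mu]_(x in `[0%R, +oo[) (u x ^+ 2)%:E = (sup (range F))%:E - (0%:E))%E.
  rewrite (@ge0_continuous_FTC2y _ _ (prim (fun x => u x ^+ 2)) 0 (sup (range F))) ?prim0//.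
  - by move=> x _; rewrite sqr_ge0.
  - exact: continuous_subspaceT.
  - by move=> x _; have d := hP x; exact: ex_derive.
  - rewrite -{2}(prim0 (fun x => u x ^+ 2)).
    by apply: cvg_at_right_filter; exact: (has_deriv_continuous hP).
  - by move=> x _; rewrite derive1E; have d := hP x; rewrite derive_val.
have IT : (\int[mu]_x (u x ^+ 2)%:E < +oo)%E.
  rewrite ge0_symfun_integralT//.
  - by rewrite -set_itvcy Ih sube0 -EFinM ltry.
  - by move=> x; rewrite sqr_ge0.
  - by move=> x /=; rewrite ue.
rewrite /finite_norm unlock; apply: poweR_lty.
rewrite [X in (X < _)%E](_ : _ = (\int[mu]_x (u x ^+ 2)%:E)%E)//.
apply: eq_integral => x _ /=.
by rewrite powR_mulrn// real_normK ?num_real.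
Unshelve. all: by end_near. Qed.

Lemma test_function_deriv phi : test_function phi -> has_deriv phi (derive1 phi).
Proof.
move=> [dphi _] x; apply: DeriveDef; first exact: (dphi 0%N).
by rewrite derive1E.
Qed.

Lemma test_function_deriv_continuous phi : test_function phi -> continuous (derive1 phi).
Proof.
move=> [dphi _] x; apply: differentiable_continuous; apply/derivable1_diffP.
exact: (dphi 1%N x).
Qed.

Lemma test_function_support phi : test_function phi ->
  compact_support phi /\ compact_support (derive1 phi).
Proof.
move=> tp; have [_ [M pM]] := tp; split; first by exists M.
exists M => x Mx; rewrite derive1E.
have d : is_derive x 1 phi 0.
  apply: (@near_eq_is_derive _ _ _ (fun=> 0)).
  have cn : `|y| @[y --> x] --> `|x| by exact: norm_continuous.
  have n1 : \forall y \near x, M < `|y| by exact: (cvgr_gt _ cn).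
  by apply: filterS n1 => y My; rewrite pM.
by rewrite derive_val.
Qed.

Lemma compact_support_mul f g : compact_support g -> compact_support (fun x => f x * g x).
Proof. by move=> [M gM]; exists M => x Mx; rewrite gM ?mulr0. Qed.

Lemma compact_support_add f g : compact_support f -> compact_support g ->
  compact_support (fun x => f x + g x).
Proof.
move=> [M fM] [M' gM]; exists (Num.max M M') => x; rewrite gt_max => /andP[h1 h2].
by rewrite fM// gM// addr0.
Qed.

(** Each identity against a test function is the vanishing of the integral of a
    derivative with compact support. *)
Lemma classical_weak_solution (V f u du : R -> R) (lambda : R) :
  continuous V -> continuous f ->
  has_deriv u du -> has_deriv du (fun x => V x * u x - lambda * f (u x)) ->
  (forall x, u (- x) = u x) ->
  (exists C : R, forall X, 0 <= X ->
      prim (fun x => u x ^+ 2) X <= C /\ prim (fun x => du x ^+ 2) X <= C) ->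
  weak_solution V f lambda u.
Proof.
move=> cV cf hu hdu ue [C uC].
have cu := has_deriv_continuous hu; have cdu := has_deriv_continuous hdu.
have duo x : du (- x) = - du x.
  have d1 : is_derive x 1 u (- du (- x)).
    have d := hu (- x).
    have e : u = u \o -%R by apply/funext => y /=; rewrite ue.
    rewrite [X in is_derive _ _ X _]e; apply: is_derive_eq.
    by rewrite mulrN mulr1.
  have := hu x => d2.
  have := @derive_val _ _ _ _ _ _ _ d1; rewrite (@derive_val _ _ _ _ _ _ _ d2) => ->.
  by rewrite opprK.
split => //; exists du.
  split.
  - apply: even_square_integrable => //; first by move=> x; rewrite ue.
    by exists C => X X0; have [] := uC X X0.
  - apply: even_square_integrable => //; first by move=> x; rewrite duo sqrrN.
    by exists C => X X0; have [] := uC X X0.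
  - move=> phi tp; have hp := test_function_deriv tp.
    have cdp := test_function_deriv_continuous tp.
    have cp := has_deriv_continuous hp.
    have [sp sdp] := test_function_support tp.
    apply/eqP; rewrite -subr_eq0 opprK -RintegralD//; last 2 first.
    + by apply: compact_support_integrable; [exact: cont_mul|exact: compact_support_mul].
    + by apply: compact_support_integrable; [exact: cont_mul|exact: compact_support_mul].
    apply/eqP; apply: (@Rintegral_deriv_compact_support (fun x => u x * phi x)).
    + move=> x; have d1 := hu x; have d2 := hp x; apply: is_derive_eq.
      by rewrite ?scaleRE; ring.
    + by apply: cont_add; exact: cont_mul.
    + exact: compact_support_mul.
    + by apply: compact_support_add; exact: compact_support_mul.
move=> phi tp; have hp := test_function_deriv tp.
have cdp := test_function_deriv_continuous tp.
have cp := has_deriv_continuous hp.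
have [sp sdp] := test_function_support tp.
have cfu : continuous (fun x => f (u x)) by exact: cont_comp.
have s1 : compact_support (fun x => f (u x) * phi x) by exact: compact_support_mul.
have c1 : continuous (fun x => f (u x) * phi x) by exact: cont_mul.
have s2 : compact_support (fun x => du x * derive1 phi x + V x * u x * phi x).
  by apply: compact_support_add; exact: compact_support_mul.
have c2 : continuous (fun x => du x * derive1 phi x + V x * u x * phi x).
  by apply: cont_add; repeat apply: cont_mul.
rewrite -RintegralZl//; last exact: compact_support_integrable.
apply/eqP; rewrite -subr_eq0 -RintegralB//; last 2 first.
- exact: compact_support_integrable.
- apply: compact_support_integrable; first exact: cont_scale.
  exact: (compact_support_mul (fun=> lambda)).
apply/eqP; apply: (@Rintegral_deriv_compact_support (fun x => du x * phi x)).
- move=> x; have d1 := hdu x; have d2 := hp x; apply: is_derive_eq.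
  by rewrite ?scaleRE; ring.
- by apply: cont_sub => //; exact: cont_scale.
- exact: compact_support_mul.
- have [M1 hM1] := s1; have [M2 hM2] := s2; exists (Num.max M1 M2) => x.
  by rewrite gt_max => /andP[h1 h2]; rewrite hM1// hM2// mulr0 subr0.
Qed.

End lebesgue_side.

(** * Truncation and rescaling of the nonlinearity *)

Section truncation.
Context {R : realType}.
Implicit Types (s t x y L : R).
Variables (p b : R) (f : R -> R).
Hypotheses (p2 : 2 < p) (b1 : 1 < b) (cf : continuous f)
  (flim : f s / s `^ (p - 1) @[s --> 0^'+] --> (1 : R))
  (fmon : exists s2 : R, 0 < s2 /\
    (forall s t : R, 0 < s -> s <= t -> t < s2 -> f s / s <= f t / t)).

Let b0 : 0 < b. Proof. exact: lt_trans b1. Qed.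
Let p20 : 0 < p - 2. Proof. have := p2; lra. Qed.
Lemma power_like_near0 : exists d : R, [/\ 0 < d,
  (forall s, 0 < s -> s <= d -> b^-1 * s `^ (p - 1) <= f s <= b * s `^ (p - 1)) &
  (forall s t, 0 < s -> s <= t -> t <= d -> f s / s <= f t / t)].
Proof.
have [s2 [s20 hs2]] := fmon.
have bi : b^-1 < 1 by rewrite invf_lt1.
have n1 : \forall s \near 0^'+, b^-1 < f s / s `^ (p - 1) by exact: (cvgr_gt _ flim).
have n2 : \forall s \near 0^'+, f s / s `^ (p - 1) < b by exact: (cvgr_lt _ flim).
have [e /= e0 he] := filterI n1 n2.
exists (Num.min (e / 2) (s2 / 2)); split.
- by rewrite lt_min !divr_gt0.
- move=> s s0; rewrite le_min => /andP[se _].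
  have [] := he s _ s0.
    by rewrite /= sub0r normrN gtr0_norm//; have := e0; lra.
  have sp : 0 < s `^ (p - 1) by rewrite powR_gt0.
  rewrite ltr_pdivlMr// ltr_pdivrMr// => h1 h2.
  by rewrite !ltW.
- by move=> s t s0 st; rewrite le_min => /andP[_ ts]; apply: hs2 => //; lra.
Qed.

Section trunc.
Variable (d : R).
Hypotheses (d0 : 0 < d)
  (fb : forall s, 0 < s -> s <= d -> b^-1 * s `^ (p - 1) <= f s <= b * s `^ (p - 1))
  (fm : forall s t, 0 < s -> s <= t -> t <= d -> f s / s <= f t / t).

(** Continues f beyond d by the power law that agrees with it at d. *)
Definition truncated s := f (Num.min s d) * Num.max (s / d) 1 `^ (p - 1).

Let mx1 s : 1 <= Num.max (s / d) 1. Proof. by rewrite le_max lexx orbT. Qed.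
Let mx0 s : 0 < Num.max (s / d) 1. Proof. exact: lt_le_trans (mx1 s). Qed.

Lemma truncated_small s : s <= d -> truncated s = f s.
Proof.
move=> sd; rewrite /truncated min_l// max_r ?powR1 ?mulr1//.
by rewrite ler_pdivrMr// mul1r.
Qed.

Lemma truncated_continuous : continuous truncated.
Proof.
apply: cont_mul.
  apply: cont_comp => // s; apply: continuous_min; [exact: cvg_id|exact: cvg_cst].
move=> s; apply: (@continuous_comp _ _ _ (fun s => Num.max (s / d) 1) (fun t => t `^ (p - 1))).
  apply: continuous_max; last exact: cvg_cst.
  by apply: cvgMr_tmp; exact: cvg_id.
exact: powR_continuous_gt0.
Qed.

Let minmax s : 0 < s -> s = Num.min s d * Num.max (s / d) 1.
Proof.
move=> s0; have [sd|/ltW ds] := leP s d.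
  by rewrite max_r ?mulr1// ler_pdivrMr// mul1r.
rewrite max_l; last by rewrite ler_pdivlMr// mul1r.
by rewrite ?min_r// mulrC divfK// gt_eqF.
Qed.

Let min0 s : 0 < s -> 0 < Num.min s d. Proof. by move=> s0; rewrite lt_min s0. Qed.
Let mind s : Num.min s d <= d. Proof. by rewrite ge_min lexx orbT. Qed.

Lemma truncated_bounds s : 0 < s ->
  b^-1 * s `^ (p - 1) <= truncated s <= b * s `^ (p - 1).
Proof.
move=> s0.
have e : s `^ (p - 1) = Num.min s d `^ (p - 1) * Num.max (s / d) 1 `^ (p - 1).
  by rewrite -powRM ?(ltW (min0 s0)) ?(ltW (mx0 s))// -minmax.
rewrite e !mulrA /truncated.
have /andP[h1 h2] := fb (min0 s0) (mind s).
by rewrite !ler_wpM2r ?powR_ge0.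
Qed.

(** Writing s as min(s, d) times max(s/d, 1) splits truncated(s)/s into two
    nondecreasing nonnegative factors. *)
Lemma truncated_monotone s t : 0 < s -> s <= t -> truncated s / s <= truncated t / t.
Proof.
move=> s0 st; have t0 := lt_le_trans s0 st.
have E r : 0 < r -> truncated r / r =
    f (Num.min r d) / Num.min r d * Num.max (r / d) 1 `^ (p - 2).
  move=> r0; rewrite /truncated (powRp1 p (mx0 r)).
  rewrite [X in _ / X = _](minmax r0).
  by field; rewrite !gt_eqF ?mx0 ?min0.
rewrite !E//; apply: ler_pM.
- rewrite divr_ge0 ?(ltW (min0 s0))//; have /andP[h1 _] := fb (min0 s0) (mind s).
  by apply: le_trans h1; rewrite mulr_ge0 ?powR_ge0// invr_ge0 ltW.
- exact: powR_ge0.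
- apply: fm; [exact: min0| |exact: mind].
  by rewrite le_min mind andbT ge_min st.
- apply: ge0_ler_powR; rewrite ?nnegrE ?(ltW p20) ?(ltW (mx0 _))//.
  rewrite ge_max mx1 andbT le_max ler_wpM2r// invr_ge0 ltW//.
Qed.

Definition rescaled L s := L `^ (p - 1) * truncated (s / L).

Variable L : R.
Hypothesis L0 : 0 < L.

Lemma rescaled_continuous : continuous (rescaled L).
Proof.
apply: cont_scale; apply: cont_comp; first exact: truncated_continuous.
by move=> s; apply: cvgMr_tmp; exact: cvg_id.
Qed.

Lemma rescaled_bounds s : 0 < s ->
  b^-1 * s `^ (p - 1) <= rescaled L s <= b * s `^ (p - 1).
Proof.
move=> s0; have sL : 0 < s / L by rewrite divr_gt0.
have e : s `^ (p - 1) = L `^ (p - 1) * (s / L) `^ (p - 1).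
  by rewrite -powRM ?(ltW L0) ?(ltW sL)// mulrC divfK// gt_eqF.
rewrite e !(mulrCA _ (L `^ _)) /rescaled !ler_wpM2l ?powR_ge0//.
  by have /andP[] := truncated_bounds sL.
by have /andP[] := truncated_bounds sL.
Qed.

Lemma rescaled_monotone s t : 0 < s -> s <= t -> rescaled L s / s <= rescaled L t / t.
Proof.
move=> s0 st; have t0 := lt_le_trans s0 st.
have E r : 0 < r -> rescaled L r / r = L `^ (p - 2) * (truncated (r / L) / (r / L)).
  by move=> r0; rewrite /rescaled (powRp1 p L0); field; rewrite !gt_eqF.
rewrite !E// ler_wpM2l ?powR_ge0//; apply: truncated_monotone; first by rewrite divr_gt0.
by rewrite ler_wpM2r// invr_ge0 ltW.
Qed.

Lemma rescaled_small s : s <= L * d -> rescaled L s = L `^ (p - 1) * f (s / L).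
Proof. by move=> sL; rewrite /rescaled truncated_small// ler_pdivrMr// mulrC. Qed.

End trunc.
End truncation.

Theorem theorem1p6 (R : realType) (Vinf p : R) (hVinf : 0 < Vinf) (hp : 2 < p) :
  exists C0 Ct0 : R, [/\ 0 < C0, 0 < Ct0 &
    forall V f : R -> R,
      continuous V ->
      (exists V0 : R,
        [/\ 0 < V0, has_inf (range V) & inf (range V) = V0]) ->
      V x @[x --> +oo] --> Vinf ->
      V x @[x --> -oo] --> Vinf ->
      (forall x : R, V (- x) = V x) ->
      continuous f ->
      (forall s : R, s <= 0 -> f s = 0) ->
      f s / s `^ (p - 1) @[s --> 0^'+] --> (1 : R) ->
      (exists s2 : R, 0 < s2 /\
        (forall s t : R, 0 < s -> s <= t -> t < s2 -> f s / s <= f t / t)) ->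
      exists lambda0 : R, 0 < lambda0 /\
        forall alpha kappa : R,
          2 * Num.sqrt Vinf < alpha ->
          0 < kappa ->
          (forall x : R, V x <= Vinf + kappa * expR (- alpha * `|x|)) ->
          forall lambda : R,
            lambda0 <= lambda ->
            - C0 + Ct0 * kappa * alpha / (alpha ^+ 2 - 4 * Vinf) < 0 ->
            exists u : R -> R,
              [/\ weak_solution V f lambda u,
                  (forall x : R, 0 < u x) &
                  (forall x : R, u (- x) = u x)]].
Proof.
pose m := Num.sqrt Vinf.
have m0 : 0 < m by rewrite sqrtr_gt0.
have m2 : m ^+ 2 = Vinf by rewrite sqr_sqrtr// ltW.
have [r [b [E0 [r0 b1 bp core]]]] := even_positive_solution hp m0.
(* alpha^2 - 4 Vinf = (alpha - 2m)(alpha + 2m) with alpha + 2m <= 2 alpha, whence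
   the factor 2: the hypothesis bounds kappa / (alpha - 2m) by r. *)
exists r, 2; split => // V f cV [V0 [V00 Vinf_inf V0E]] Vp Vm Ve cf f0 flim fmon.
have V0V x : V0 <= V x by rewrite -V0E; apply: ge_inf; [case: Vinf_inf|exists x].
have [d [d0 fb fm]] := power_like_near0 b1 flim fmon.
pose M := sup_bound p b V0 E0.
have p20 : 0 < p - 2 by lra.
have Md0 : 0 < (`|M| + 1) / d by rewrite divr_gt0// ltr_wpDl.
(* For L >= (|M| + 1) / d the bound w <= M gives w / L <= d, where the truncation
   is inactive. *)
exists (((`|M| + 1) / d) `^ (p - 2)); split; first exact: powR_gt0.
move=> alpha kappa al2 ka0 Vka lambda lam_ge small.
have lam0 : 0 < lambda by apply: lt_le_trans lam_ge; exact: powR_gt0.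
pose L := lambda `^ (p - 2)^-1.
have L0 : 0 < L by exact: powR_gt0.
have LE : L `^ (p - 2) = lambda.
  by rewrite /L -powRrM mulVf ?gt_eqF// powRr1// ltW.
have ML : M <= L * d.
  rewrite -ler_pdivrMr//; apply: (@le_trans _ _ ((`|M| + 1) / d)).
    rewrite ler_wpM2r ?invr_ge0 ?(ltW d0)//.
    by apply: le_trans (ler_norm _) _; rewrite lerDl.
  have -> : (`|M| + 1) / d = (((`|M| + 1) / d) `^ (p - 2)) `^ (p - 2)^-1.
    by rewrite -powRrM mulfV ?gt_eqF// powRr1// ltW.
  by apply: ge0_ler_powR; rewrite ?nnegrE ?powR_ge0 ?invr_ge0 ?(ltW p20) ?(ltW lam0).
pose h := rescaled p f d L.
have kal : kappa / (alpha - 2 * m) <= r.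
  have am : 0 < alpha - 2 * m by rewrite subr_gt0.
  have ap : 0 < alpha + 2 * m by lra.
  have e : alpha ^+ 2 - 4 * Vinf = (alpha - 2 * m) * (alpha + 2 * m) by rewrite -m2; ring.
  have : 2 * kappa * alpha / ((alpha - 2 * m) * (alpha + 2 * m)) < r by rewrite -e; lra.
  move=> /ltW; apply: le_trans; rewrite ler_pdivlMr ?mulr_gt0//.
  rewrite mulrA divfK ?gt_eqF//.
  have : kappa * (alpha + 2 * m) <= kappa * (2 * alpha) by rewrite ler_wpM2l ?(ltW ka0)//; lra.
  lra.
have Vp' : V x @[x --> +oo] --> m ^+ 2 by rewrite m2.
have Vka' x : V x <= m ^+ 2 + kappa * expR (- alpha * `|x|) by rewrite m2.
have ch : continuous h by apply: rescaled_continuous.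
have hb s : 0 < s -> b^-1 * s `^ (p - 1) <= h s <= b * s `^ (p - 1).
  by apply: rescaled_bounds.
have hmon s t : 0 < s -> s <= t -> h s / s <= h t / t.
  exact: (rescaled_monotone hp b1 d0 fb fm L0).
have [w [dw [hw [hdw we wM [C wC]]]]] :=
  core h V V0 kappa alpha ch hb hmon cV V00 V0V Ve Vp' ka0 al2 Vka' kal.
have Ln : L != 0 by rewrite gt_eqF.
exists (fun x => L^-1 * w x); split; last 2 first.
- by move=> x; rewrite mulr_gt0 ?invr_gt0//; have /andP[] := wM x.
- by move=> x; rewrite we.
have cw := has_deriv_continuous hw; have cdw := has_deriv_continuous hdw.
apply: (@classical_weak_solution _ _ _ _ (fun x => L^-1 * dw x)) => //.
- by move=> x; have d1 := hw x; apply: is_derive_eq.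
- move=> x; have d1 := hdw x; apply: is_derive_eq; rewrite ?scaleRE.
  have /andP[_ wx] := wM x.
  rewrite /h rescaled_small//; last exact: le_trans ML.
  by rewrite (powRp1 p L0) LE (mulrC (w x)); field.
- by move=> x; rewrite we.
- exists (L^-1 ^+ 2 * C) => X X0; have [h1 h2] := wC X X0.
  have sq (g : R -> R) : continuous g -> prim (fun x => g x ^+ 2) X <= C ->
      prim (fun x => (L^-1 * g x) ^+ 2) X <= L^-1 ^+ 2 * C.
    move=> cg gC; under [X in prim X]eq_fun do rewrite exprMn.
    by rewrite primZ//; [rewrite ler_wpM2l ?sqr_ge0|exact: cont_sq].
  by split; exact: sq.
Qed.
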